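(* Let $d,a,b,p$ satisfy the admissibility conditions below and $q=p/(p-1)$. Let $u\in\mathcal D^{1,2}_a(\mathbb R^d)$ be nonnegative and not identically zero, set $\kappa=\big(\int_{\mathbb R^d}|u|^p|x|^{-bp}dx\big)^{1/p}$, and let $v$ be defined by $|x|^{-2a}v=\kappa^{2-p}|x|^{-bp}u^{p-1}$; assume $v\in L^q(\mathbb R^d,|x|^{-(2a-b)q}dx)\cap\mathsf L_a(\mathcal D^{1,2}_a(\mathbb R^d))$. Then \[ 0\le\Big(\int_{\mathbb R^d}\frac{|v|^q}{|x|^{(2a-b)q}}dx\Big)^{2/q}-\frac1{\mathsf C_{a,b}}\langle v,\mathsf L_a^{-1}v\rangle\le\mathsf C_{a,b}\int_{\mathbb R^d}\frac{|\nabla u|^2}{|x|^{2a}}dx-\Big(\int_{\mathbb R^d}\frac{|u|^p}{|x|^{bp}}dx\Big)^{2/p}. \]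
   Context: Let $a_c=\frac{d-2}2$, $2^*=\infty$ if $d=1,2$ and $2^*=\frac{2d}{d-2}$ if $d\ge3$. Admissibility: $d\ge1$; $p\in[2,2^*]$ if $d\ge3$, $p\in[2,2^* )$ if $d=1,2$; $b=a-a_c+d/p$; $a<a_c$; and $a\le b\le a+1$ if $d\ge3$, $a<b\le a+1$ if $d=2$, $a+\frac12<b\le a+1$ if $d=1$. $\mathcal D^{1,2}_a(\mathbb R^d)$ is the completion of $C_c^\infty(\mathbb R^d\setminus\{0\})$ w.r.t. $u\mapsto\||x|^{-a}\nabla u\|_2$. $\mathsf C_{a,b}$ is the optimal (finite) constant with $\big(\int\frac{|u|^p}{|x|^{bp}}\big)^{2/p}\le\mathsf C_{a,b}\int\frac{|\nabla u|^2}{|x|^{2a}}$ for all $u\in\mathcal D^{1,2}_a(\mathbb R^d)$. $\langle u,v\rangle=\int u\,v\,|x|^{-2a}dx$; $\mathsf L_a u=-\Delta u+2a\frac{x}{|x|^2}\cdot\nabla u$, with inverse $\mathsf L_a^{-1}$ on $\mathsf L_a(\mathcal D^{1,2}_a(\mathbb R^d))$. *)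

(* Defs.v *)
From HB Require Import structures.
From mathcomp Require Import all_boot all_order all_algebra.
From mathcomp Require Import all_classical all_reals all_analysis.
Set Implicit Arguments. Unset Strict Implicit. Unset Printing Implicit Defensive.
Import Order.TTheory GRing.Theory Num.Theory.
Import numFieldNormedType.Exports.
Local Open Scope classical_set_scope.
Local Open Scope ring_scope.

Section Defs.
Variable R : realType.

Definition sqnorm (d : nat) (x : 'rV[R]_d) : R := \sum_(i < d) (x ord0 i) ^+ 2.
Definition enorm (d : nat) (x : 'rV[R]_d) : R := Num.sqrt (sqnorm x).
Definition dotp (d : nat) (x y : 'rV[R]_d) : R := \sum_(i < d) x ord0 i * y ord0 i.

Definition wgt (d : nat) (s : R) (x : 'rV[R]_d) : R := powR (enorm x) s.

(* Lebesgue integral over R^d of a nonnegative (Borel) function, as the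
   iterated one-dimensional Lebesgue integral (Tonelli). *)
Fixpoint iint (d : nat) : ('rV[R]_d -> \bar R) -> \bar R :=
  match d return ('rV[R]_d -> \bar R) -> \bar R with
  | 0 => fun f => f 0
  | d'.+1 => fun f =>
      (\int[@lebesgue_measure R]_t
          iint (fun y : 'rV[R]_d' => f (row_mx (const_mx t : 'rV[R]_1) y)))%E
  end.

Definition nnint (d : nat) (f : 'rV[R]_d -> R) : \bar R := iint (fun x => (f x)%:E).

Definition sint (d : nat) (f : 'rV[R]_d -> R) : \bar R :=
  (nnint (fun x => Num.max (f x) 0%R) - nnint (fun x => Num.max (- f x)%R 0%R))%E.

Definition borel_fun (d : nat) (f : 'rV[R]_d -> R) : Prop :=
  forall O : set R, open O -> <<s [set: 'rV[R]_d], open >> (f @^-1` O).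

Definition not_ae_zero (d : nat) (f : 'rV[R]_d -> R) : Prop :=
  nnint (fun x => if f x == 0 then 0 else 1) != 0%E.

Definition pderiv (d : nat) (j : 'I_d) (f : 'rV[R]_d -> R) : 'rV[R]_d -> R :=
  fun x => 'D_(delta_mx ord0 j) f x.
Definition grad (d : nat) (f : 'rV[R]_d -> R) (x : 'rV[R]_d) : 'rV[R]_d :=
  \row_j pderiv j f x.

Fixpoint Ck (d : nat) (k : nat) (f : 'rV[R]_d -> R) : Prop :=
  match k with
  | 0 => continuous f
  | k'.+1 => (forall x, differentiable f x) /\ forall j : 'I_d, Ck k' (pderiv j f)
  end.
Definition smooth (d : nat) (f : 'rV[R]_d -> R) : Prop := forall k, Ck k f.

(* C_c^infinity(R^d \ {0}) : smooth with support in an annulus r <= |x| <= r' *)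
Definition testfun (d : nat) (f : 'rV[R]_d -> R) : Prop :=
  smooth f /\ exists r r' : R, 0 < r /\
    forall x, (enorm x < r \/ r' < enorm x) -> f x = 0.

(* u (with gradient G) belongs to D^{1,2}_a(R^d): u is the limit of test
   functions phi_n with grad phi_n -> G in L^2(|x|^{-2a}dx) and phi_n -> u in
   L^2(|x|^{-2(a+1)}dx) (the space in which D^{1,2}_a embeds by Hardy's
   inequality, a < a_c). *)
Definition inD (d : nat) (a : R) (u : 'rV[R]_d -> R) (G : 'rV[R]_d -> 'rV[R]_d) : Prop :=
  borel_fun u /\ (forall j : 'I_d, borel_fun (fun x => G x ord0 j)) /\
  exists phi : nat -> 'rV[R]_d -> R,
    (forall n, testfun (phi n)) /\
    ((fun n => nnint (fun x => sqnorm (grad (phi n) x - G x) * wgt (- (2 * a)) x))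
       @ \oo --> 0%E) /\
    ((fun n => nnint (fun x => (phi n x - u x) ^+ 2 * wgt (- (2 * (a + 1))) x))
       @ \oo --> 0%E).

Definition a_c (d : nat) : R := (d%:R - 2) / 2.

Definition admissible (d : nat) (a b p : R) : Prop :=
  (1 <= d)%N /\ 2 <= p /\
  ((3 <= d)%N -> p <= 2 * d%:R / (d%:R - 2)) /\
  b = a - a_c d + d%:R / p /\ a < a_c d /\
  ((3 <= d)%N -> a <= b /\ b <= a + 1) /\
  (d = 2%N -> a < b /\ b <= a + 1) /\
  (d = 1%N -> a + 2^-1 < b /\ b <= a + 1).

Definition Cab (d : nat) (a b p : R) : R :=
  fine (ereal_inf [set (C%:E) | C in
    [set C : R | forall (u : 'rV[R]_d -> R) (G : 'rV[R]_d -> 'rV[R]_d), inD a u G ->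
       ((nnint (fun x => powR `|u x| p * wgt (- (b * p)) x)%R) `^ (2 / p)%R
        <= C%:E * nnint (fun x => sqnorm (G x) * wgt (- (2 * a)) x)%R)%E]]).

End Defs.

(* Main.v *)
Require Import Defs.
From HB Require Import structures.
From mathcomp Require Import all_boot all_order all_algebra.
From mathcomp Require Import all_classical all_reals all_analysis.
From mathcomp Require Import measurable_realfun.
From mathcomp Require Import ring lra.
Import Order.TTheory GRing.Theory Num.Theory.
Import numFieldNormedType.Exports.
Local Open Scope classical_set_scope.
Local Open Scope ring_scope.

Set Implicit Arguments.
Unset Strict Implicit.
Unset Printing Implicit Defensive.

(** The quantities reduce to two pairings.  Put [h = |x|^{-2a} v], so that
    [h = kappa^{2-p} |x|^{-bp} u^{p-1}].  A computation gives
    [int h u = kappa^2], and also [(int |v|^q |x|^{-(2a-b)q})^{2/q} = kappa^2] and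
    [(int |u|^p |x|^{-bp})^{2/p} = kappa^2].  Testing the weak equation for [w]
    with [w] and with [u] yields [int h w = |Dw|^2 =: W] and
    [kappa^2 = (Dw, Du) <= (W |Du|^2)^{1/2}] (norms in [L^2(|x|^{-2a})]).
    Hoelder and the inequality with constant [C] give
    [W <= kappa (C W)^{1/2}], which is the lower bound, while
    [2 kappa^2 <= 2 (W |Du|^2)^{1/2} <= C |Du|^2 + W / C] is the upper bound.

    Extending the weak equation from test functions to [D^{1,2}_a], and the
    finiteness and positivity of [C], require the Caffarelli-Kohn-Nirenberg
    inequality itself.  For [p = 2] it is Hardy's inequality, from the
    divergence of [x |x|^{-2(a+1)} phi^2].  For larger [p] the
    Gagliardo-Nirenberg (Loomis-Whitney) argument is applied to
    [|x|^{-s} |phi|^g]: for [d >= 3] this gives the endpoint [p = 2d/(d-2)] by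
    absorption, for [d = 2] all even [p] by induction, for [d = 1] a weighted
    sup bound; the remaining exponents follow by interpolation.  The result
    passes to the completion by approximation. *)

(** The integrals of the statement are iterated one-dimensional ones. The measure [rV_measure] is
    therefore built coordinate by coordinate, so that Tonelli identifies its integral with [iint]
    and arguments along coordinate lines stay available.

    Two conventions shape the rest. The value of [wgt] at the origin is conventional ([powR] sends 0
    to 0 for every nonzero exponent), so most weight identities are proved off the origin, a null
    set, or against functions vanishing near it. And [Cab] is [fine] of an infimum, hence 0 by
    default: some finite constant valid on the whole completion must be produced first, though it
    need not be sharp.

    Dilation fixes all exponents: with [tau = |phi| |x|^{a_c-a}], each weighted L^p integral is the
    integral of [tau^p] against [|x|^{-d} dx], a measure that does not depend on p. The
    Gagliardo-Nirenberg step bounds exponent p by exponents 2 and 2g-2, where g = p(d-1)/d. For d >=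
    3 and p critical, 2g-2 is p itself; for d = 2 it is p-2; for d = 1 the choice g = 2 gives back
    Hardy's exponent 2. *)

Notation BV R d := (g_sigma_algebraType (@open 'rV[R]_d)).

(** * Measurability of prepending a coordinate *)

Section ConsRow.
Context {R : realType}.

Definition consr (d : nat) (t : R) (y : 'rV[R]_d) : 'rV[R]_d.+1 :=
  row_mx (const_mx t : 'rV[R]_1) y.

Lemma consr0 d t (y : 'rV[R]_d) : consr t y ord0 ord0 = t.
Proof.
rewrite /consr /row_mx !mxE; case: splitP => [j _|j /=]; first by rewrite mxE.
by move/eqP; rewrite eq_sym.
Qed.

Lemma consrS d t (y : 'rV[R]_d) i : consr t y ord0 (lift ord0 i) = y ord0 i.
Proof.
rewrite /consr /row_mx !mxE; case: splitP => [j /=|j /=].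
  by rewrite ord1.
by rewrite /bump /= !add1n => -[] /ord_inj ->.
Qed.

Lemma row_consr d (x : 'rV[R]_d.+1) :
  x = consr (x ord0 ord0) (\row_i x ord0 (lift ord0 i)).
Proof.
apply/rowP => i; have [->|[j ->]] : i = ord0 \/ exists j, i = lift ord0 j.
  by case: (unliftP ord0 i) => [j|] ->; [right; exists j|left].
- by rewrite consr0.
- by rewrite consrS mxE.
Qed.

Lemma ball_consr d (x : 'rV[R]_d.+1) e t (y : 'rV[R]_d) :
  ball x e (consr t y) <->
  ball (x ord0 ord0) e t /\ ball (\row_i x ord0 (lift ord0 i)) e y.
Proof.
split=> [[e0 H]|[H0 [e0 H]]].
  split; first by have := H ord0 ord0; rewrite consr0.
  by split=> // i j; have := H ord0 (lift ord0 j); rewrite consrS (ord1 i) mxE.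
split=> // i j; rewrite (ord1 i).
have [->|[k ->]] : j = ord0 \/ exists k, j = lift ord0 k.
  by case: (unliftP ord0 j) => [k|] ->; [right; exists k|left].
- by rewrite consr0; exact: H0.
- by have := H ord0 k; rewrite consrS mxE; exact.
Qed.

Let rV_ratr d (q : 'rV[rat]_d) : 'rV[R]_d := map_mx ratr q.

(** The union runs over all rational centres and radii, with the empty set in place of the balls
    that leave [O], so its countability is read off the index type. *)
Lemma open_rV_ball_rat d (O : set 'rV[R]_d) : open O ->
  O = \bigcup_(q in [set: 'rV[rat]_d * rat])
    if `[< ball (rV_ratr q.1) (ratr q.2) `<=` O >]
    then ball (rV_ratr q.1) (ratr q.2 : R) else set0.
Proof.
move=> oO; apply/seteqP; split => x; last first.
  by move=> [q _]; case: ifPn => // /asboolP; apply.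
move=> Ox.
have /nbhs_ballP[e /= e0 xeO] : nbhs x O by exact: open_nbhs_nbhs.
(* A ball of radius [r < e / 2] whose centre is within [r] of [x] contains [x] and stays inside
   [ball x e]. *)
have e40 : 0 < e / 2 by rewrite divr_gt0.
have [r re] := rat_in_itvoo e40.
have r0 : 0 < (ratr r : R) by move: re; rewrite in_itv /= => /andP[].
have [q qP] : exists q : 'rV[rat]_d, forall i, `|ratr (q ord0 i) - x ord0 i| < (ratr r : R).
  have H i : exists q : rat, `|ratr q - x ord0 i| < (ratr r : R).
    have [|q] := @rat_in_itvoo R (x ord0 i - ratr r) (x ord0 i + ratr r).
      by rewrite ltrD2l gtrN.
    by rewrite in_itv /= => /andP[h1 h2]; exists q; rewrite ltr_norml; lra.
  have [f fP] := choice H; exists (\row_i f i) => i.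
  by rewrite mxE.
exists (q, r) => //=.
have xin : ball (rV_ratr q) (ratr r : R) x.
  by split => // i j; rewrite ord1 mxE /ball /=; exact: qP.
rewrite ifT //; apply/asboolP => y [_ yq]; apply: xeO.
split => // i j; rewrite ord1 /ball /=.
have := yq ord0 j; rewrite mxE /ball /= => h1.
have h2 := qP j.
have h3 : (ratr r : R) < e / 2 by move: re; rewrite in_itv /= => /andP[].
rewrite (_ : _ - _ = (ratr (q ord0 j) - y ord0 j) - (ratr (q ord0 j) - x ord0 j)); last by ring.
apply: (le_lt_trans (ler_normB _ _)); lra.
Qed.

Lemma open_measurable_BV d (O : set 'rV[R]_d) : open O -> measurable (O : set (BV R d)).
Proof. by move=> oO; apply: sub_sigma_algebra. Qed.

(** Balls are those of the sup norm, so the preimage of a ball is a rectangle, hence measurable for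
    the product sigma-algebra. Countable unions of rational balls then reach every open set. *)
Lemma measurable_consr d :
  measurable_fun [set: R * BV R d] (fun z => consr z.1 z.2 : BV R d.+1).
Proof.
apply: (@measurability _ _ _ (BV R d.+1) _ _ (@open 'rV[R]_d.+1)) => //.
move=> _ [U oU] <-; rewrite setTI (open_rV_ball_rat oU) preimage_bigcup.
apply: countable_bigcupT_measurable; first exact: countableP.
move=> q; case: ifPn => _; last by rewrite preimage_set0.
rewrite (_ : _ @^-1` _ =
  ball (rV_ratr q.1 ord0 ord0) (ratr q.2) `*`
  (ball (\row_i rV_ratr q.1 ord0 (lift ord0 i)) (ratr q.2 : R))); last first.
  by apply/seteqP; split => -[t y] /= H; apply/ball_consr.
apply: measurableX; first by apply: open_measurable; exact: ball_open.
by apply: open_measurable_BV; exact: ball_open.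
Qed.

End ConsRow.

(** * Lebesgue measure on row vectors, one coordinate at a time *)

Section ConsMeasure.
Context {R : realType} (d : nat) (mu : {sigma_finite_measure set (BV R d) -> \bar R}).
Hypothesis muball : forall n : nat, (mu (ball (0%R : 'rV[R]_d) n.+1%:R) < +oo)%E.

Definition cons_measure : set (BV R d.+1) -> \bar R :=
  fun A => ((@lebesgue_measure R) \x mu)%E ((fun z => consr z.1 z.2) @^-1` A).

Let mE A : measurable A -> measurable ((fun z : R * BV R d => consr z.1 z.2 : BV R d.+1) @^-1` A).
Proof. by move=> mA; rewrite -[X in measurable X]setTI; exact: measurable_consr. Qed.

Let cons_measure0 : cons_measure set0 = 0%E.
Proof. by rewrite /cons_measure preimage_set0 measure0. Qed.

Let cons_measure_ge0 A : (0 <= cons_measure A)%E.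
Proof. exact: measure_ge0. Qed.

Let cons_measure_sigma_additive : semi_sigma_additive cons_measure.
Proof.
move=> F mF tF mUF; rewrite /cons_measure preimage_bigcup.
apply: measure_semi_sigma_additive.
- by move=> n; exact: mE.
- apply/trivIsetP => /= i j _ _ ij; rewrite -preimage_setI.
  by move/trivIsetP : tF => /(_ _ _ _ _ ij) ->//; rewrite preimage_set0.
- by rewrite -preimage_bigcup; exact: mE.
Qed.

HB.instance Definition _ := isMeasure.Build _ _ _
  cons_measure cons_measure0 cons_measure_ge0 cons_measure_sigma_additive.

Lemma cons_measure_ball n : (cons_measure (ball (0%R : 'rV[R]_d.+1) n.+1%:R) < +oo)%E.
Proof.
rewrite /cons_measure (_ : _ @^-1` _ = ball (0:R) n.+1%:R `*` ball (0 : 'rV[R]_d) n.+1%:R).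
  rewrite product_measure1E; last 2 first.
  - by apply: open_measurable; exact: ball_open.
  - by apply: open_measurable_BV; exact: ball_open.
  have h := @lebesgue_measure_ball R 0 n.+1%:R (ler0n _ _).
  rewrite [X in (X * _)%E](_ : _ = (n.+1%:R *+ 2)%:E); last exact: h.
  by rewrite lte_mul_pinfty ?muball ?lee_fin ?mulrn_wge0.
apply/seteqP; split => -[t y] /=.
  move/ball_consr; rewrite mxE (_ : \row_i _ = 0) //.
  by apply/rowP => i; rewrite !mxE.
move=> H; apply/ball_consr; rewrite mxE (_ : \row_i _ = 0) //.
by apply/rowP => i; rewrite !mxE.
Qed.

Let sfin : sigma_finite setT cons_measure.
Proof.
exists (fun n => ball (0%R : 'rV[R]_d.+1) n.+1%:R).
  apply/seteqP; split => // x _.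
  exists (Num.truncn `|x|) => //.
  rewrite /= -ball_normE /= sub0r normrN; exact: truncnS_gt.
move=> n; split; last exact: cons_measure_ball.
by apply: open_measurable_BV; exact: ball_open.
Qed.

HB.instance Definition _ := Measure_isSigmaFinite.Build _ _ _ cons_measure sfin.

Definition cons_sfmeasure : {sigma_finite_measure set (BV R d.+1) -> \bar R} :=
  cons_measure.

End ConsMeasure.

Section RVMeasure.
Context {R : realType}.

Definition dirac0 : set (BV R 0) -> \bar R := dirac (0 : BV R 0).
HB.instance Definition _ := Measure.on dirac0.
Lemma dirac0_ball n : (dirac0 (ball (0%R : 'rV[R]_0) n.+1%:R) < +oo)%E.
Proof. by rewrite /dirac0 diracE ltry. Qed.
Lemma dirac0_sfin : sigma_finite setT dirac0.
Proof.
exists (fun n => setT); first by rewrite bigcup_const//; exists 0%N.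
by move=> n; split => //; rewrite /dirac0 diracE ltry.
Qed.
HB.instance Definition _ := Measure_isSigmaFinite.Build _ _ _ dirac0 dirac0_sfin.

(** Finiteness on balls is carried through the recursion: it gives sigma-finiteness in the next
    dimension, and later the integrability of continuous functions with bounded support. *)
Fixpoint rV_measure_sig (d : nat) : {mu : {sigma_finite_measure set (BV R d) -> \bar R} |
    forall n : nat, (mu (ball (0%R : 'rV[R]_d) n.+1%:R) < +oo)%E} :=
  match d with
  | 0 => exist _ (dirac0 : {sigma_finite_measure set _ -> \bar R}) dirac0_ball
  | d'.+1 => let: exist mu H := rV_measure_sig d' in
     exist _ (cons_sfmeasure H)
       (@cons_measure_ball R d' mu H)
  end.

Definition rV_measure d : {sigma_finite_measure set (BV R d) -> \bar R} :=
  sval (rV_measure_sig d).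

Lemma rV_measure_ball d n : (rV_measure d (ball (0%R : 'rV[R]_d) n.+1%:R) < +oo)%E.
Proof. exact: (svalP (rV_measure_sig d)). Qed.

Lemma rV_measureS d A :
  rV_measure d.+1 A = ((@lebesgue_measure R) \x rV_measure d)%E ((fun z => consr z.1 z.2) @^-1` A).
Proof. by rewrite /rV_measure /=; case: (rV_measure_sig d). Qed.

Lemma integral_rVS d (f : BV R d.+1 -> \bar R) :
  measurable_fun setT f -> (forall x, 0 <= f x)%E ->
  (\int[rV_measure d.+1]_x f x =
   \int[@lebesgue_measure R]_t \int[rV_measure d]_y f (consr t y))%E.
Proof.
move=> mf f0.
have -> : (rV_measure d.+1 : set _ -> \bar R) =
  pushforward ((@lebesgue_measure R) \x rV_measure d)%E
    (fun z => consr z.1 z.2 : BV R d.+1).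
  by apply/funext => A; rewrite rV_measureS.
rewrite ge0_integral_pushforward//; last exact: measurable_consr.
rewrite preimage_setT fubini_tonelli1//; last by move=> z; exact: f0.
by apply: measurableT_comp => //; exact: measurable_consr.
Qed.

Lemma integral_rV0 (f : BV R 0 -> \bar R) :
  measurable_fun setT f -> (\int[rV_measure 0]_x f x = f (0%R : 'rV[R]_0))%E.
Proof.
move=> mf; rewrite [LHS](_ : _ = \int[dirac (0%R : BV R 0)]_x f x)%E //.
by rewrite integral_dirac// diracT mul1e.
Qed.

Lemma measurable_consr2 d t : measurable_fun setT (fun y : BV R d => consr t y : BV R d.+1).
Proof.
have := measurableT_comp (@measurable_consr R d) (@pair1_measurable _ _ R (BV R d) t).
by apply.
Qed.

(** Links the iterated integrals of the statement to a genuine measure, for which Hoelder, monotone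
    convergence and almost-everywhere arguments apply. *)
Lemma iintE d (f : 'rV[R]_d -> \bar R) :
  measurable_fun setT (f : BV R d -> \bar R) -> (forall x, 0 <= f x)%E ->
  iint f = (\int[rV_measure d]_x f x)%E.
Proof.
elim: d f => [|d IH] f mf f0; first by rewrite integral_rV0.
rewrite integral_rVS//=; apply: eq_integral => t _; apply: IH => [|y]; last exact: f0.
exact: (measurableT_comp mf (@measurable_consr2 d t)).
Qed.

Lemma borel_funE d (f : 'rV[R]_d -> R) :
  borel_fun f <-> measurable_fun setT (f : BV R d -> R).
Proof.
split=> [bf|mf A oA]; last first.
  by have := mf measurableT _ (measurable_realfun.open_measurable oA); rewrite setTI.
apply: (measurability _ (RGenOpens.measurableE R)).
move=> _ [_ [a [b ->]] <-]; rewrite setTI; apply: bf; exact: interval_open.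
Qed.

End RVMeasure.

(** * Integration along coordinate lines *)

Section Lines.
Context {R : realType}.

Definition upd d (x : 'rV[R]_d) (j : 'I_d) (s : R) : 'rV[R]_d :=
  \row_i if i == j then s else x ord0 i.

Lemma upd_consr0 d t (y : 'rV[R]_d) s : upd (consr t y) ord0 s = consr s y.
Proof.
apply/rowP => i; rewrite mxE; case: (unliftP ord0 i) => [k|] ->.
  by rewrite !consrS.
by rewrite eqxx consr0.
Qed.

Lemma upd_consrS d t (y : 'rV[R]_d) j s :
  upd (consr t y) (lift ord0 j) s = consr t (upd y j s).
Proof.
apply/rowP => i; rewrite mxE; case: (unliftP ord0 i) => [k|] ->.
  by rewrite !consrS mxE (inj_eq lift_inj).
by rewrite !consr0.
Qed.

Let mslice d (f : BV R d.+1 -> \bar R) : measurable_fun setT f ->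
  forall t, measurable_fun setT (fun y : BV R d => f (consr t y)).
Proof. by move=> mf t; exact: (measurableT_comp mf (@measurable_consr2 R d t)). Qed.

Let mprod d (f : BV R d.+1 -> \bar R) : measurable_fun setT f ->
  measurable_fun setT (fun z : R * BV R d => f (consr z.1 z.2)).
Proof. by move=> mf; exact: (measurableT_comp mf (@measurable_consr R d)). Qed.

Lemma integral_rVS_swap d (f : BV R d.+1 -> \bar R) :
  measurable_fun setT f -> (forall x, 0 <= f x)%E ->
  (\int[rV_measure d.+1]_x f x =
   \int[rV_measure d]_y \int[@lebesgue_measure R]_t f (consr t y))%E.
Proof.
move=> mf f0; rewrite integral_rVS//.
have h := @fubini_tonelli _ _ _ _ _ (@lebesgue_measure R) (rV_measure d)
  (fun z : R * BV R d => f (consr z.1 z.2)) (mprod mf) (fun z => f0 _).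
exact: h.
Qed.

(** Peel off leading coordinates until [j] is the leading one, then exchange the order of
    integration so that the line integral in direction [j] is computed first. *)
Lemma eq_line_integral d (j : 'I_d) (h1 h2 : BV R d -> \bar R) :
  measurable_fun setT h1 -> measurable_fun setT h2 ->
  (forall x, 0 <= h1 x)%E -> (forall x, 0 <= h2 x)%E ->
  (forall x, \int[@lebesgue_measure R]_s h1 (upd x j s) =
             \int[@lebesgue_measure R]_s h2 (upd x j s))%E ->
  (\int[rV_measure d]_x h1 x = \int[rV_measure d]_x h2 x)%E.
Proof.
elim: d j h1 h2 => [[]//|d IH] j h1 h2 m1 m2 p1 p2 e12.
case: (unliftP ord0 j) => [k|] jE.
  rewrite !integral_rVS//; apply: eq_integral => t _.
  apply: (IH k) => //; [exact: mslice|exact: mslice|move=> x].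
  have := e12 (consr t x); rewrite jE.
  by under eq_integral do rewrite upd_consrS;
    under [in RHS]eq_integral do rewrite upd_consrS.
rewrite !integral_rVS_swap//; apply: eq_integral => y _.
have := e12 (consr 0 y); rewrite jE.
by under eq_integral do rewrite upd_consr0;
   under [in RHS]eq_integral do rewrite upd_consr0.
Qed.

End Lines.

(** * Hoelder and Loomis-Whitney inequalities *)

Section Hoelder.
Context d (T : measurableType d) (R : realType) (mu : {measure set T -> \bar R}).
Local Open Scope ereal_scope.

Lemma ge0_hoelder (f g : T -> R) (p q : R) :
  measurable_fun setT f -> measurable_fun setT g ->
  (forall x, 0 <= f x)%R -> (forall x, 0 <= g x)%R ->
  (0 < p)%R -> (0 < q)%R -> (p^-1 + q^-1 = 1)%R ->
  \int[mu]_x (f x * g x)%:E <=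
  (\int[mu]_x (f x `^ p)%:E) `^ p^-1 * (\int[mu]_x (g x `^ q)%:E) `^ q^-1.
Proof.
move=> mf mg f0 g0 p0 q0 pq; have := hoelder mu mf mg p0 q0 pq.
rewrite unlock /= invr1 poweRe1; last by apply: integral_ge0.
rewrite (_ : \int[mu]_x _ = \int[mu]_x (f x * g x)%:E); last first.
  by apply: eq_integral => x _ /=; rewrite powRr1// ger0_norm// mulr_ge0.
rewrite (_ : \int[mu]_x `|(EFin \o f) x| `^ p = \int[mu]_x (f x `^ p)%:E); last first.
  by apply: eq_integral => x _ /=; rewrite ger0_norm.
rewrite (_ : \int[mu]_x `|(EFin \o g) x| `^ q = \int[mu]_x (g x `^ q)%:E) //.
by apply: eq_integral => x _ /=; rewrite ger0_norm.
Qed.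

End Hoelder.

Lemma measurable_EFin_fun d (T : measurableType d) (R : realType) (f : T -> R) :
  measurable_fun setT f -> measurable_fun setT (fun x => (f x)%:E).
Proof. by move=> mf; apply/measurable_EFinP. Qed.

Section LoomisWhitney.
Context {R : realType}.
Local Open Scope ereal_scope.

Lemma loomis_whitney1 (G F : BV R 1 -> R) :
  measurable_fun setT F -> (forall x, 0 <= F x)%R ->
  (forall j x, (G x)%:E <= \int[@lebesgue_measure R]_s (F (upd x j s))%:E) ->
  forall x, (G x)%:E <= \int[rV_measure 1]_x (F x)%:E.
Proof.
move=> mF F0 GF x; have := GF ord0 x.
rewrite integral_rVS//; last exact: measurable_EFin_fun.
move=> /le_trans; apply; rewrite le_eqVlt; apply/orP; left; apply/eqP.
apply: eq_integral => s _; rewrite integral_rV0; last first.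
  apply: measurable_EFin_fun; exact: (measurableT_comp mF (@measurable_consr2 R 0 s)).
rewrite (row_consr x) upd_consr0; congr (_ (consr _ _))%:E.
by apply/rowP => -[].
Qed.


(** A single [F] dominates in all directions, which replaces the product of d different line
    integrals. The finiteness of line integrals lets the integral in the first direction be a
    real-valued function [H]. With d the dimension, the exponent is d/(d-1), and the induction is on
    d. *)
Lemma loomis_whitney n (G F : BV R n.+2 -> R) :
  measurable_fun setT G -> measurable_fun setT F ->
  (forall x, 0 <= G x)%R -> (forall x, 0 <= F x)%R ->
  (forall j x, \int[@lebesgue_measure R]_s (F (upd x j s))%:E < +oo) ->
  (forall j x, (G x)%:E <= \int[@lebesgue_measure R]_s (F (upd x j s))%:E) ->
  \int[rV_measure n.+2]_x (G x `^ (n.+2%:R / n.+1%:R))%:E <=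
  (\int[rV_measure n.+2]_x (F x)%:E) `^ (n.+2%:R / n.+1%:R).
Proof.
elim: n G F => [|n IH] G F mG mF G0 F0 Ffin GF.
(* Dimension 2: [G^2 <= H y * It t], a product of functions of separate variables whose integrals
   are both [I]. *)
- rewrite divr1.
  pose H (y : BV R 1) := fine (\int[@lebesgue_measure R]_s (F (consr s y))%:E).
  have HE y : (H y)%:E = \int[@lebesgue_measure R]_s (F (consr s y))%:E.
    rewrite /H fineK// ge0_fin_numE; last by apply: integral_ge0 => s _; rewrite lee_fin.
    have := Ffin ord0 (consr 0 y).
    by under eq_integral do rewrite upd_consr0.
  have H0 y : (0 <= H y)%R.
    by rewrite -lee_fin HE; apply: integral_ge0 => s _; rewrite lee_fin.
  have GH t y : (G (consr t y) <= H y)%R.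
    rewrite -lee_fin HE; have := GF ord0 (consr t y).
    by under eq_integral do rewrite upd_consr0.
  have mF' : measurable_fun setT (fun z : R * BV R 1 => (F (consr z.1 z.2))%:E).
    apply: measurable_EFin_fun; exact: (measurableT_comp mF (@measurable_consr R _)).
  have mG' : measurable_fun setT
      (fun z : R * BV R 1 => (G (consr z.1 z.2) `^ 2)%:E).
    apply: measurable_EFin_fun; apply: (measurableT_comp (measurable_powR _)) => //.
    exact: (measurableT_comp mG (@measurable_consr R _)).
  have mH : measurable_fun setT (fun y => (H y)%:E).
    rewrite (_ : (fun y => _) = fun y => \int[@lebesgue_measure R]_s (F (consr s y))%:E); last first.
      by apply/funext => y /=; rewrite HE.
    apply: (@measurable_fun_fubini_tonelli_G _ _ _ _ _ (@lebesgue_measure R) _ mF') => z.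
    by rewrite lee_fin.
  pose It t := \int[rV_measure 1]_y (F (consr t y))%:E.
  have It0 t : 0 <= It t by apply: integral_ge0 => y _; rewrite lee_fin.
  have mIt : measurable_fun setT It.
    apply: (@measurable_fun_fubini_tonelli_F _ _ _ _ _ (rV_measure 1) _ mF') => z.
    by rewrite lee_fin.
  have GI t y : (G (consr t y))%:E <= It t.
    apply: (@loomis_whitney1 (fun y => G (consr t y)) (fun y => F (consr t y))) => //.
      exact: (measurableT_comp mF (@measurable_consr2 R _ t)).
    move=> j x; have := GF (lift ord0 j) (consr t x).
    by under eq_integral do rewrite upd_consrS.
  set I := \int[rV_measure 2]_x (F x)%:E.
  have I0 : 0 <= I by apply: integral_ge0 => y _; rewrite lee_fin.
  have IE : \int[rV_measure 1]_y (H y)%:E = I.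
    rewrite /I [RHS]integral_rVS_swap//; last exact: measurable_EFin_fun.
    by apply: eq_integral => y _; rewrite HE.
  have IE' : I = \int[@lebesgue_measure R]_t It t.
    rewrite /I integral_rVS//; exact: measurable_EFin_fun.
  rewrite integral_rVS//; last 2 first.
    apply: measurable_EFin_fun; apply: (measurableT_comp (measurable_powR _)) => //.
    by move=> x; rewrite lee_fin powR_ge0.
  apply: (@le_trans _ _ (\int[@lebesgue_measure R]_t (I * It t))).
    apply: ge0_le_integral => //.
    - by move=> t _; apply: integral_ge0 => y _; rewrite lee_fin powR_ge0.
    - apply: (@measurable_fun_fubini_tonelli_F _ _ _ _ _ (rV_measure 1) _ mG') => z.
      by rewrite lee_fin powR_ge0.
    - exact: measurable_funeM.
    move=> t _; rewrite -IE -ge0_integralZr//; last by move=> y _; rewrite lee_fin.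
    apply: ge0_le_integral => //.
    - by move=> y _; rewrite lee_fin powR_ge0.
    - exact: (measurableT_comp mG' (pair1_measurable _)).
    - by apply: emeasurable_funM => //; exact: measurable_cst.
    move=> y _; rewrite (powR_mulrn 2)// expr2 EFinM.
    by apply: lee_pmul; rewrite ?lee_fin.
  rewrite ge0_integralZl// -IE'.
  rewrite (_ : 2%:R = 1 + 1)%R//; have [->|In0] := eqVneq I 0.
    by rewrite mule0 poweR_ge0.
  by rewrite poweRD ?poweRe1//; exact: nneg_neq0_poweRD_def.
pose H (y : BV R n.+2) := fine (\int[@lebesgue_measure R]_s (F (consr s y))%:E).
have HE y : (H y)%:E = \int[@lebesgue_measure R]_s (F (consr s y))%:E.
  rewrite /H fineK// ge0_fin_numE; last by apply: integral_ge0 => s _; rewrite lee_fin.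
  have := Ffin ord0 (consr 0 y).
  by under eq_integral do rewrite upd_consr0.
have H0 y : (0 <= H y)%R.
  by rewrite -lee_fin HE; apply: integral_ge0 => s _; rewrite lee_fin.
have GH t y : (G (consr t y) <= H y)%R.
  rewrite -lee_fin HE; have := GF ord0 (consr t y).
  by under eq_integral do rewrite upd_consr0.
have mslice t : measurable_fun setT (fun y : BV R n.+2 => F (consr t y)).
  exact: (measurableT_comp mF (@measurable_consr2 R _ t)).
have msliceG t : measurable_fun setT (fun y : BV R n.+2 => G (consr t y)).
  exact: (measurableT_comp mG (@measurable_consr2 R _ t)).
have mH : measurable_fun setT H.
  have h := @measurable_fun_fubini_tonelli_G _ _ _ _ _ (@lebesgue_measure R)
    (fun z : R * BV R n.+2 => (F (consr z.1 z.2))%:E).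
  apply/measurable_EFinP; rewrite (_ : EFin \o H = fun y => \int[@lebesgue_measure R]_s (F (consr s y))%:E); last first.
    by apply/funext => y /=; rewrite HE.
  apply: h => //; last by move=> z; rewrite lee_fin.
  apply: measurable_EFin_fun; exact: (measurableT_comp mF (@measurable_consr R _)).
have IF0 : 0 <= \int[rV_measure n.+3]_x (F x)%:E.
  by apply: integral_ge0 => x _; rewrite lee_fin.
have IH_ : \int[rV_measure n.+2]_y (H y)%:E = \int[rV_measure n.+3]_x (F x)%:E.
  rewrite [RHS]integral_rVS_swap//; last exact: measurable_EFin_fun.
  by apply: eq_integral => y _; rewrite HE.
set I := \int[rV_measure n.+3]_x (F x)%:E in IF0 IH_ *.
rewrite integral_rVS//; last 2 first.
  apply: measurable_EFin_fun; apply: (measurableT_comp (measurable_powR _)) => //.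
  by move=> x; rewrite lee_fin powR_ge0.
pose It t := \int[rV_measure n.+2]_y (F (consr t y))%:E.
have IE : I = \int[@lebesgue_measure R]_t It t.
  rewrite /I integral_rVS//; exact: measurable_EFin_fun.
have mIt : measurable_fun setT It.
  have h := @measurable_fun_fubini_tonelli_F _ _ _ _ _ (rV_measure n.+2)
    (fun z : R * BV R n.+2 => (F (consr z.1 z.2))%:E).
  apply: h => //; last by move=> z; rewrite lee_fin.
  apply: measurable_EFin_fun; exact: (measurableT_comp mF (@measurable_consr R _)).
(* At fixed [t], write d for the dimension [n.+3]. Then [G^{d/(d-1)} <= H^{1/(d-1)} G], and Hoelder
   with exponents d-1 and (d-1)/(d-2) leaves a power of [I] times an integral over the slice, which
   the induction hypothesis bounds by [It t]. *)
have key t : \int[rV_measure n.+2]_y (G (consr t y) `^ (n.+3%:R / n.+2%:R))%:E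
   <= I `^ (n.+2%:R)^-1 * It t.
  apply: (@le_trans _ _ (\int[rV_measure n.+2]_y (H y `^ (n.+2%:R)^-1 * G (consr t y))%:E)).
    apply: ge0_le_integral => //.
    - by move=> y _; rewrite lee_fin powR_ge0.
    - apply: measurable_EFin_fun; apply: (measurableT_comp (measurable_powR _)) => //.
    - apply: measurable_EFin_fun; apply: measurable_funM => //.
      by apply: (measurableT_comp (measurable_powR _)).
    move=> y _; rewrite lee_fin.
    have [G0'|G0'] := eqVneq (G (consr t y)) 0%R.
      by rewrite G0' mulr0 powR0// mulf_neq0// invr_eq0 pnatr_eq0.
    rewrite (_ : n.+3%:R / n.+2%:R = n.+2%:R^-1 + 1)%R; last first.
      by rewrite -[in n.+3]addn1 natrD mulrDl divff ?mul1r 1?addrC// pnatr_eq0.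
    rewrite powRD ?G0' ?implybT// powRr1//; apply: ler_wpM2r => //.
    by apply: ge0_ler_powR => //; rewrite ?invr_ge0// nnegrE.
  apply: (le_trans (ge0_hoelder _ _ _ _ _ (p := n.+2%:R) (q := n.+2%:R / n.+1%:R) _ _ _)) => //.
  - by apply: (measurableT_comp (measurable_powR _)).
  - by move=> x; exact: powR_ge0.
  - by rewrite invf_div -{1}[(n.+2%:R^-1)%R]mul1r -mulrDl nat1r divff// pnatr_eq0.
  rewrite (_ : \int[_]_x (( _ `^ _) `^ _)%:E = I); last first.
    rewrite -IH_; apply: eq_integral => y _.
    by rewrite -powRrM mulVf ?pnatr_eq0// powRr1.
  apply: lee_wpmul2l; first exact: poweR_ge0.
  have e1 j x : \int[@lebesgue_measure R]_s (F (consr t (upd x j s)))%:E =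
       \int[@lebesgue_measure R]_s (F (upd (consr t x) (lift ord0 j) s))%:E.
    by apply: eq_integral => s _; rewrite upd_consrS.
  have h : \int[rV_measure n.+2]_y (G (consr t y) `^ (n.+2%:R / n.+1%:R))%:E
      <= It t `^ (n.+2%:R / n.+1%:R).
    by apply: IH => // j x; rewrite e1.
  have r0 : (0 <= (n.+2%:R / n.+1%:R)^-1 :> R)%R by rewrite invr_ge0 divr_ge0.
  have It0 : 0 <= It t by apply: integral_ge0 => y _; rewrite lee_fin.
  apply: (@le_trans _ _ ((It t `^ (n.+2%:R / n.+1%:R)) `^ (n.+2%:R / n.+1%:R)^-1)).
    apply: gt0_ler_poweR => //; rewrite in_itv /= ?leey ?andbT.
    - by apply: integral_ge0 => y _; rewrite lee_fin powR_ge0.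
    - exact: poweR_ge0.
  by rewrite -poweRrM mulfV ?mulf_neq0 ?invr_eq0 ?pnatr_eq0// poweRe1.
have mG' : measurable_fun setT
    (fun z : R * BV R n.+2 => (G (consr z.1 z.2) `^ (n.+3%:R / n.+2%:R))%:E).
  apply: measurable_EFin_fun; apply: (measurableT_comp (measurable_powR _)) => //.
  exact: (measurableT_comp mG (@measurable_consr R _)).
apply: (@le_trans _ _ (\int[@lebesgue_measure R]_t (I `^ (n.+2%:R)^-1 * It t))).
  apply: ge0_le_integral => //.
  - by move=> t _; apply: integral_ge0 => y _; rewrite lee_fin powR_ge0.
  - apply: (@measurable_fun_fubini_tonelli_F _ _ _ _ _ (rV_measure n.+2) _ mG') => z.
    by rewrite lee_fin powR_ge0.
  - exact: measurable_funeM.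
rewrite ge0_integralZl//; last 2 first.
- by move=> t _; apply: integral_ge0 => y _; rewrite lee_fin.
- exact: poweR_ge0.
rewrite -IE.
have [->|In0] := eqVneq I 0; first by rewrite mule0 poweR_ge0.
rewrite (_ : n.+3%:R / n.+2%:R = n.+2%:R^-1 + 1)%R; last first.
  by rewrite -[in n.+3]addn1 natrD mulrDl divff ?mul1r 1?addrC// pnatr_eq0.
rewrite poweRD ?poweRe1//.
by apply: nneg_neq0_poweRD_def => //; rewrite invr_ge0.
Qed.

End LoomisWhitney.

Lemma bounded_support_integrable d (T : measurableType d) (R : realType)
    (mu : {measure set T -> \bar R}) (f : T -> R) (A : set T) (B : R) :
  measurable_fun setT f -> measurable A -> (mu A < +oo)%E ->
  (forall x, A x -> `|f x| <= B) -> (forall x, ~ A x -> f x = 0) ->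
  mu.-integrable setT (EFin \o f).
Proof.
move=> mf mA Aoo fB f0; apply/integrableP; split; first exact/measurable_EFinP.
apply: (@le_lt_trans _ _ (\int[mu]_x ((B%:E * (\1_A x)%:E)))%E).
  apply: ge0_le_integral => //.
  - by apply/measurable_EFinP; exact: (measurableT_comp _ mf).
  - apply: measurable_funeM; apply: measurable_EFin_fun; exact: measurable_indic.
  move=> x _ /=; rewrite -EFinM lee_fin indicE.
  have [/set_mem xA|xA] := boolP (x \in A); first by rewrite mulr1; exact: fB.
  by rewrite f0 ?normr0 ?mulr0// => /mem_set; apply/negP.
have [[x Ax]|A0] := pselect (A !=set0); last first.
  rewrite (_ : A = set0) ?integral0_eq// => [x _|].
    by rewrite indic0 mule0.
  by apply/seteqP; split => // x Ax; apply: A0; exists x.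
have B0 : 0 <= B by rewrite (le_trans _ (fB _ Ax)).
rewrite ge0_integralZl//; last by apply: measurable_EFin_fun; exact: measurable_indic.
by rewrite integral_indic// setIT lte_mul_pinfty.
Qed.

(** * Continuous functions with bounded support; the null set at the origin *)

Section Cont.
Context {R : realType}.

Lemma continuous_measurable_BV d (f : 'rV[R]_d -> R) :
  continuous f -> measurable_fun setT (f : BV R d -> R).
Proof.
by move=> /continuousP cf; apply/borel_funE => A oA; apply: sub_sigma_algebra; exact: cf.
Qed.

Lemma normr_coord d (x : 'rV[R]_d) j : `|x ord0 j| <= `|x|.
Proof.
have /mapP[i Hi ->] : `|x ord0 j| \in [seq `|x k.1 k.2| | k : 'I_1 * 'I_d].
  by apply/mapP; exists (ord0, j) => //=; rewrite mem_enum.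
by rewrite [leRHS]/Num.norm /= mx_normrE; apply/bigmax_geP; right => /=; exists i.
Qed.

Lemma continuous_bounded_ball d (f : 'rV[R]_d -> R) (M : R) : continuous f ->
  exists B, forall x, `|x| <= M -> `|f x| <= B.
Proof.
move=> cf; have [M0|M0] := ltP M 0.
  by exists 0 => x /le_lt_trans/(_ M0); rewrite normr_lt0.
have cA : compact (closed_ball_ Num.norm (0 : 'rV[R]_d) M).
  apply: bounded_closed_compact.
    exists M; split => [|K MK x /=]; first exact: num_real.
    by rewrite /closed_ball_ /= sub0r normrN => /le_trans; apply; exact: ltW.
  exact: closed_closed_ball_.
have cfn : {within closed_ball_ Num.norm (0 : 'rV[R]_d) M, continuous (fun x => `|f x|)}.
  apply: continuous_subspaceT => x; apply: continuous_comp; first exact: cf.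
  exact: norm_continuous.
have [|c cA' cmax] := EVT_max_rV _ cA cfn.
  by exists 0; rewrite /closed_ball_ /= subrr normr0.
exists (`|f c|) => x xM; apply: cmax; rewrite inE /closed_ball_ /=.
by rewrite sub0r normrN.
Qed.

Lemma cs_integrable d (f : 'rV[R]_d -> R) (M : R) : continuous f ->
  (forall x, M < `|x| -> f x = 0) ->
  (rV_measure d).-integrable setT (EFin \o (f : BV R d -> R)).
Proof.
move=> cf f0; have [B fB] := continuous_bounded_ball M cf.
have [n Mn] : exists n : nat, M < n.+1%:R.
  exists (Num.truncn M); exact: truncnS_gt.
apply: (@bounded_support_integrable _ _ _ _ _ (ball (0 : 'rV[R]_d) n.+1%:R : set (BV R d)) (Num.max B 0)) => //.
- exact: continuous_measurable_BV.
- by apply: open_measurable_BV; exact: ball_open.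
- exact: rV_measure_ball.
- move=> x _; have [xM|xM] := leP `|x| M; first by rewrite le_max fB.
  by rewrite f0// normr0 le_max lexx orbT.
- move=> x; rewrite -ball_normE /= sub0r normrN => /negP; rewrite -leNgt => nx.
  by apply: f0; exact: lt_le_trans nx.
Qed.

Lemma upd_continuous d (x : 'rV[R]_d) j : continuous (upd x j).
Proof.
move=> s; apply/cvgrPdist_lt => e e0; near=> t.
rewrite [ltLHS]/Num.norm /= mx_normrE; apply/bigmax_ltP; split => // -[i k] _ /=.
rewrite !mxE; case: ifPn => _; last by rewrite subrr normr0.
by near: t; apply: (@cvgr_dist_lt _ _ _ (nbhs s) _ id s) => //; exact: cvg_id.
Unshelve. all: by end_near. Qed.

Lemma normr_upd d (x : 'rV[R]_d) j s : `|s| <= `|upd x j s|.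
Proof. by have := normr_coord (upd x j s) j; rewrite mxE eqxx. Qed.

Lemma updE d (x : 'rV[R]_d) j : upd x j (x ord0 j) = x.
Proof. by apply/rowP => i; rewrite mxE; case: eqP => [->|]. Qed.

Lemma normr_rV_le d (x : 'rV[R]_d) M : 0 <= M ->
  (forall j, `|x ord0 j| <= M) -> `|x| <= M.
Proof.
move=> M0 xM; rewrite [leLHS]/Num.norm /= mx_normrE; apply/bigmax_leP; split => //.
by case=> i k _ /=; rewrite (ord1 i).
Qed.

Lemma cs_integrable1 (f : R -> R) (M : R) : continuous f ->
  (forall x, M < `|x| -> f x = 0) ->
  (@lebesgue_measure R).-integrable setT (EFin \o f).
Proof.
move=> cf f0.
have cf1 : continuous (fun x : 'rV[R]_1 => f (x ord0 ord0)).
  by move=> x; apply: continuous_comp; [exact: coord_continuous|exact: cf].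
have [B fB] := continuous_bounded_ball `|M| cf1.
have h := @bounded_support_integrable _ _ R (@lebesgue_measure R) f
  (`[- `|M|, `|M|]%classic : set R) B.
apply: h => //.
- exact: continuous_measurable_fun.
- suff : (@lebesgue_measure R [set` `[(- `|M|)%R, (`|M|)%R]] < +oo)%E by [].
  by rewrite lebesgue_measure_itv /=; case: ifP => // _; rewrite -EFinB ltry.
- move=> s /=; rewrite in_itv /= -ler_norml => sM.
  have := fB (const_mx s); rewrite mxE; apply.
  by apply: normr_rV_le => // j; rewrite mxE.
- move=> s /=; rewrite in_itv /= -ler_norml => /negP; rewrite -ltNge => sM.
  by apply: f0; rewrite (le_lt_trans _ sM)// ler_norm.
Qed.

(** The fundamental theorem is applied between points outside the support for the first claim, and
    from such a point up to [s] for the second. *)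
Lemma cs_FTC (f f' : R -> R) (M : R) :
  (forall s : R, is_derive s (1 : R) f (f' s)) -> continuous f' ->
  (forall s, M < `|s| -> f s = 0) -> (forall s, M < `|s| -> f' s = 0) ->
  (\int[@lebesgue_measure R]_s (f' s)%:E = 0)%E /\
  forall s, (`|f s|%:E <= \int[@lebesgue_measure R]_t `|f' t|%:E)%E.
Proof.
move=> df cf' f0 f'0.
have ftc a b : a < b ->
    (\int[@lebesgue_measure R]_(x in `[a, b]) (f' x)%:E = (f b)%:E - (f a)%:E)%E.
  move=> ab; apply: continuous_FTC2 => //.
  - exact: continuous_subspaceT.
  - have cfx x : {for x, continuous f}.
      by apply: differentiable_continuous; apply/derivable1_diffP; case: (df x).
    split.
    + by move=> x _; case: (df x).
    + exact/cvg_at_right_filter/cfx.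
    + exact/cvg_at_left_filter/cfx.
  - by move=> x _; rewrite derive1E; case: (df x).
have If' : (@lebesgue_measure R).-integrable setT (EFin \o f').
  exact: cs_integrable1 f'0.
(* Both [-N] and [N] lie outside the support, whatever the sign of [M]. *)
pose N : R := `|M| + 1.
have MN : M < N by rewrite (le_lt_trans (ler_norm M))// ltrDl.
have N0 : 0 < N by rewrite ltr_wpDl.
split.
  rewrite (_ : \int[_]_s _ = \int[@lebesgue_measure R]_(x in `[(- N)%R, N]) (f' x)%:E)%E; last first.
    rewrite [RHS]integral_mkcond; apply: eq_integral => x _.
    rewrite patchE; case: ifPn => //; rewrite mem_setE in_itv /= -ler_norml -ltNge => Nx.
    by rewrite f'0// (lt_trans MN).
  by rewrite ftc ?gtrN// !f0 ?normrN ?gtr0_norm// sube0.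
move=> s; have [Ms|sM] := ltP M `|s|.
  by rewrite f0// normr0; apply: integral_ge0 => t _; rewrite lee_fin.
have sN : - N < s.
  by rewrite ltrNl (le_lt_trans _ MN)// (le_trans _ sM)// -normrN ler_norm.
have -> : f s = f s - f (- N) by rewrite (f0 (- N)) ?normrN ?gtr0_norm// subr0.
have := ftc _ _ sN; rewrite -EFinB => h.
rewrite -abse_EFin -h; apply: (le_trans (le_abse_integral _ _ _)) => //=.
  by apply/measurable_EFinP; apply: measurable_funTS; exact: continuous_measurable_fun.
apply: ge0_subset_integral => //; apply/measurable_EFinP.
by apply: measurableT_comp => //; exact: continuous_measurable_fun.
Qed.

Section DerivLine.
Variables (d : nat) (j : 'I_d) (f f' : 'rV[R]_d -> R) (M : R).
Hypothesis df : forall x (s : R), is_derive s (1 : R) (fun s : R => f (upd x j s)) (f' (upd x j s)).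
Hypothesis cf' : continuous f'.
Hypothesis f0 : forall x, M < `|x| -> f x = 0.
Hypothesis f'0 : forall x, M < `|x| -> f' x = 0.

Let ftc x := @cs_FTC (fun s => f (upd x j s)) (fun s => f' (upd x j s)) M (df x).

Let cline x : continuous (fun s => f' (upd x j s)).
Proof.
by move=> s; apply: continuous_comp; [exact: upd_continuous|exact: cf'].
Qed.

Lemma le_line_integral x :
  (`|f x|%:E <= \int[@lebesgue_measure R]_s `|f' (upd x j s)|%:E)%E.
Proof.
have [|||_ h] := @ftc x; first exact: cline.
- by move=> s sM; apply: f0; rewrite (lt_le_trans sM)// normr_upd.
- by move=> s sM; apply: f'0; rewrite (lt_le_trans sM)// normr_upd.
by have := h (x ord0 j); rewrite updE.
Qed.

(** [eq_line_integral] handles nonnegative functions only, so the claim is recast as the equality of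
    the integrals of the positive and negative parts of [f'], which holds on every line by
    [cs_FTC]. *)
Lemma integral_deriv0 : (\int[rV_measure d]_x (f' x)%:E = 0)%E.
Proof.
have If' := cs_integrable cf' f'0.
rewrite integralE; apply/eqP; rewrite sube_eq ?add0e; last 2 first.
  exact: integrable_pos_fin_num.
  by rewrite fin_num_adde_defl// integrable_neg_fin_num.
apply/eqP; apply: (eq_line_integral (j := j)) => //.
- by apply: measurable_funepos; case/integrableP : If'.
- by apply: measurable_funeneg; case/integrableP : If'.
move=> x; have [|||h _] := @ftc x; first exact: cline.
- by move=> s sM; apply: f0; rewrite (lt_le_trans sM)// normr_upd.
- by move=> s sM; apply: f'0; rewrite (lt_le_trans sM)// normr_upd.
have Il : (@lebesgue_measure R).-integrable setT (EFin \o (fun s => f' (upd x j s))).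
  apply: (@cs_integrable1 _ M) => // s sM.
  by apply: f'0; rewrite (lt_le_trans sM)// normr_upd.
move: h; rewrite integralE => /eqP; rewrite sube_eq ?add0e => [/eqP h||].
- transitivity (\int[@lebesgue_measure R]_s (fun s => (f' (upd x j s))%:E)^\+ s)%E.
    by apply: eq_integral => s _; rewrite !funeposE.
  by rewrite h; apply: eq_integral => s _; rewrite !funenegE.
- exact: integrable_pos_fin_num Il.
- by rewrite fin_num_adde_defl// (integrable_neg_fin_num _ Il).
Qed.

End DerivLine.

Lemma measurable_rV_set1 d (x : 'rV[R]_d) : measurable ([set x] : set (BV R d)).
Proof.
rewrite -[X in measurable X]setCK; apply: measurableC; apply: open_measurable_BV.
by apply: closed_openC; apply: accessible_closed_set1; exact: hausdorff_accessible (@norm_hausdorff _ _).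
Qed.

Lemma rV_measure_set0 d : (rV_measure d.+1 [set (0%R : 'rV[R]_d.+1)] = 0)%E.
Proof.
rewrite rV_measureS (_ : _ @^-1` _ = [set 0 : R] `*` [set (0 : 'rV[R]_d)]).
  rewrite product_measure1E//; last exact: measurable_rV_set1.
  have h := lebesgue_measure_set1 (0 : R).
  by rewrite [X in (X * _)%E](_ : _ = 0%E) ?mul0e.
apply/seteqP; split => -[t y] /=.
  move=> h; split; first by rewrite -(consr0 t y) h mxE.
  by apply/rowP => i; rewrite -(consrS t y i) h !mxE.
move=> [-> ->]; apply/rowP => i.
by case: (unliftP ord0 i) => [k|] ->; rewrite ?consrS ?consr0 !mxE.
Qed.

(** Makes the conventional value of the weights at the origin invisible to integrals. *)
Lemma ae_neq0 d : (1 <= d)%N -> {ae rV_measure d, forall x : 'rV[R]_d, x != 0}.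
Proof.
case: d => // d _; exists [set (0 : 'rV[R]_d.+1)]; split.
- exact: measurable_rV_set1.
- exact: rV_measure_set0.
- by move=> x /= /negP; rewrite negbK => /eqP.
Qed.

End Cont.

(** * Euclidean norm and power weights *)

Section Norms.
Context {R : realType}.
Variable d : nat.
Implicit Types x y : 'rV[R]_d.

Lemma sqnorm_ge0 x : 0 <= sqnorm x.
Proof. by apply: sumr_ge0 => i _; exact: sqr_ge0. Qed.

Lemma sqnorm_gt0 x : x != 0 -> 0 < sqnorm x.
Proof.
move=> x0; rewrite lt0r sqnorm_ge0 andbT; apply: contra x0.
rewrite psumr_eq0 => [|i _]; last exact: sqr_ge0.
move=> /allP h; apply/eqP/rowP => i; rewrite mxE.
by have := h i (mem_index_enum _); rewrite sqrf_eq0 => /eqP.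
Qed.

Lemma sqnorm0 : sqnorm (0 : 'rV[R]_d) = 0.
Proof. by rewrite /sqnorm big1// => i _; rewrite mxE expr0n. Qed.

Lemma sqr_coord_le x j : x ord0 j ^+ 2 <= sqnorm x.
Proof.
rewrite /sqnorm (bigD1 j)//= lerDl; apply: sumr_ge0 => i _; exact: sqr_ge0.
Qed.

Lemma enorm_ge0 x : 0 <= enorm x. Proof. exact: sqrtr_ge0. Qed.

Lemma enorm_gt0 x : x != 0 -> 0 < enorm x.
Proof. by move=> x0; rewrite sqrtr_gt0 sqnorm_gt0. Qed.

Lemma enorm0 : enorm (0 : 'rV[R]_d) = 0.
Proof. by rewrite /enorm sqnorm0 sqrtr0. Qed.

Lemma sqr_enorm x : enorm x ^+ 2 = sqnorm x.
Proof. by rewrite sqr_sqrtr// sqnorm_ge0. Qed.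

Lemma coord_le_enorm x j : `|x ord0 j| <= enorm x.
Proof. by rewrite -sqrtr_sqr; apply: ler_wsqrtr; exact: sqr_coord_le. Qed.

Lemma normr_le_enorm x : `|x| <= enorm x.
Proof. by apply: normr_rV_le => [|j]; [exact: enorm_ge0|exact: coord_le_enorm]. Qed.


Lemma sqnormZB (a b : R) x y :
  sqnorm (a *: x - b *: y) = a ^+ 2 * sqnorm x - 2 * a * b * dotp x y + b ^+ 2 * sqnorm y.
Proof.
rewrite /sqnorm /dotp !mulr_sumr -sumrB -big_split /=.
by apply: eq_bigr => i _; rewrite !mxE; ring.
Qed.

Lemma dotp_sqr_le x y : dotp x y ^+ 2 <= sqnorm x * sqnorm y.
Proof.
have [->|y0] := eqVneq y 0.
  rewrite sqnorm0 mulr0 /dotp big1 ?expr0n// => i _; by rewrite mxE mulr0.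
have y_gt0 := sqnorm_gt0 y0.
(* The vector is [sqnorm y] times the component of [x] orthogonal to [y]. *)
have h : 0 <= sqnorm (sqnorm y *: x - dotp x y *: y) by exact: sqnorm_ge0.
have e : sqnorm (sqnorm y *: x - dotp x y *: y) =
   sqnorm y * (sqnorm x * sqnorm y - dotp x y ^+ 2) by rewrite sqnormZB; ring.
by move: h; rewrite e pmulr_rge0// subr_ge0.
Qed.

End Norms.

Section Wgt.
Context {R : realType} (d : nat).
Implicit Types x : 'rV[R]_d.

Lemma wgt_ge0 s x : 0 <= wgt s x. Proof. exact: powR_ge0. Qed.

Lemma wgt_gt0 s x : x != 0 -> 0 < wgt s x.
Proof. by move=> x0; apply: powR_gt0; exact: enorm_gt0. Qed.

Lemma wgtD s t x : x != 0 -> wgt (s + t) x = wgt s x * wgt t x.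
Proof. by move=> x0; apply: powRD; rewrite (gt_eqF (enorm_gt0 x0)) implybT. Qed.

Lemma wgt_powR s t x : powR (wgt s x) t = wgt (s * t) x.
Proof. by rewrite /wgt powRrM. Qed.

Lemma wgt2 x : wgt 2 x = sqnorm x.
Proof. by rewrite /wgt powR_mulrn ?enorm_ge0// sqr_enorm. Qed.

Lemma wgt_sqnorm s x : wgt s x = powR (sqnorm x) (s / 2).
Proof.
by rewrite /wgt /enorm -powR12_sqrt ?sqnorm_ge0// -powRrM mulrC.
Qed.

Lemma wgt0 x : wgt 0 x = 1. Proof. exact: powRr0. Qed.

End Wgt.

(** * Derivatives along coordinate lines *)

Section LineDerivatives.
Context {R : realType} (d : nat).
Implicit Types (x y : 'rV[R]_d) (j : 'I_d) (f P A : 'rV[R]_d -> R).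

(** Partial differentiability phrased on whole lines, the form required by the one-dimensional
    fundamental theorem. *)
Definition line_derive j f f' := forall x (s : R),
  is_derive s (1 : R) (fun t : R => f (upd x j t)) (f' (upd x j s)).

Lemma updD x j s h : upd x j (h + s) = h *: delta_mx ord0 j + upd x j s.
Proof.
apply/rowP => i; rewrite !mxE eqxx /=; case: eqP => _.
  by rewrite mulr1.
by rewrite mulr0 add0r.
Qed.

Lemma pderiv_line j f : (forall x, differentiable f x) ->
  line_derive j f (pderiv j f).
Proof.
move=> df x s.
have dfs := @diff_derivable _ _ _ f (upd x j s) (delta_mx ord0 j) (df _).
have e : (fun h : R => h^-1 *: (((fun t : R => f (upd x j t)) \o shift s) (h *: (1:R)) - f (upd x j s)))
   = (fun h => h^-1 *: ((f \o shift (upd x j s)) (h *: delta_mx ord0 j) - f (upd x j s))).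
  apply/funext => h /=; congr (_ *: (f _ - _)).
  by rewrite [X in upd x j (X + s)]mulr1 updD.
split; first by rewrite /derivable e.
by rewrite /pderiv /derive e.
Qed.

Lemma sqnorm_line j : line_derive j (@sqnorm R d) (fun y => 2 * y ord0 j).
Proof.
move=> x s; rewrite (_ : (fun t => _) = cst (\sum_(i < d | i != j) x ord0 i ^+ 2) + id ^+ 2); last first.
  apply/funext => t; rewrite /sqnorm (bigD1 j)//= mxE eqxx addrC; congr (_ + _).
  by apply: eq_bigr => i ij; rewrite mxE (negbTE ij).
apply: is_derive_eq; rewrite mxE eqxx add0r /=.
by rewrite /GRing.scale /= mulr1 expr1.
Qed.

Lemma wgt_line e j x (s : R) : upd x j s != 0 ->
  is_derive s (1:R) (fun t => wgt e (upd x j t))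
    (e * upd x j s ord0 j * wgt (e - 2) (upd x j s)).
Proof.
move=> x0; rewrite (_ : (fun t => _) = (@powR R ^~ (e / 2)) \o (fun t => sqnorm (upd x j t))); last first.
  by apply/funext => t /=; rewrite wgt_sqnorm.
have h1 := @sqnorm_line j x s.
have h2 := is_derive1_powR (e / 2) (sqnorm_gt0 x0).
apply: is_derive_eq; rewrite wgt_sqnorm (_ : (e - 2) / 2 = e / 2 - 1); last by field.
by field.
Qed.

Lemma coord_line j : line_derive j (fun y => y ord0 j) (fun=> 1).
Proof.
move=> x s; rewrite (_ : (fun t => _) = id); first exact: is_derive_id.
by apply/funext => t; rewrite mxE eqxx.
Qed.

Lemma upd_near0 x j s (r : R) : 0 < r -> upd x j s = 0 ->
  \forall t \near s, enorm (upd x j t) < r.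
Proof.
move=> r0 xs0.
have e t : enorm (upd x j t) = `|t|.
  have s0 : s = 0 by have := congr1 (fun y : 'rV[R]_d => y ord0 j) xs0; rewrite !mxE eqxx.
  rewrite /enorm /sqnorm (bigD1 j)//= mxE eqxx big1 ?addr0 ?sqrtr_sqr// => i ij.
  have := congr1 (fun y : 'rV[R]_d => y ord0 i) xs0; rewrite !mxE (negbTE ij) => ->.
  by rewrite expr0n.
have s0 : s = 0 by have := congr1 (fun y : 'rV[R]_d => y ord0 j) xs0; rewrite !mxE eqxx.
near=> t; rewrite e; near: t; rewrite s0.
by exists r => // t /=; rewrite sub0r normrN.
Unshelve. all: by end_near. Qed.

Definition ann (r M : R) f := forall x, (enorm x < r \/ M < enorm x) -> f x = 0.

(** [A] stands for a weight, possibly singular at the origin, and [P] for a factor vanishing near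
    it. On a line through the origin the product is locally zero at the singular parameter;
    elsewhere the product rule applies. *)
Lemma mul_line j (A A' P P' : 'rV[R]_d -> R) r : 0 < r ->
  (forall x s, upd x j s != 0 ->
     is_derive s (1 : R) (fun t => A (upd x j t)) (A' (upd x j s))) ->
  line_derive j P P' ->
  (forall y, enorm y < r -> P y = 0) -> (forall y, enorm y < r -> P' y = 0) ->
  line_derive j (fun y => A y * P y) (fun y => A' y * P y + A y * P' y).
Proof.
move=> r0 dA dP P0 P'0 x s; have [xs0|xs0] := eqVneq (upd x j s) 0.
  rewrite P0 ?xs0 ?enorm0// P'0 ?enorm0// !mulr0 addr0.
  apply: (@near_eq_is_derive _ _ _ (cst 0)).
  have h := upd_near0 r0 xs0.
  by apply: filterS h => t tr; rewrite P0 ?mulr0.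
have h1 := dA _ _ xs0; have h2 := dP x s.
have h := is_deriveM h1 h2; apply: (is_derive_eq h).
by rewrite /GRing.scale /=; ring.
Qed.

Lemma sqnorm_continuous : continuous (@sqnorm R d).
Proof.
move=> x; rewrite (_ : @sqnorm R d = \sum_(i < d) (fun y : 'rV[R]_d => y ord0 i ^+ 2)); last first.
  by apply/funext => y; rewrite fct_sumE.
apply: (@big_ind _ (fun f : 'rV[R]_d -> R => {for x, continuous f})) => [|f g cf cg|i _]; first exact: cst_continuous.
- exact: continuousD.
- apply: (@continuous_comp _ _ _ (fun y : 'rV[R]_d => y ord0 i) (fun t : R => t ^+ 2)).
    exact: coord_continuous.
  exact: exprn_continuous.
Qed.

Lemma wgt_continuous e x : x != 0 -> {for x, continuous (wgt e)}.
Proof.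
move=> x0; rewrite (_ : wgt e = (@powR R ^~ (e / 2)) \o @sqnorm R d); last first.
  by apply/funext => t /=; rewrite wgt_sqnorm.
apply: continuous_comp; first exact: sqnorm_continuous.
apply: differentiable_continuous; apply/derivable1_diffP.
by case: (is_derive1_powR (e / 2) (sqnorm_gt0 x0)).
Qed.

Lemma enorm_continuous : continuous (@enorm R d).
Proof.
move=> x; apply: continuous_comp; [exact: sqnorm_continuous|exact: sqrt_continuous].
Qed.

Lemma continuous_mul0 (A P : 'rV[R]_d -> R) r : 0 < r ->
  (forall x, x != 0 -> {for x, continuous A}) -> continuous P ->
  (forall y, enorm y < r -> P y = 0) -> continuous (fun y => A y * P y).
Proof.
move=> r0 cA cP P0 x; have [->|x0] := eqVneq x 0; last exact: continuousM (cA _ x0) (cP x).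
rewrite /continuous_at P0 ?enorm0// mulr0.
apply: (@cvg_near_cst _ _ 0 (fun y => A y * P y) (nbhs (0 : 'rV[R]_d))).
have h : \forall y \near (0 : 'rV[R]_d), enorm y < r.
  apply: (@cvgr_lt _ _ _ _ (@enorm R d) (enorm (0 : 'rV[R]_d)) (@enorm_continuous 0)).
  by rewrite enorm0.
near=> y; rewrite P0 ?mulr0//; near: y; exact: h.
Unshelve. all: by end_near. Qed.

End LineDerivatives.

(** * Powers of the absolute value *)

Section AbsPow.
Context {R : realType}.

Lemma sqr_powR (g t : R) : (t ^+ 2) `^ (g / 2) = `|t| `^ g.
Proof.
by rewrite -[t ^+ 2]real_normK ?num_real// -powR_mulrn// -powRrM mulrC divfK.
Qed.

Lemma powR_le1 (a e : R) : 0 <= e -> 0 <= a -> a <= 1 -> a `^ e <= 1.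
Proof.
move=> e0 a0 a1; rewrite (_ : 1 = 1 `^ e); last by rewrite powR1.
by apply: ge0_ler_powR => //; rewrite nnegrE.
Qed.

Lemma abs_powR_le (e t : R) : 0 <= e -> `|t| <= 1 -> `| `|t| `^ e * t| <= `|t|.
Proof.
move=> e0 t1; rewrite normrM ger0_norm ?powR_ge0// ler_piMl//.
exact: powR_le1.
Qed.

Lemma near0_norm_le (P : R -> Prop) : (forall t, `|t| <= 1 -> P t) ->
  \forall t \near (0 : R), P t.
Proof.
by move=> h; exists 1 => //= t /=; rewrite sub0r normrN => /ltW; exact: h.
Qed.

(** At 0 the difference quotient is at most [|h|^{g-1} <= |h|] in absolute value for small [h].
    Elsewhere [|t|^g] is the power g/2 of the smooth positive function [t^2]. *)
Lemma is_derive_abspow (g u : R) : 2 <= g ->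
  is_derive u (1 : R) (fun t : R => `|t| `^ g) (g * (`|u| `^ (g - 2) * u)).
Proof.
move=> g2; have [->|u0] := eqVneq u 0.
  rewrite mulr0 mulr0.
  pose f (t : R) := `|t| `^ g.
  have h : (fun h : R => h^-1 *: ((f \o shift 0) (h *: (1:R)) - f 0)) @ 0^' --> (0 : R).
    have g0 : g != 0 by rewrite gt_eqF// (lt_le_trans _ g2).
    rewrite {2}/f normr0 powR0//.
    apply/cvgr0Pnorm_lt => e e0; near=> h.
    have h0 : h != 0 by near: h; exact: nbhs_dnbhs_neq.
    rewrite /= subr0 addr0 /GRing.scale /= mulr1 /f.
    rewrite normrM normfV [`|_ `^ g|]ger0_norm ?powR_ge0//.
    apply: (@le_lt_trans _ _ `|h|); last first.
      by near: h; apply: dnbhs0_lt.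
    rewrite ler_pdivrMl ?normr_gt0// (_ : g = (g - 2) + 2); last by ring.
    rewrite powRD ?normr_eq0 ?h0 ?implybT// powR_mulrn// expr2.
    rewrite ler_piMl ?mulr_ge0// powR_le1//; first lra.
    by near: h; apply: dnbhs0_le.
  split; first by apply/cvg_ex; exists 0.
  exact/cvg_lim.
rewrite (_ : (fun t => _) = (@powR R ^~ (g / 2)) \o (fun t => t ^+ 2)); last first.
  by apply/funext => t /=; rewrite sqr_powR.
have u2 : 0 < u ^+ 2 by rewrite exprn_even_gt0.
have h1 := is_derive1_powR (g / 2) u2.
have h2 : is_derive u (1 : R) (fun t : R => t ^+ 2) (2 * u).
  have := @is_deriveX R R id 2 u 1 1 (is_derive_id _ _).
  by rewrite /GRing.scale /= mulr1 expr1.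
have h := @is_derive1_comp R (@powR R ^~ (g / 2)) (fun t => t ^+ 2) u _ _ h1 h2; apply: (is_derive_eq h).
rewrite (_ : g / 2 - 1 = (g - 2) / 2); last by field.
rewrite sqr_powR; field.
Unshelve. all: by end_near. Qed.

Lemma abspow_continuous (e : R) : 0 <= e -> continuous (fun t : R => `|t| `^ e * t).
Proof.
move=> e0 u; have [->|u0] := eqVneq u 0.
  rewrite /continuous_at mulr0; apply/cvgr0Pnorm_lt => k k0.
  near=> t; apply: (@le_lt_trans _ _ `|t|).
    by near: t; apply: near0_norm_le => t; exact: abs_powR_le.
  by near: t; exists k => //= t /=; rewrite sub0r normrN.
apply: (@continuousM _ _ (fun t => `|t| `^ e) id u); last exact: cvg_id.
apply: (@continuous_comp _ _ _ (@Num.norm _ R) (@powR R ^~ e)); first exact: norm_continuous.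
have u1 : 0 < `|u| by rewrite normr_gt0.
apply: differentiable_continuous; apply/derivable1_diffP.
by case: (is_derive1_powR e u1).
Unshelve. all: by end_near. Qed.

Lemma abspow_continuous2 (g : R) : 2 <= g -> continuous (fun t : R => `|t| `^ g).
Proof.
move=> g2 u; apply: differentiable_continuous; apply/derivable1_diffP.
by case: (is_derive_abspow u g2).
Qed.

End AbsPow.

(** * Test functions of class C^1 supported in an annulus *)

Section CTest.
Context {R : realType} (d : nat).
Implicit Types (phi : 'rV[R]_d -> R).

(** One derivative suffices for every integration by parts below, and this class is stable under
    subtraction with little effort ([c1testB]). *)
Definition c1test phi := [/\ forall x, differentiable phi x,
  forall j, continuous (pderiv j phi) &
  exists r M : R, 0 < r /\ ann r M phi].

Lemma testfun_c1test phi : testfun phi -> c1test phi.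
Proof.
move=> [/(_ 1%N) [d1 c1] [r [M [r0 a0]]]]; split => //; exists r, M; split => //.
Qed.

Lemma ann_pderiv r M phi j : ann r M phi -> ann r M (pderiv j phi).
Proof.
move=> a0 x xr; rewrite /pderiv (@near_eq_derive _ _ _ _ (cst 0)).
  by rewrite derive_val.
case: xr => xr.
  have h : \forall y \near x, enorm y < r.
    exact: (@cvgr_lt _ _ _ _ (@enorm R d) _ (@enorm_continuous _ _ x)).
  by near=> y; apply: a0; left; near: y; exact: h.
have h : \forall y \near x, M < enorm y.
  exact: (@cvgr_gt _ _ _ _ (@enorm R d) _ (@enorm_continuous _ _ x)).
by near=> y; apply: a0; right; near: y; exact: h.
Unshelve. all: by end_near. Qed.

Lemma c1test_continuous phi : c1test phi -> continuous phi.
Proof. by move=> [h _ _] x; apply: differentiable_continuous; exact: h. Qed.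

Lemma grad_sqnorm phi x : sqnorm (grad phi x) = \sum_j pderiv j phi x ^+ 2.
Proof. by apply: eq_bigr => j _; rewrite mxE. Qed.

Lemma sqr_pderiv_le phi x j : pderiv j phi x ^+ 2 <= sqnorm (grad phi x).
Proof. by have := sqr_coord_le (grad phi x) j; rewrite mxE. Qed.

Lemma grad_sqnorm_continuous phi : c1test phi ->
  continuous (fun x => sqnorm (grad phi x)).
Proof.
move=> [_ c1 _] x.
rewrite (_ : (fun x => _) = \sum_(j < d) (fun y : 'rV[R]_d => pderiv j phi y ^+ 2)); last first.
  by apply/funext => y; rewrite fct_sumE grad_sqnorm.
apply: (@big_ind _ (fun f : 'rV[R]_d -> R => {for x, continuous f})) => [|f g cf cg|i _]; first exact: cst_continuous.
- exact: continuousD.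
- apply: (@continuous_comp _ _ _ (pderiv i phi) (fun t : R => t ^+ 2)); first exact: c1.
  exact: exprn_continuous.
Qed.

Lemma ann_grad_sqnorm r M phi : ann r M phi -> ann r M (fun x => sqnorm (grad phi x)).
Proof.
move=> a0 x xr; rewrite grad_sqnorm big1// => j _.
by rewrite (ann_pderiv _ a0)// expr0n.
Qed.

Lemma wgt_ann_continuous r M (g : 'rV[R]_d -> R) s : 0 < r -> ann r M g ->
  continuous g -> continuous (fun x => g x * wgt s x).
Proof.
move=> r0 a0 cg.
rewrite (_ : (fun x => _) = (fun x => wgt s x * g x)); last by apply/funext => x; rewrite mulrC.
by apply: (@continuous_mul0 R d (wgt s) g r r0) => // [x|y yr]; [exact: wgt_continuous|apply: a0; left].
Qed.

Lemma ann_norm r M (g : 'rV[R]_d -> R) : ann r M g -> forall x, M < `|x| -> g x = 0.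
Proof. by move=> a0 x Mx; apply: a0; right; rewrite (lt_le_trans Mx)// normr_le_enorm. Qed.

Lemma wgt_ann_integrable r M (g : 'rV[R]_d -> R) s : 0 < r -> ann r M g ->
  continuous g -> (rV_measure d).-integrable setT (fun x : BV R d => (g x * wgt s x)%:E).
Proof.
move=> r0 a0 cg.
apply: (@cs_integrable _ d (fun x => g x * wgt s x) M).
  exact: wgt_ann_continuous a0 cg.
by move=> x Mx; rewrite (ann_norm a0)// mul0r.
Qed.

End CTest.

(** * Hardy's inequality *)

Section Hardy.
Context {R : realType} (d : nat) (a : R) (phi : 'rV[R]_d -> R).
Hypothesis ctphi : c1test phi.
Local Notation mu := (rV_measure d).
Let e := - (2 * (a + 1)).
(* [h j] is the [j]-th partial derivative of [y_j |y|^e phi(y)^2]. *)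
Let h (j : 'I_d) (y : 'rV[R]_d) : R :=
  (wgt e y + y ord0 j * (e * y ord0 j * wgt (e - 2) y)) * phi y ^+ 2
  + (y ord0 j * wgt e y) * (2 * (phi y * pderiv j phi y)).

Let U y := phi y ^+ 2 * wgt e y.
Let V y := sqnorm (grad phi y) * wgt (- (2 * a)) y.

Lemma comp_line (f : R -> R) (f' : R -> R) (g g' : 'rV[R]_d -> R) j :
  (forall t, is_derive t (1 : R) f (f' t)) -> line_derive j g g' ->
  line_derive j (fun y => f (g y)) (fun y => f' (g y) * g' y).
Proof.
move=> df dg x s.
exact: (@is_derive1_comp R f (fun t => g (upd x j t)) s _ _ (df _) (dg x s)).
Qed.

Lemma is_derive_sqr (u : R) : is_derive u (1 : R) (fun t : R => t ^+ 2) (2 * u).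
Proof.
have := @is_deriveX R R id 2 u 1 1 (is_derive_id _ _).
by rewrite /GRing.scale /= mulr1 expr1.
Qed.

Lemma hardy_deriv j : (\int[mu]_x (h j x)%:E = 0)%E /\
  mu.-integrable setT (EFin \o (h j : BV R d -> R)).
Proof.
have [d1 c1 [r [M [r0 a0]]]] := ctphi; have cphi := c1test_continuous ctphi.
have P0 y : enorm y < r -> phi y ^+ 2 = 0 by move=> yr; rewrite a0 ?expr0n//; left.
have P'0 y : enorm y < r -> 2 * (phi y * pderiv j phi y) = 0.
  by move=> yr; rewrite a0 ?mul0r ?mulr0//; left.
have dF : line_derive j (fun y => (y ord0 j * wgt e y) * phi y ^+ 2) (h j).
  apply: (mul_line r0 (P' := fun y => 2 * (phi y * pderiv j phi y))) => //.
    move=> x s x0; have := is_deriveM (coord_line j x s) (wgt_line e x0).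
    by move=> h0; apply: (is_derive_eq h0); rewrite /GRing.scale /=; ring.
  move=> x s; have := comp_line is_derive_sqr (pderiv_line j d1) x s.
  by move=> h0; apply: (is_derive_eq h0); ring.
have ccoord : continuous (fun y : 'rV[R]_d => y ord0 j) by exact: coord_continuous.
have ch : continuous (h j).
  move=> x; apply: (@continuousD _ _ _ (fun y => (wgt e y + y ord0 j * (e * y ord0 j * wgt (e - 2) y)) * phi y ^+ 2)
      (fun y => (y ord0 j * wgt e y) * (2 * (phi y * pderiv j phi y))) x).
    apply: (@continuous_mul0 R d (fun y => wgt e y + y ord0 j * (e * y ord0 j * wgt (e - 2) y)) (fun y => phi y ^+ 2) r r0) => // [z z0|].
      apply: continuousD; first exact: wgt_continuous.
      apply: continuousM; first exact: ccoord.
      apply: continuousM; last exact: wgt_continuous.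
      by apply: continuousM; [exact: cst_continuous|exact: ccoord].
    move=> z; apply: (@continuous_comp _ _ _ phi (fun t : R => t ^+ 2)); first exact: cphi.
    exact: exprn_continuous.
  apply: (@continuous_mul0 R d (fun y => y ord0 j * wgt e y) (fun y => 2 * (phi y * pderiv j phi y)) r r0) => // [z z0|z].
    by apply: continuousM; [exact: ccoord|exact: wgt_continuous].
  apply: (@continuousM _ _ (fun=> 2) (fun y => phi y * pderiv j phi y) z); first exact: cst_continuous.
  by apply: continuousM; [exact: cphi|exact: c1].
have phM x : M < `|x| -> phi x = 0 by exact: (ann_norm a0).
have hM x : M < `|x| -> h j x = 0.
  by move=> xM; rewrite /h phM// mul0r mulr0 expr0n !mulr0 addr0.
split; last exact: cs_integrable hM.
apply: (integral_deriv0 dF ch _ hM) => x xM.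
by rewrite phM// expr0n mulr0.
Qed.

Lemma c1test_int2 : mu.-integrable setT (fun x : BV R d => (U x)%:E).
Proof.
have [d1 c1 [r [M [r0 a0]]]] := ctphi; have cphi := c1test_continuous ctphi.
apply: (@wgt_ann_integrable _ _ r M (fun x => phi x ^+ 2)) => //.
  by move=> x xr; rewrite a0 ?expr0n.
move=> z; apply: (@continuous_comp _ _ _ phi (fun t : R => t ^+ 2)); first exact: cphi.
exact: exprn_continuous.
Qed.

Lemma c1test_intD : mu.-integrable setT (fun x : BV R d => (V x)%:E).
Proof.
have [d1 c1 [r [M [r0 a0]]]] := ctphi; have cphi := c1test_continuous ctphi.
apply: (@wgt_ann_integrable _ _ r M (fun x => sqnorm (grad phi x))) => //.
  exact: ann_grad_sqnorm.
exact: grad_sqnorm_continuous.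
Qed.

(** The constant is [(a_c - a)^{-2}], as [c = 2 (a_c - a)]. The divergence has integral zero and is
    bounded below by [(c/2) U - (2/c) V], whence [(c/2) \int U <= (2/c) \int V]. *)
Lemma hardy : a < a_c R d ->
  (\int[mu]_x (U x)%:E <= (4 / (d%:R - 2 - 2 * a) ^+ 2)%:E * \int[mu]_x (V x)%:E)%E.
Proof.
move=> aac; set c := d%:R - 2 - 2 * a.
have c0 : 0 < c by move: aac; rewrite /a_c /c; lra.
have U0 x : 0 <= U x by rewrite mulr_ge0 ?sqr_ge0 ?wgt_ge0.
have V0 x : 0 <= V x by rewrite mulr_ge0 ?sqnorm_ge0 ?wgt_ge0.
(* The divergence of [x |x|^e] is [(d + e) |x|^e], and [d + e = c]. *)
have sumh x : \sum_j h j x = c * U x + 2 * (wgt e x * (phi x * dotp x (grad phi x))).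
  have [d1 c1 [r [M [r0 a0]]]] := ctphi.
  have [x0|x0] := eqVneq x 0.
    have p0 : phi x = 0 by rewrite a0// x0 enorm0; left.
    rewrite /U p0 expr0n !(mul0r, mulr0) addr0 big1// => j _.
    by rewrite /h p0 expr0n !(mul0r, mulr0) addr0.
  have e2 : sqnorm x * wgt (e - 2) x = wgt e x.
    by rewrite -wgt2 -wgtD// addrC subrK.
  have d1' : \sum_(j < d) wgt e x = d%:R * wgt e x by rewrite sumr_const card_ord mulr_natl.
  have d2 : \sum_(j < d) (x ord0 j ^+ 2 * (e * wgt (e - 2) x)) = e * wgt e x.
    by rewrite -mulr_suml -/(sqnorm x) mulrCA e2.
  have d3 : \sum_(j < d) x ord0 j * pderiv j phi x = dotp x (grad phi x).
    by apply: eq_bigr => j _; rewrite mxE.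
  transitivity ((\sum_(j < d) wgt e x + \sum_(j < d) (x ord0 j ^+ 2 * (e * wgt (e - 2) x))) * phi x ^+ 2
     + (\sum_(j < d) x ord0 j * pderiv j phi x) * (2 * wgt e x * phi x)).
    by rewrite -big_split /= !mulr_suml -big_split /=; apply: eq_bigr => j _; rewrite /h; ring.
  rewrite d1' d2 d3 /U /c /e; ring.
(* Young's inequality: the cross term costs half of [c U], and the rest is a multiple of
   [|x|^e (x . grad phi)^2], which Cauchy-Schwarz bounds by [V]. *)
have key x : (c / 2) * U x - (2 / c) * V x <= \sum_j h j x.
  rewrite sumh.
  have [x0|x0] := eqVneq x 0.
    have [d1 c1 [r [M [r0 a0]]]] := ctphi.
    have p0 : phi x = 0 by rewrite a0// x0 enorm0; left.
    by rewrite /U p0 expr0n !(mul0r, mulr0) addr0 sub0r oppr_le0 mulr_ge0// divr_ge0// ltW.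
  have W0 := wgt_ge0 e x.
  have VE : V x = wgt e x * (sqnorm x * sqnorm (grad phi x)).
    rewrite /V -(wgt2 x) mulrA -wgtD// mulrC; congr (wgt _ _ * _); rewrite /e; ring.
  have q := dotp_sqr_le x (grad phi x).
  rewrite VE /U.
  set D := dotp _ _ in q *; set S := sqnorm x * _ in q *; set p := phi x; set W := wgt e x in W0 *.
  have : 0 <= W * ((c / 2) * p ^+ 2 + 2 * (p * D) + (2 / c) * S).
    apply: mulr_ge0 => //.
    have : (2 / c) * D ^+ 2 <= (2 / c) * S by apply: ler_wpM2l => //; rewrite divr_ge0 ?ltW.
    have : (c / 2) * p ^+ 2 + 2 * (p * D) + (2 / c) * D ^+ 2 = (2 / c) * (D + (c / 2) * p) ^+ 2.
      by field; rewrite gt_eqF.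
    have : 0 <= (2 / c) * (D + (c / 2) * p) ^+ 2 by rewrite mulr_ge0 ?sqr_ge0// divr_ge0// ltW.
    by lra.
  nra.
have hI j := (hardy_deriv j).2.
have : (\int[mu]_x ((c / 2 * U x)%:E - (2 / c * V x)%:E) <= 0)%E.
  have <- : (\int[mu]_x (\sum_j (h j x)%:E) = 0)%E.
    rewrite (integral_sum measurableT (f := fun j (x : BV R d) => (h j x)%:E)) //.
    by rewrite big1// => j _; exact: (hardy_deriv j).1.
  apply: le_integral => //.
  - apply: integrableB => //.
    + exact: (integrableZl measurableT (c / 2) c1test_int2).
    + exact: (integrableZl measurableT (2 / c) c1test_intD).
  - by apply: integrable_sum => // j _; exact: hI.
  - by move=> x _; rewrite -EFinB sumEFin lee_fin; exact: key.
rewrite integralB_EFin//; last 2 first.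
- exact: (integrableZl measurableT (c / 2) c1test_int2).
- exact: (integrableZl measurableT (2 / c) c1test_intD).
have mU := measurable_int _ c1test_int2.
have mV := measurable_int _ c1test_intD.
have c2 : 0 <= c / 2 by rewrite divr_ge0 ?ltW.
have c3 : 0 <= 2 / c by rewrite divr_ge0 ?ltW.
have -> : (\int[mu]_x (c / 2 * U x)%:E = (c / 2)%:E * \int[mu]_x (U x)%:E)%E.
  by rewrite -integralZl//; exact: c1test_int2.
have -> : (\int[mu]_x (2 / c * V x)%:E = (2 / c)%:E * \int[mu]_x (V x)%:E)%E.
  by rewrite -integralZl//; exact: c1test_intD.
have fU : (\int[mu]_x (U x)%:E)%E \is a fin_num by exact: integrable_fin_num c1test_int2.
have fV : (\int[mu]_x (V x)%:E)%E \is a fin_num by exact: integrable_fin_num c1test_intD.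
rewrite -(fineK fU) -(fineK fV) -!EFinM -EFinB !lee_fin.
set X := fine _; set D := fine _ => H.
rewrite (_ : 4 / c ^+ 2 = (2 / c) * (2 / c)); last by field; rewrite gt_eqF.
have -> : X = (2 / c) * ((c / 2) * X) by field; rewrite gt_eqF.
by rewrite -[leRHS]mulrA ler_wpM2l//; move: H; rewrite subr_le0.
Qed.

End Hardy.

Section CauchySchwarz.
Context d (T : measurableType d) (R : realType) (mu : {measure set T -> \bar R}).
Local Open Scope ereal_scope.

Lemma ge0_le_poweR (x y : \bar R) (r : R) : (0 <= r)%R -> 0 <= x -> x <= y -> x `^ r <= y `^ r.
Proof.
move=> r0 x0 xy; apply: gt0_ler_poweR => //; rewrite in_itv /= leey andbT //.
exact: le_trans xy.
Qed.

(** Stated for a pointwise bound on a square because both uses arise that way: partial derivatives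
    in [gn_F_int], and inner products of gradients in [dotp_integrable]. *)
Lemma integral_sqrt_le (h Q E : T -> R) (q w : R) :
  measurable_fun setT h -> measurable_fun setT Q -> measurable_fun setT E ->
  (forall x, 0 <= Q x)%R -> (forall x, 0 <= E x)%R ->
  (forall x, h x ^+ 2 <= Q x * E x)%R ->
  \int[mu]_x (Q x)%:E <= q%:E -> \int[mu]_x (E x)%:E <= w%:E ->
  \int[mu]_x `|h x|%:E <= (Num.sqrt (q * w))%:E.
Proof.
move=> mh mQ mE Q0 E0 hQE Qq Ew.
have q0 : (0 <= q)%R.
  by rewrite -lee_fin (le_trans _ Qq)//; apply: integral_ge0 => x _; rewrite lee_fin.
have w0 : (0 <= w)%R.
  by rewrite -lee_fin (le_trans _ Ew)//; apply: integral_ge0 => x _; rewrite lee_fin.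
have mp (r : R) (f : T -> R) : measurable_fun setT f -> measurable_fun setT (fun x => f x `^ r)%R.
  by move=> mf; exact: (measurableT_comp (measurable_powR _) mf).
apply: (@le_trans _ _ (\int[mu]_x ((Q x `^ 2^-1) * (E x `^ 2^-1))%:E)).
  apply: ge0_le_integral => //.
  - by apply: measurable_EFin_fun; exact: measurableT_comp.
  - by apply: measurable_EFin_fun; apply: measurable_funM; exact: mp.
  move=> x _; rewrite lee_fin !powR12_sqrt// -sqrtrM// -sqrtr_sqr.
  exact: ler_wsqrtr.
have half : (2^-1 + 2^-1 = 1 :> R)%R by field.
have := ge0_hoelder mu (mp 2^-1%R _ mQ) (mp 2^-1%R _ mE)
  (fun x => powR_ge0 _ _) (fun x => powR_ge0 _ _) (ltr0n R 2) (ltr0n R 2) half.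
move=> /le_trans; apply.
have e (f : T -> R) : (forall x, 0 <= f x)%R ->
    \int[mu]_x (((f x `^ 2^-1) `^ 2)%R)%:E = \int[mu]_x (f x)%:E.
  by move=> f0; apply: eq_integral => x _; rewrite -powRrM mulVf ?powRr1.
rewrite !e// sqrtrM// EFinM; apply: lee_pmul.
- exact: poweR_ge0.
- exact: poweR_ge0.
- rewrite -powR12_sqrt// -poweR_EFin; apply: ge0_le_poweR => //.
  by apply: integral_ge0 => x _; rewrite lee_fin.
- rewrite -powR12_sqrt// -poweR_EFin; apply: ge0_le_poweR => //.
  by apply: integral_ge0 => x _; rewrite lee_fin.
Qed.

End CauchySchwarz.

(** * The Gagliardo-Nirenberg estimate for a weighted power of a test function *)

Section GN.
Context {R : realType} (d : nat) (a s g : R) (phi : 'rV[R]_d -> R).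
Hypothesis ctphi : c1test phi.
Hypothesis g2 : 2 <= g.
Local Notation mu := (rV_measure d).

Let f (y : 'rV[R]_d) := wgt (- s) y * `|phi y| `^ g.
Let f' (j : 'I_d) (y : 'rV[R]_d) : R :=
  (- s * y ord0 j * wgt (- s - 2) y) * `|phi y| `^ g
  + wgt (- s) y * (g * (`|phi y| `^ (g - 2) * phi y) * pderiv j phi y).
(** One majorant for the partial derivatives in all directions, as [loomis_whitney] expects. *)
Let F y := \sum_(j < d) `|f' j y|.
Let U y := phi y ^+ 2 * wgt (- (2 * (a + 1))) y.
Let V y := sqnorm (grad phi y) * wgt (- (2 * a)) y.
(** The factor left when a squared derivative of [f] is divided by the Hardy density [U] or the
    Dirichlet density [V]. *)
Let E y := `|phi y| `^ (2 * g - 2) * wgt (2 * a - 2 * s) y.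

Let g0 : g != 0. Proof. by rewrite gt_eqF// (lt_le_trans _ g2). Qed.

Let f'0 j y : phi y = 0 -> f' j y = 0.
Proof. by move=> p0; rewrite /f' p0 normr0 powR0// !(mulr0, mul0r) addr0. Qed.

Lemma gn_deriv j : line_derive j f (f' j) /\ continuous (f' j).
Proof.
have [d1 c1 [r [M [r0 a0]]]] := ctphi; have cphi := c1test_continuous ctphi.
have P0 y : enorm y < r -> `|phi y| `^ g = 0.
  by move=> yr; rewrite a0 ?normr0 ?powR0//; left.
have P'0 y : enorm y < r -> g * (`|phi y| `^ (g - 2) * phi y) * pderiv j phi y = 0.
  by move=> yr; rewrite a0 ?mulr0 ?mul0r//; left.
split.
  apply: (mul_line r0 (P' := fun y => g * (`|phi y| `^ (g - 2) * phi y) * pderiv j phi y)) => //.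
    by move=> x t x0; exact: wgt_line.
  move=> x t; exact: (comp_line (fun t => is_derive_abspow t g2) (pderiv_line j d1) x t).
have ccoord : continuous (fun y : 'rV[R]_d => y ord0 j) by exact: coord_continuous.
move=> x; apply: (@continuousD _ _ _ (fun y : 'rV[R]_d => (- s * y ord0 j * wgt (- s - 2) y) * `|phi y| `^ g)
  (fun y : 'rV[R]_d => wgt (- s) y * (g * (`|phi y| `^ (g - 2) * phi y) * pderiv j phi y)) x).
  apply: (@continuous_mul0 R d (fun y => - s * y ord0 j * wgt (- s - 2) y) (fun y => `|phi y| `^ g) r r0) => // [z z0|].
    apply: continuousM; last exact: wgt_continuous.
    by apply: continuousM; [exact: cst_continuous|exact: ccoord].
  move=> z; apply: (@continuous_comp _ _ _ phi (fun t : R => `|t| `^ g)); first exact: cphi.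
  exact: abspow_continuous2.
apply: (@continuous_mul0 R d (wgt (- s)) (fun y => g * (`|phi y| `^ (g - 2) * phi y) * pderiv j phi y) r r0) => // [z z0|z].
  exact: wgt_continuous.
apply: (@continuousM _ _ (fun y => g * (`|phi y| `^ (g - 2) * phi y)) (pderiv j phi) z); last exact: c1.
apply: continuousM; first exact: cst_continuous.
apply: (@continuous_comp _ _ _ phi (fun t : R => `|t| `^ (g - 2) * t)); first exact: cphi.
by apply: abspow_continuous; rewrite subr_ge0.
Qed.

Let F_continuous : continuous F.
Proof.
move=> x; rewrite (_ : F = \sum_(j < d) (fun y : 'rV[R]_d => `|f' j y|)); last first.
  by apply/funext => y; rewrite fct_sumE.
apply: (@big_ind _ (fun f : 'rV[R]_d -> R => {for x, continuous f})) => [|k1 k2 ck1 ck2|j _]; first exact: cst_continuous.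
- exact: continuousD.
- apply: (@continuous_comp _ _ _ (f' j) (@Num.norm _ R)); first exact: (gn_deriv j).2.
  exact: norm_continuous.
Qed.

Lemma gn_F0 x : 0 <= F x. Proof. by apply: sumr_ge0 => j _. Qed.

Lemma gn_F_meas : measurable_fun setT (F : BV R d -> R).
Proof. exact: continuous_measurable_BV. Qed.

(** Supplies the finiteness hypothesis of [loomis_whitney]: on each line [F] is continuous with
    bounded support. *)
Lemma gn_F_line j x : (\int[@lebesgue_measure R]_t (F (upd x j t))%:E < +oo)%E.
Proof.
have [d1 c1 [r [M [r0 a0]]]] := ctphi.
have : (@lebesgue_measure R).-integrable setT (EFin \o (fun t => F (upd x j t))).
  apply: (@cs_integrable1 _ _ M).
    by move=> t; apply: (@continuous_comp _ _ _ (upd x j) F); [exact: upd_continuous|exact: F_continuous].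
  move=> t Mt; rewrite /F big1// => k _; rewrite f'0 ?normr0//.
  by apply: (ann_norm a0); rewrite (lt_le_trans Mt)// normr_upd.
move=> /integrableP[_]; apply: le_lt_trans.
apply: ge0_le_integral => //.
- by move=> t _; rewrite lee_fin gn_F0.
- apply: measurable_EFin_fun; apply: continuous_measurable_fun => t.
  by apply: (@continuous_comp _ _ _ (upd x j) F); [exact: upd_continuous|exact: F_continuous].
- apply: measurable_EFin_fun; apply: measurableT_comp => //; apply: continuous_measurable_fun => t.
  by apply: (@continuous_comp _ _ _ (upd x j) F); [exact: upd_continuous|exact: F_continuous].
- by move=> t _ /=; rewrite lee_fin ler_norm.
Qed.

Lemma gn_le_line j x : ((f x)%:E <= \int[@lebesgue_measure R]_t (F (upd x j t))%:E)%E.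
Proof.
have [d1 c1 [r [M [r0 a0]]]] := ctphi.
have [df cf'] := gn_deriv j.
apply: (@le_trans _ _ `|f x|%:E); first by rewrite lee_fin ler_norm.
have fM y : M < `|y| -> f y = 0.
  by move=> yM; rewrite /f (ann_norm a0)// normr0 powR0// mulr0.
have f'M y : M < `|y| -> f' j y = 0.
  by move=> yM; apply: f'0; exact: (ann_norm a0).
apply: (le_trans (le_line_integral df cf' fM f'M x)).
have cl k : continuous (fun t => f' k (upd x j t)).
  by move=> t; apply: (@continuous_comp _ _ _ (upd x j) (f' k)); [exact: upd_continuous|exact: (gn_deriv k).2].
apply: ge0_le_integral => //.
- apply: measurable_EFin_fun; apply: measurableT_comp => //.
  exact: continuous_measurable_fun.
- apply: measurable_EFin_fun; apply: continuous_measurable_fun => t.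
  by apply: (@continuous_comp _ _ _ (upd x j) F); [exact: upd_continuous|exact: F_continuous].
move=> t _; rewrite lee_fin /F (bigD1 j)//= lerDl; exact: sumr_ge0.
Qed.

(** The derivative of [f] is a sum [A + B]. When the weight is differentiated, [A^2 <= s^2 U E];
    when the power is, [B^2 <= g^2 V E]. The exponents in [E] are those that make both
    factorisations balance. *)
Lemma gn_pointwise j y :
  f' j y ^+ 2 <= (2 * s ^+ 2 * U y + 2 * g ^+ 2 * V y) * E y.
Proof.
have U0 : 0 <= U y by rewrite mulr_ge0 ?sqr_ge0 ?wgt_ge0.
have V0 : 0 <= V y by rewrite mulr_ge0 ?sqnorm_ge0 ?wgt_ge0.
have E0 : 0 <= E y by rewrite mulr_ge0 ?powR_ge0 ?wgt_ge0.
have [p0|p0] := eqVneq (phi y) 0.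
  by rewrite f'0// expr0n mulr_ge0// addr_ge0// mulr_ge0// mulr_ge0// sqr_ge0.
have y0 : y != 0.
  apply: contra p0 => /eqP ->; have [_ _ [r [M [r0 a0]]]] := ctphi.
  by rewrite a0// enorm0; left.
set t := `|phi y|; have t0 : 0 < t by rewrite normr_gt0.
have tD (x z : R) : t `^ (x + z) = t `^ x * t `^ z by rewrite powRD// (gt_eqF t0) implybT.
have t2 : phi y ^+ 2 = t `^ 2 by rewrite powR_mulrn ?ltW// real_normK ?num_real.
pose A := - s * y ord0 j * wgt (- s - 2) y * t `^ g.
pose B := wgt (- s) y * (g * (t `^ (g - 2) * phi y) * pderiv j phi y).
have AB : f' j y = A + B by [].
have : (A + B) ^+ 2 <= 2 * A ^+ 2 + 2 * B ^+ 2.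
  rewrite -subr_ge0 (_ : _ - _ = (A - B) ^+ 2) ?sqr_ge0//; ring.
rewrite AB => /le_trans; apply.
have A2 : A ^+ 2 <= s ^+ 2 * (U y * E y).
  have e1 : A ^+ 2 = s ^+ 2 * (y ord0 j ^+ 2 * (wgt (- s - 2) y * wgt (- s - 2) y * (t `^ g * t `^ g))).
    by rewrite /A; ring.
  have e2 : U y * E y = sqnorm y * (wgt (- s - 2) y * wgt (- s - 2) y * (t `^ g * t `^ g)).
    have h1 : t `^ 2 * t `^ (2 * g - 2) = t `^ g * t `^ g by rewrite -!tD; congr (_ `^ _); ring.
    have h2 : wgt (- (2 * (a + 1))) y * wgt (2 * a - 2 * s) y
        = sqnorm y * (wgt (- s - 2) y * wgt (- s - 2) y).
      by rewrite -(wgt2 y) -!wgtD//; congr (wgt _ _); ring.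
    rewrite /U /E -/t t2 mulrACA h1 h2; ring.
  rewrite e1 e2; apply: ler_wpM2l; first exact: sqr_ge0.
  apply: ler_wpM2r; last exact: sqr_coord_le.
  by rewrite !mulr_ge0 ?wgt_ge0 ?powR_ge0.
have B2 : B ^+ 2 <= g ^+ 2 * (V y * E y).
  have e1 : B ^+ 2 = g ^+ 2 * (pderiv j phi y ^+ 2 * (wgt (- s) y * wgt (- s) y * (t `^ (g - 2) * t `^ (g - 2) * phi y ^+ 2))).
    by rewrite /B; ring.
  have e2 : V y * E y = sqnorm (grad phi y) * (wgt (- s) y * wgt (- s) y * (t `^ (g - 2) * t `^ (g - 2) * phi y ^+ 2)).
    have h1 : t `^ (2 * g - 2) = t `^ (g - 2) * t `^ (g - 2) * t `^ 2 by rewrite -!tD; congr (_ `^ _); ring.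
    have h2 : wgt (- (2 * a)) y * wgt (2 * a - 2 * s) y = wgt (- s) y * wgt (- s) y.
      by rewrite -!wgtD//; congr (wgt _ _); ring.
    rewrite /V /E -/t t2 -h2 h1; ring.
  rewrite e1 e2; apply: ler_wpM2l; first exact: sqr_ge0.
  apply: ler_wpM2r; last exact: sqr_pderiv_le.
  apply: mulr_ge0; first by rewrite mulr_ge0 ?wgt_ge0.
  by apply: mulr_ge0; [rewrite mulr_ge0 ?powR_ge0|exact: sqr_ge0].
rewrite mulrDl; nra.
Qed.

Lemma gn_E_int : mu.-integrable setT (fun x : BV R d => (E x)%:E).
Proof.
have [d1 c1 [r [M [r0 a0]]]] := ctphi; have cphi := c1test_continuous ctphi.
have g22 : 2 <= 2 * g - 2 by move: g2; lra.
apply: (@wgt_ann_integrable _ _ r M (fun x => `|phi x| `^ (2 * g - 2))) => //.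
  by move=> x xr; rewrite a0// normr0 powR0// gt_eqF//; lra.
move=> z; apply: (@continuous_comp _ _ _ phi (fun t : R => `|t| `^ (2 * g - 2))); first exact: cphi.
exact: abspow_continuous2.
Qed.

(** Cauchy-Schwarz is applied in each of the [d] directions, and Hardy and Dirichlet integrals enter
    as one factor; the factor [d] comes from summing. *)
Lemma gn_F_int (u v w : R) :
  (\int[mu]_x (U x)%:E <= u%:E)%E -> (\int[mu]_x (V x)%:E <= v%:E)%E ->
  (\int[mu]_x (E x)%:E <= w%:E)%E ->
  (\int[mu]_x (F x)%:E <= (d%:R * Num.sqrt ((2 * s ^+ 2 * u + 2 * g ^+ 2 * v) * w))%:E)%E.
Proof.
move=> Uu Vv Ew.
have mU := measurable_int _ (c1test_int2 a ctphi).
have mV := measurable_int _ (c1test_intD a ctphi).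
have mE := measurable_int _ gn_E_int.
have U0 y : 0 <= U y by rewrite mulr_ge0 ?sqr_ge0 ?wgt_ge0.
have V0 y : 0 <= V y by rewrite mulr_ge0 ?sqnorm_ge0 ?wgt_ge0.
have E0 y : 0 <= E y by rewrite mulr_ge0 ?powR_ge0 ?wgt_ge0.
have mU' : measurable_fun setT (U : BV R d -> R) by apply/measurable_EFinP.
have mV' : measurable_fun setT (V : BV R d -> R) by apply/measurable_EFinP.
have mE' : measurable_fun setT (E : BV R d -> R) by apply/measurable_EFinP.
have s0 : 0 <= 2 * s ^+ 2 by rewrite mulr_ge0// sqr_ge0.
have gg0 : 0 <= 2 * g ^+ 2 by rewrite mulr_ge0// sqr_ge0.
have mf j : measurable_fun setT (f' j : BV R d -> R).
  apply: continuous_measurable_BV; exact: (gn_deriv j).2.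
have IQ : (\int[mu]_x (2 * s ^+ 2 * U x + 2 * g ^+ 2 * V x)%:E <= (2 * s ^+ 2 * u + 2 * g ^+ 2 * v)%:E)%E.
  under eq_integral do rewrite EFinD.
  have nn (c : R) (k : 'rV[R]_d -> R) : 0 <= c -> (forall x, 0 <= k x) ->
      measurable_fun setT (k : BV R d -> R) ->
      (\int[mu]_x (c * k x)%:E = c%:E * \int[mu]_x (k x)%:E)%E.
    move=> c0 k0 mk; under eq_integral do rewrite EFinM.
    rewrite ge0_integralZl//; first exact: (measurable_EFin_fun mk).
    by move=> x _; rewrite lee_fin.
  rewrite ge0_integralD//.
  - rewrite !nn// EFinD (EFinM _ u) (EFinM _ v).
    by apply: leeD; apply: lee_wpmul2l; rewrite ?lee_fin.
  - by move=> x _; rewrite lee_fin mulr_ge0.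
  - by apply: measurable_EFin_fun; exact: measurable_funM.
  - by move=> x _; rewrite lee_fin mulr_ge0.
  - by apply: measurable_EFin_fun; exact: measurable_funM.
have Fj j : (\int[mu]_x `|f' j x|%:E <= (Num.sqrt ((2 * s ^+ 2 * u + 2 * g ^+ 2 * v) * w))%:E)%E.
  apply: (integral_sqrt_le (mf j) _ mE' _ E0 (gn_pointwise j) IQ Ew).
    by apply: measurable_funD; apply: measurable_funM.
  by move=> x; rewrite addr_ge0// mulr_ge0.
rewrite /F; under eq_integral do rewrite -sumEFin.
rewrite ge0_integral_sum//; last first.
  by move=> j; apply: measurable_EFin_fun; apply: measurableT_comp.
set K := Num.sqrt _ in Fj *.
have -> : d%:R * K = \sum_(j < d) K by rewrite sumr_const card_ord mulr_natl.
by rewrite -sumEFin; apply: lee_sum => j _; exact: Fj.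
Qed.

End GN.

(** * The Caffarelli-Kohn-Nirenberg inequality for test functions *)

Section CKNTest.
Context {R : realType}.

(* The weight exponent [b * p], expressed without [b]. *)
Definition wexp (d : nat) (a p : R) : R := (a - a_c R d) * p + d%:R.

Definition mp (d : nat) (a p : R) (phi : 'rV[R]_d -> R) (x : 'rV[R]_d) : R :=
  `|phi x| `^ p * wgt (- wexp d a p) x.

Lemma mp_ge0 d a p (phi : 'rV[R]_d -> R) x : 0 <= mp a p phi x.
Proof. by rewrite mulr_ge0 ?powR_ge0 ?wgt_ge0. Qed.

Lemma mp2 d a (phi : 'rV[R]_d -> R) x :
  mp a 2 phi x = phi x ^+ 2 * wgt (- (2 * (a + 1))) x.
Proof.
rewrite /mp powR_mulrn// real_normK ?num_real//; congr (_ * wgt _ _).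
by rewrite /wexp /a_c; field.
Qed.

Lemma mp_zero d a p (phi : 'rV[R]_d -> R) x : p != 0 -> phi x = 0 -> mp a p phi x = 0.
Proof. by move=> p0 h; rewrite /mp h normr0 powR0// mul0r. Qed.

Lemma c1test_neq0 d (phi : 'rV[R]_d -> R) x : c1test phi -> phi x != 0 -> x != 0.
Proof.
move=> [_ _ [r [M [r0 a0]]]]; apply: contra => /eqP ->.
by rewrite a0// enorm0; left.
Qed.

(** The base of the power and the measure [|x|^{-d} dx] do not depend on [p]; this is why
    interpolation between exponents needs no change of weight. *)
Lemma mpE d a p (phi : 'rV[R]_d -> R) x : x != 0 ->
  mp a p phi x = (`|phi x| * wgt (- (a - a_c R d)) x) `^ p * wgt (- d%:R) x.
Proof.
move=> x0; rewrite powRM ?wgt_ge0// wgt_powR -mulrA -wgtD//; congr (_ * wgt _ _).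
by rewrite /wexp; ring.
Qed.

Lemma mp_int d a p (phi : 'rV[R]_d -> R) : c1test phi -> 2 <= p ->
  (rV_measure d).-integrable setT (fun x : BV R d => (mp a p phi x)%:E).
Proof.
move=> ctphi p2; have [d1 c1 [r [M [r0 a0]]]] := ctphi; have cphi := c1test_continuous ctphi.
apply: (@wgt_ann_integrable _ _ r M (fun x => `|phi x| `^ p)) => //.
  by move=> x xr; rewrite a0// normr0 powR0// gt_eqF//; lra.
move=> z; apply: (@continuous_comp _ _ _ phi (fun t : R => `|t| `^ p)); first exact: cphi.
exact: abspow_continuous2.
Qed.

Definition Xp d (a p : R) (phi : 'rV[R]_d -> R) : \bar R :=
  (\int[rV_measure d]_x (mp a p phi x)%:E)%E.
Definition Dp d (a : R) (phi : 'rV[R]_d -> R) : \bar R :=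
  (\int[rV_measure d]_x (sqnorm (grad phi x) * wgt (- (2 * a)) x)%:E)%E.

(** Below the threshold [s] the power [t^p] is controlled through [p0], above it through [p1]. *)
Lemma powR_interp (p0 p p1 s t : R) : p0 <= p -> p <= p1 -> 0 < s -> 0 < t ->
  t `^ p <= s `^ (p - p0) * t `^ p0 + s `^ (p - p1) * t `^ p1.
Proof.
move=> p0p pp1 s0 t0.
have tD (x z : R) : t `^ (x + z) = t `^ x * t `^ z by rewrite powRD// (gt_eqF t0) implybT.
have [ts|/ltW st] := leP t s.
  apply: (@le_trans _ _ (s `^ (p - p0) * t `^ p0)); last by rewrite lerDl mulr_ge0 ?powR_ge0.
  rewrite -[in leLHS](subrK p0 p) tD; apply: ler_wpM2r; first exact: powR_ge0.
  by apply: ge0_ler_powR => //; rewrite ?subr_ge0// nnegrE ltW.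
apply: (@le_trans _ _ (s `^ (p - p1) * t `^ p1)); last by rewrite lerDr mulr_ge0 ?powR_ge0.
have h : s `^ (p1 - p) <= t `^ (p1 - p).
  by apply: ge0_ler_powR => //; rewrite ?subr_ge0// nnegrE ltW.
rewrite -(opprB p1 p) powRN mulrC ler_pdivlMr ?powR_gt0//.
rewrite -[in leRHS](subrK p p1) tD mulrC; apply: ler_wpM2r => //; exact: powR_ge0.
Qed.

(** The threshold [sqrt S] makes each of the two terms contribute [S^{p/2}]. The resulting factor 2
    is absorbed as [2 <= 2^{p/2}]. *)
Lemma interp d a (p0 p p1 S : R) (phi : 'rV[R]_d -> R) : c1test phi ->
  2 <= p0 -> p0 <= p -> p <= p1 -> 0 < S ->
  (Xp a p0 phi <= (S `^ (p0 / 2))%:E)%E -> (Xp a p1 phi <= (S `^ (p1 / 2))%:E)%E ->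
  (Xp a p phi <= ((2 * S) `^ (p / 2))%:E)%E.
Proof.
move=> ctphi p02 p0p pp1 S0 X0 X1.
have SD (x z : R) : S `^ (x + z) = S `^ x * S `^ z by rewrite powRD// (gt_eqF S0) implybT.
have I0 := mp_int a ctphi p02.
have I1 := mp_int a ctphi (le_trans p02 (le_trans p0p pp1)).
have Ip := mp_int a ctphi (le_trans p02 p0p).
apply: (@le_trans _ _ (\int[rV_measure d]_x
   ((S `^ ((p - p0) / 2))%:E * (mp a p0 phi x)%:E + (S `^ ((p - p1) / 2))%:E * (mp a p1 phi x)%:E))%E).
  apply: le_integral => //.
  - by apply: integrableD => //; apply: integrableZl.
  move=> x _; rewrite -!EFinM -EFinD lee_fin.
  have [f0|f0] := eqVneq (phi x) 0.
    by rewrite mp_zero ?addr_ge0 ?mulr_ge0 ?powR_ge0 ?mp_ge0// gt_eqF//; lra.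
  have x0 := c1test_neq0 ctphi f0.
  rewrite !mpE//; set tau := `|phi x| * _; set W := wgt (- d%:R) x.
  have W0 : 0 <= W by exact: wgt_ge0.
  rewrite (mulrA _ _ W) (mulrA _ _ W) -(mulrDl _ _ W); apply: ler_wpM2r => //.
  have e q : S `^ (q / 2) = (Num.sqrt S) `^ q.
    by rewrite -powR12_sqrt ?ltW// -powRrM mulrC.
  rewrite !e; apply: powR_interp => //; first by rewrite sqrtr_gt0.
  by rewrite mulr_gt0 ?normr_gt0 ?wgt_gt0.
rewrite integralD//; try exact: integrableZl.
rewrite !integralZl// -/(Xp a p0 phi) -/(Xp a p1 phi).
apply: (@le_trans _ _ (S `^ (p / 2) + S `^ (p / 2))%:E).
  rewrite EFinD; apply: leeD.
    rewrite (_ : p / 2 = (p - p0) / 2 + p0 / 2); last by field.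
    by rewrite SD EFinM; apply: lee_wpmul2l => //; rewrite lee_fin powR_ge0.
  rewrite (_ : p / 2 = (p - p1) / 2 + p1 / 2); last by field.
  by rewrite SD EFinM; apply: lee_wpmul2l => //; rewrite lee_fin powR_ge0.
rewrite lee_fin powRM//; last exact: ltW.
have h2 : 2 <= 2 `^ (p / 2) :> R.
  by rewrite -[leLHS]powRr1//; apply: ler_powR; lra.
by have := ler_wpM2r (powR_ge0 S (p / 2)) h2; lra.
Qed.

(** With dimension d = [n.+2], the exponents [g] and [s] are those for which
    [(|x|^{-s} |phi|^g)^{d/(d-1)}] is the integrand for exponent [p]. Loomis-Whitney then bounds
    exponent [p] through exponents 2 and [2 * g - 2]. *)
Lemma gn_step n (a p u v w : R) (phi : 'rV[R]_n.+2 -> R) : c1test phi ->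
  let d : R := n.+2%:R in let g := p * (n.+1%:R / d) in
  let s := wexp n.+2 a p * (n.+1%:R / d) in
  2 <= g ->
  (Xp a 2 phi <= u%:E)%E -> (Dp a phi <= v%:E)%E ->
  (Xp a (2 * g - 2) phi <= w%:E)%E ->
  (Xp a p phi <= ((d * Num.sqrt ((2 * s ^+ 2 * u + 2 * g ^+ 2 * v) * w)) `^ (d / n.+1%:R))%:E)%E.
Proof.
move=> ctphi d g s g2 Xu Dv Xw.
have d0 : d != 0 by rewrite pnatr_eq0.
have n0 : n.+1%:R != 0 :> R by rewrite pnatr_eq0.
have dn : d = n.+1%:R + 1 by rewrite /d natr1.
have p0 : 2 <= p.
  apply: (le_trans g2); rewrite /g ler_piMr//; last by rewrite ler_pdivrMr ?ltr0n// mul1r ler_nat.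
  have : 0 < g by lra.
  by rewrite /g pmulr_lgt0 ?divr_gt0 ?ltr0n// => /ltW.
have U2 x : mp a 2 phi x = phi x ^+ 2 * wgt (- (2 * (a + 1))) x by exact: mp2.
(* By homogeneity the weight of [E] in the previous section is exactly the one attached to the
   exponent [2 * g - 2]. *)
have sw : 2 * a - 2 * s = - wexp n.+2 a (2 * g - 2).
  by rewrite /s /g /wexp /a_c -/d dn; field.
have Fint : (_ <= _)%E := @gn_F_int R n.+2 a s g phi ctphi g2 u v w _ Dv _.
have {}Fint := Fint _ _.
have mphi : measurable_fun setT (fun y : BV R n.+2 => wgt (- s) y * `|phi y| `^ g).
  have [d1 c1 [r [M [r0 a0]]]] := ctphi; have cphi := c1test_continuous ctphi.
  apply: (@continuous_measurable_BV R n.+2 (fun y => wgt (- s) y * `|phi y| `^ g)).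
  apply: (@continuous_mul0 R n.+2 (wgt (- s)) (fun y => `|phi y| `^ g) r r0) => // [x x0|z|y yr].
  - exact: wgt_continuous.
  - apply: (@continuous_comp _ _ _ phi (fun t : R => `|t| `^ g)); first exact: cphi.
    exact: abspow_continuous2.
  - by rewrite a0 ?normr0 ?powR0//; [rewrite gt_eqF//; lra|left].
have LW := @loomis_whitney R n (fun y => wgt (- s) y * `|phi y| `^ g) _ mphi
  (gn_F_meas s ctphi g2) (fun y => mulr_ge0 (wgt_ge0 _ _) (powR_ge0 _ _)) (gn_F0 s g phi)
  (gn_F_line s ctphi g2) (gn_le_line s ctphi g2).
have mpf x : mp a p phi x = (wgt (- s) x * `|phi x| `^ g) `^ (n.+2%:R / n.+1%:R).
  have e1 : (`|phi x| `^ g) `^ (n.+2%:R / n.+1%:R) = `|phi x| `^ p.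
    by rewrite -powRrM; congr (_ `^ _); rewrite /g -/d; field; rewrite ?nat1r -(natrD _ 2 n) !pnatr_eq0.
  rewrite powRM ?wgt_ge0 ?powR_ge0// wgt_powR e1 mulrC /mp.
  by congr (_ * wgt _ _); rewrite /s -/d; field; rewrite ?nat1r -(natrD _ 2 n) !pnatr_eq0.
rewrite /Xp; under eq_integral do rewrite mpf.
apply: (le_trans LW); rewrite -poweR_EFin.
apply: ge0_le_poweR.
- by rewrite divr_ge0.
- by apply: integral_ge0 => x _; rewrite lee_fin gn_F0.
- apply: Fint.
  + by move: Xu; rewrite /Xp; under eq_integral do rewrite U2.
  + by move: Xw; rewrite /Xp /mp -sw.
Qed.

(** The bound is in terms of any positive [T] dominating the Dirichlet integral, so that powers of
    [T] can be split without treating zero energy apart. *)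
Definition ckn_at d a (p : R) := exists K : R, 0 < K /\
  forall (phi : 'rV[R]_d -> R) (T : R), c1test phi -> 0 < T ->
    (Dp a phi <= T%:E)%E -> (Xp a p phi <= ((K * T) `^ (p / 2))%:E)%E.

Lemma ckn_hardy d a : a < a_c R d -> ckn_at d a 2.
Proof.
move=> aac; have c0 : 0 < d%:R - 2 - 2 * a :> R by move: aac; rewrite /a_c; lra.
exists (4 / (d%:R - 2 - 2 * a) ^+ 2); split; first by rewrite divr_gt0// exprn_gt0.
move=> phi T ctphi T0 DT; rewrite divff// powRr1; last first.
  by rewrite mulr_ge0 ?divr_ge0 ?exprn_ge0// ltW.
rewrite /Xp; under eq_integral do rewrite mp2.
apply: (le_trans (hardy ctphi aac)); rewrite (EFinM _ T).
by apply: lee_wpmul2l => //; rewrite lee_fin divr_ge0// exprn_ge0// ltW.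
Qed.

Lemma ckn_interp d a (p0 p p1 : R) : 2 <= p0 -> p0 <= p -> p <= p1 ->
  ckn_at d a p0 -> ckn_at d a p1 -> ckn_at d a p.
Proof.
move=> p02 p0p pp1 [K0 [K00 H0]] [K1 [K10 H1]].
pose K := Num.max K0 K1.
have K_0 : 0 < K by rewrite lt_max K00.
exists (2 * K); split; first by rewrite mulr_gt0.
move=> phi T ctphi T0 DT; rewrite -mulrA; apply: (interp ctphi p02 p0p pp1).
- by rewrite mulr_gt0.
- apply: (le_trans (H0 _ _ ctphi T0 DT)); rewrite lee_fin.
  apply: ge0_ler_powR; rewrite ?nnegrE; first lra.
  + by rewrite mulr_ge0// ltW.
  + by rewrite mulr_ge0// ltW.
  + by apply: ler_wpM2r; [exact: ltW|rewrite le_max lexx].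
- apply: (le_trans (H1 _ _ ctphi T0 DT)); rewrite lee_fin.
  apply: ge0_ler_powR; rewrite ?nnegrE; first lra.
  + by rewrite mulr_ge0// ltW.
  + by rewrite mulr_ge0// ltW.
  + by apply: ler_wpM2r; [exact: ltW|rewrite le_max lexx orbT].
Qed.

(** In dimension 2, [g = p / 2] and [2 * g - 2 = p - 2], so one step raises an even exponent by
    2. *)
Lemma ckn_dim2_even a m : a < a_c R 2 -> ckn_at 2 a (2 * m.+1%:R).
Proof.
move=> aac; have [KH [KH0 HH]] := ckn_hardy aac.
elim: m => [|m [K [K0 IH]]]; first by rewrite mulr1; exact: ckn_hardy.
pose p : R := 2 * m.+2%:R; pose g : R := p * (1 / 2); pose s := wexp 2 a p * (1 / 2).
(* The factor 4 is the square of the dimension: the step is raised to the power d/(d-1) = 2, which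
   also removes the square root. *)
pose K1 := 4 * (2 * s ^+ 2 * KH + 2 * g ^+ 2).
have gE : g = m.+2%:R by rewrite /g /p; field.
have g2 : 2 <= g by rewrite gE ler_nat.
have A0 : 0 <= 2 * s ^+ 2 * KH + 2 * g ^+ 2.
  by have := mulr_ge0 (sqr_ge0 s) (ltW KH0); have := sqr_ge0 g; lra.
have K10 : 0 <= K1 by rewrite /K1 mulr_ge0.
exists (Num.max K1 K); split; first by rewrite lt_max K0 orbT.
move=> phi T ctphi T0 DT.
have X2 : (Xp a 2 phi <= (KH * T)%:E)%E.
  apply: (le_trans (HH _ _ ctphi T0 DT)).
  by rewrite divff// powRr1// mulr_ge0// ltW.
have Xr : (Xp a (2 * g - 2) phi <= ((K * T) ^+ m.+1)%:E)%E.
  rewrite gE (_ : 2 * m.+2%:R - 2 = 2 * m.+1%:R); last by rewrite -[m.+2]addn1 natrD; ring.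
  apply: (le_trans (IH _ _ ctphi T0 DT)); rewrite lee_fin [2 * _ / 2](_ : _ = m.+1%:R); last by field.
  by rewrite powR_mulrn// mulr_ge0// ltW.
have := @gn_step 0 a p (KH * T) T ((K * T) ^+ m.+1) phi ctphi g2 X2 DT Xr.
move=> /le_trans; apply; rewrite lee_fin -/g -/s.
have q0 : 0 <= (2 * s ^+ 2 * (KH * T) + 2 * g ^+ 2 * T) * (K * T) ^+ m.+1.
  rewrite mulr_ge0 ?exprn_ge0 ?mulr_ge0 ?(ltW K0) ?(ltW T0)//.
  by have := mulr_ge0 A0 (ltW T0); lra.
rewrite divr1 (powR_mulrn 2) ?mulr_ge0 ?sqrtr_ge0// exprMn sqr_sqrtr//.
rewrite [p / 2](_ : _ = m.+2%:R); last by rewrite -gE /g mul1r.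
have KT0 : 0 <= K * T by rewrite mulr_ge0// ltW.
have M0 : 0 <= Num.max K1 K * T by rewrite mulr_ge0 ?(ltW T0)// le_max K10.
rewrite powR_mulrn// exprS.
rewrite (_ : 2 ^+ 2 * _ = (K1 * T) * (K * T) ^+ m.+1); last by rewrite /K1; ring.
apply: ler_pM => //.
- by rewrite mulr_ge0// ltW.
- exact: exprn_ge0.
- by apply: ler_wpM2r; [exact: ltW|rewrite le_max lexx].
- apply: lerXn2r; rewrite ?nnegrE//.
  by apply: ler_wpM2r; [exact: ltW|rewrite le_max lexx orbT].
Qed.

Lemma ckn_dim2 a (p : R) : a < a_c R 2 -> 2 <= p -> ckn_at 2 a p.
Proof.
move=> aac p2.
have [m pm] : exists m : nat, p <= 2 * m.+1%:R.
  exists (Num.truncn p); have h := truncnS_gt p.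
  have h0 : 0 <= (Num.truncn p).+1%:R :> R by [].
  by apply: (le_trans (ltW h)); rewrite ler_peMl// ler1n.
by apply: (ckn_interp (lexx 2) p2 pm); [exact: ckn_hardy|exact: ckn_dim2_even].
Qed.

(** At the critical exponent [2 * g - 2 = p], so the step reads [X <= (C X)^th] with [th < 1], and
    [X] can be absorbed on the left. *)
Lemma ckn_sobolev n a : a < a_c R n.+3 ->
  ckn_at n.+3 a (2 * n.+3%:R / (n.+3%:R - 2)).
Proof.
move=> aac; have [KH [KH0 HH]] := ckn_hardy aac.
pose d : R := n.+3%:R; pose N : R := n.+1%:R.
have N0 : 0 < N by rewrite ltr0n.
have dN : d = N + 2 by rewrite /d /N -natrD addn2.
have nN : n.+2%:R = N + 1 :> R by rewrite /N natr1.
rewrite -/d.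
pose p := 2 * d / (d - 2).
have pE : p = 2 * (N + 2) / N by rewrite /p dN; field; rewrite gt_eqF//.
pose g := p * (n.+2%:R / d); pose s := wexp n.+3 a p * (n.+2%:R / d).
have gE : g = 2 * (N + 1) / N.
  by rewrite /g pE nN dN; field; rewrite !gt_eqF//; lra.
have g2 : 2 <= g by rewrite gE ler_pdivlMr//; lra.
have rp : 2 * g - 2 = p by rewrite gE pE; field; rewrite gt_eqF.
have p2 : 2 <= p by rewrite -rp; lra.
pose A := 2 * s ^+ 2 * KH + 2 * g ^+ 2.
have A0 : 0 < A.
  rewrite /A; have : 0 <= s ^+ 2 * KH by rewrite mulr_ge0 ?sqr_ge0// ltW.
  have : 0 < g ^+ 2 by rewrite exprn_gt0//; lra.
  lra.
exists (d ^+ 2 * A); split; first by rewrite mulr_gt0// exprn_gt0// ltr0n.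
move=> phi T ctphi T0 DT.
have X2 : (Xp a 2 phi <= (KH * T)%:E)%E.
  apply: (le_trans (HH _ _ ctphi T0 DT)).
  by rewrite divff// powRr1// mulr_ge0// ltW.
have Ip := mp_int a ctphi p2.
(* Absorption divides by a power of [X], which is legitimate because [X] is finite for a test
   function. *)
have Xfin : Xp a p phi \is a fin_num by exact: integrable_fin_num Ip.
have [X XE X0] : exists2 X : R, Xp a p phi = X%:E & 0 <= X.
  exists (fine (Xp a p phi)); first by rewrite fineK.
  by apply: fine_ge0; apply: integral_ge0 => x _; rewrite lee_fin mp_ge0.
have Xr : (Xp a (2 * g - 2) phi <= X%:E)%E by rewrite rp XE.
have := @gn_step n.+1 a p (KH * T) T X phi ctphi g2 X2 DT Xr.
rewrite -/p XE !lee_fin -/g -/s -/d.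
have -> : 2 * s ^+ 2 * (KH * T) + 2 * g ^+ 2 * T = A * T by rewrite /A; ring.
have C0 : 0 < d ^+ 2 * A * T by rewrite !mulr_gt0// ?exprn_gt0// ltr0n.
set C := d ^+ 2 * A * T in C0 *.
have [->|Xn0] := eqVneq X 0; first by move=> _; exact: powR_ge0.
have X_0 : 0 < X by rewrite lt0r Xn0.
have -> : d * Num.sqrt (A * T * X) = (C * X) `^ 2^-1.
  rewrite powR12_sqrt; last by rewrite mulr_ge0// ltW.
  rewrite (_ : C * X = d ^+ 2 * (A * T * X)); last by rewrite /C; ring.
  by rewrite [RHS]sqrtrM ?sqr_ge0// sqrtr_sqr ger0_norm.
rewrite -powRrM (_ : 2^-1 * _ = d / (2 * (N + 1))); last first.
  by rewrite nN; field; rewrite gt_eqF//; lra.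
(* Here [th = d / (2 (d - 1))]. From [X^{1-th} <= C^th] the power [1 / (1 - th)] gives [C] the
   exponent [th / (1 - th) = d / (d - 2) = p / 2]. *)
set th := d / _ => HX.
have th1 : 1 - th = N / (2 * (N + 1)) by rewrite /th dN; field; rewrite gt_eqF//; lra.
have h1 : X `^ (1 - th) <= C `^ th.
  rewrite powRB; last by rewrite (gt_eqF X_0) implybT.
  rewrite powRr1 ?(ltW X_0)//.
  by rewrite ler_pdivrMr ?powR_gt0// -powRM ?(ltW C0) ?(ltW X_0).
have th0 : 0 < 1 - th by rewrite th1 divr_gt0//; lra.
have e1 : (X `^ (1 - th)) `^ (1 - th)^-1 = X.
  by rewrite -powRrM mulfV ?(gt_eqF th0)// powRr1 ?(ltW X_0).
have e2 : (C `^ th) `^ (1 - th)^-1 = C `^ (p / 2).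
  rewrite -powRrM; congr (_ `^ _).
  by rewrite th1 /th dN pE; field; rewrite !gt_eqF//; lra.
rewrite -e1 -e2; apply: ge0_ler_powR => //.
- by rewrite invr_ge0 ltW.
- by rewrite nnegrE powR_ge0.
- by rewrite nnegrE powR_ge0.
Qed.

(** With [g = 2] and [s = 2 * a + 1] the factor [E] is again the Hardy integrand, so the estimate
    closes and bounds [|x|^{-s} phi^2] uniformly by [K * T]. *)
Lemma ckn_dim1 a (p : R) : a < a_c R 1 -> 2 <= p -> ckn_at 1 a p.
Proof.
move=> aac p2; have [KH [KH0 HH]] := ckn_hardy aac.
pose s := 2 * a + 1.
pose K1 := Num.sqrt ((2 * s ^+ 2 * KH + 2 * 2 ^+ 2) * KH).
have A0 : 0 <= 2 * s ^+ 2 * KH + 2 * 2 ^+ 2.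
  by have := mulr_ge0 (sqr_ge0 s) (ltW KH0); lra.
pose K := Num.max K1 KH.
have K0 : 0 < K by rewrite lt_max KH0 orbT.
exists K; split => //.
move=> phi T ctphi T0 DT.
have X2 : (Xp a 2 phi <= (KH * T)%:E)%E.
  apply: (le_trans (HH _ _ ctphi T0 DT)).
  by rewrite divff// powRr1// mulr_ge0// ltW.
have X2' : (\int[rV_measure 1]_x (phi x ^+ 2 * wgt (- (2 * (a + 1))) x)%:E <= (KH * T)%:E)%E.
  by move: X2; rewrite /Xp; under eq_integral do rewrite mp2.
have two : 2 <= 2 :> R by [].
have X2'' : (\int[rV_measure 1]_x (`|phi x| `^ (2 * 2 - 2) * wgt (2 * a - 2 * s) x)%:E <= (KH * T)%:E)%E.
  move: X2; rewrite /Xp /mp (_ : 2 * 2 - 2 = 2); last by ring.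
  by rewrite (_ : - wexp 1 a 2 = 2 * a - 2 * s)//; rewrite /wexp /a_c /s; field.
have sup x : (wgt (- s) x * `|phi x| `^ 2) <= K * T.
  rewrite -lee_fin.
  apply: (le_trans (loomis_whitney1 (gn_F_meas s ctphi two) (gn_F0 s 2 phi) (gn_le_line s ctphi two) x)).
  apply: (le_trans (gn_F_int (a := a) ctphi two X2' DT X2'')).
  rewrite lee_fin mul1r.
  apply: (@le_trans _ _ (K1 * T)); last by apply: ler_wpM2r; [exact: ltW|rewrite le_max lexx].
  rewrite le_eqVlt; apply/orP; left; apply/eqP.
  rewrite (_ : _ * (KH * T) = ((2 * s ^+ 2 * KH + 2 * 2 ^+ 2) * KH) * T ^+ 2); last by ring.
  rewrite sqrtrM ?mulr_ge0 ?(ltW KH0)//.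
  by rewrite sqrtr_sqr ger0_norm ?(ltW T0).
have KT0 : 0 < K * T by rewrite mulr_gt0.
apply: (@le_trans _ _ (((K * T) `^ ((p - 2) / 2))%:E * Xp a 2 phi)%E).
  rewrite /Xp -integralZl//; last exact: mp_int.
  apply: le_integral => //; first exact: mp_int.
    by apply: integrableZl => //; exact: mp_int.
  move=> x _; rewrite -EFinM lee_fin.
  have [f0|f0] := eqVneq (phi x) 0.
    by rewrite mp_zero ?mulr_ge0 ?powR_ge0 ?mp_ge0// gt_eqF//; lra.
  have x0 := c1test_neq0 ctphi f0.
  have tD (t : R) (y z : R) : t != 0 -> t `^ (y + z) = t `^ y * t `^ z.
    by move=> t0; rewrite powRD// t0 implybT.
  (* The integrand for [p] is a power of the uniformly bounded quantity times the Hardy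
     integrand. *)
  have -> : mp a p phi x = (wgt (- s) x * `|phi x| `^ 2) `^ ((p - 2) / 2) * mp a 2 phi x.
    have e1 : wgt (- s * ((p - 2) / 2)) x * wgt (- wexp 1 a 2) x = wgt (- wexp 1 a p) x.
      by rewrite -wgtD//; congr (wgt _ _); rewrite /wexp /a_c /s; field.
    have e2 : `|phi x| `^ (2 * ((p - 2) / 2)) * `|phi x| `^ 2 = `|phi x| `^ p.
      by rewrite -tD ?normr_eq0//; congr (_ `^ _); field.
    by rewrite powRM ?wgt_ge0 ?powR_ge0// wgt_powR -[(_ `^ 2) `^ _]powRrM /mp -e1 -e2; ring.
  apply: ler_wpM2r; first exact: mp_ge0.
  apply: ge0_ler_powR => //; rewrite ?nnegrE.
  - by rewrite divr_ge0// subr_ge0.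
  - by rewrite mulr_ge0 ?wgt_ge0 ?powR_ge0.
  - exact: ltW.
apply: (@le_trans _ _ (((K * T) `^ ((p - 2) / 2))%:E * (KH * T)%:E)%E).
  by apply: lee_wpmul2l => //; rewrite lee_fin powR_ge0.
rewrite -EFinM lee_fin (_ : p / 2 = (p - 2) / 2 + 1); last by field.
rewrite powRD ?(gt_eqF KT0) ?implybT// powRr1 ?(ltW KT0)//.
apply: ler_wpM2l; first exact: powR_ge0.
by apply: ler_wpM2r; [exact: ltW|rewrite le_max lexx orbT].
Qed.

Lemma ckn_test d a b (p : R) : admissible d a b p -> ckn_at d a p.
Proof.
case: d => [|[|[|n]]] [// _ [p2 [pS [_ [aac _]]]]].
- exact: ckn_dim1.
- exact: ckn_dim2.
- apply: (ckn_interp (lexx 2) p2 (pS _)) => //; first exact: ckn_hardy.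
  exact: ckn_sobolev.
Qed.

End CKNTest.

(** * Passage to limits of test functions *)

Section Approx.
Context {R : realType} (d : nat).
Local Notation mu := (rV_measure d).
Implicit Types (u phi : 'rV[R]_d -> R) (G : 'rV[R]_d -> 'rV[R]_d).

Definition mfun_BV u := measurable_fun setT (u : BV R d -> R).
Definition mvec G := forall j, mfun_BV (fun x => G x ord0 j).

Lemma mfun_wgt s : mfun_BV (wgt s).
Proof.
apply: (@measurableT_comp _ _ _ _ _ _ (@powR R ^~ s) _ (@enorm R d : BV R d -> R)).
  exact: measurable_powR.
by apply: continuous_measurable_BV; exact: enorm_continuous.
Qed.

Lemma mfun_sqnorm G : mvec G -> mfun_BV (fun x => sqnorm (G x)).
Proof.
move=> mG; apply: (@measurable_sum _ _ _ _ _ _ (fun (i : 'I_d) (x : BV R d) => G x ord0 i ^+ 2)).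
by move=> i; apply: measurable_funX; exact: mG.
Qed.

Lemma mfun_dotp G H : mvec G -> mvec H -> mfun_BV (fun x => dotp (G x) (H x)).
Proof.
move=> mG mH; apply: (@measurable_sum _ _ _ _ _ _ (fun (i : 'I_d) (x : BV R d) => G x ord0 i * H x ord0 i)).
by move=> i; apply: measurable_funM; [exact: mG|exact: mH].
Qed.

Lemma mvecB G H : mvec G -> mvec H -> mvec (fun x => G x - H x).
Proof.
move=> mG mH j; rewrite (_ : (fun x => _) = (fun x => G x ord0 j - H x ord0 j)); last first.
  by apply/funext => x; rewrite !mxE.
by apply: measurable_funB; [exact: mG|exact: mH].
Qed.

Lemma c1test_mfun phi : c1test phi -> mfun_BV phi.
Proof. by move=> /c1test_continuous; exact: continuous_measurable_BV. Qed.

Lemma c1test_mvec phi : c1test phi -> mvec (grad phi).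
Proof.
move=> [_ c1 _] j; rewrite (_ : (fun x => _) = pderiv j phi); last first.
  by apply/funext => x; rewrite mxE.
exact: continuous_measurable_BV.
Qed.

Lemma mfun_mp a p u : mfun_BV u -> mfun_BV (mp a p u).
Proof.
move=> mu_; apply: measurable_funM; last exact: mfun_wgt.
by apply: (measurableT_comp (measurable_powR _)); apply: measurableT_comp.
Qed.

Definition DG a G : \bar R := (\int[mu]_x (sqnorm (G x) * wgt (- (2 * a)) x)%:E)%E.
Definition L2 a u : \bar R := (\int[mu]_x (u x ^+ 2 * wgt (- (2 * (a + 1))) x)%:E)%E.

(** Convergence in the completion, phrased with one tolerance for both integrals instead of a
    sequence. *)
Definition approx a u G := forall eps : R, 0 < eps -> exists phi, c1test phi /\
  (DG a (fun x => grad phi x - G x)%R <= eps%:E)%E /\ (L2 a (fun x => phi x - u x)%R <= eps%:E)%E.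

Lemma DG_ge0 a G : (0 <= DG a G)%E.
Proof. by apply: integral_ge0 => x _; rewrite lee_fin mulr_ge0 ?sqnorm_ge0 ?wgt_ge0. Qed.

Lemma Xp_ge0 a p u : (0 <= Xp a p u)%E.
Proof. by apply: integral_ge0 => x _; rewrite lee_fin mp_ge0. Qed.

Lemma mfun_DG a G : mvec G -> measurable_fun setT (fun x : BV R d => (sqnorm (G x) * wgt (- (2 * a)) x)%:E).
Proof.
by move=> mG; apply: measurable_EFin_fun; apply: measurable_funM; [exact: mfun_sqnorm|exact: mfun_wgt].
Qed.

Lemma mfun_L2 a u : mfun_BV u -> measurable_fun setT (fun x : BV R d => (u x ^+ 2 * wgt (- (2 * (a + 1))) x)%:E).
Proof.
move=> mG; apply: measurable_EFin_fun; apply: measurable_funM; last exact: mfun_wgt.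
exact: measurable_funX.
Qed.

Lemma sqnormD_le (x y : 'rV[R]_d) : sqnorm x <= 2 * sqnorm y + 2 * sqnorm (y - x).
Proof.
rewrite /sqnorm !mulr_sumr -big_split /=; apply: ler_sum => i _; rewrite !mxE.
rewrite -subr_ge0 (_ : _ - _ = (x ord0 i - 2 * y ord0 i) ^+ 2) ?sqr_ge0//; ring.
Qed.

Lemma sqnormB (x y : 'rV[R]_d) : sqnorm (x - y) = sqnorm (y - x).
Proof. by apply: eq_bigr => i _; rewrite !mxE -sqrrN opprB. Qed.

Lemma DG_triangle a G H : mvec G -> mvec H ->
  (DG a G <= 2%:E * DG a H + 2%:E * DG a (fun x => H x - G x)%R)%E.
Proof.
move=> mG mH; have mHG := mvecB mH mG.
have nn G' x : (0 <= (sqnorm (G' x) * wgt (- (2 * a)) x)%:E :> \bar R)%E.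
  by rewrite lee_fin mulr_ge0 ?sqnorm_ge0 ?wgt_ge0.
have Z G' : mvec G' -> (2%:E * DG a G' = \int[mu]_x (2%:E * (sqnorm (G' x) * wgt (- (2 * a)) x)%:E))%E.
  by move=> mG'; rewrite ge0_integralZl//; exact: mfun_DG.
rewrite !Z// -ge0_integralD//; last 4 first.
- by move=> x _; rewrite mule_ge0// nn.
- by apply: measurable_funeM; exact: mfun_DG.
- by move=> x _; rewrite mule_ge0// (nn (fun x => H x - G x)).
- by apply: measurable_funeM; exact: mfun_DG.
apply: ge0_le_integral => //.
- exact: mfun_DG.
- by apply: emeasurable_funD; apply: measurable_funeM; exact: mfun_DG.
move=> x _; rewrite -!EFinM -EFinD lee_fin !mulrA -mulrDl.
by apply: ler_wpM2r; [exact: wgt_ge0|exact: sqnormD_le].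
Qed.

Lemma c1test_DG a phi : c1test phi -> (DG a (grad phi) < +oo)%E.
Proof.
move=> ctphi; have := c1test_intD a ctphi.
by move=> /(integrable_fin_num measurableT); rewrite ge0_fin_numE// DG_ge0.
Qed.

Lemma approx_fin a u G : mvec G -> approx a u G -> DG a G \is a fin_num.
Proof.
move=> mG /(_ 1 ltr01) [phi [ctphi [h _]]].
rewrite ge0_fin_numE ?DG_ge0//; apply: (le_lt_trans (DG_triangle a mG (c1test_mvec ctphi))).
apply: lte_add_pinfty; apply: lte_mul_pinfty => //; first exact: c1test_DG.
by apply: (le_lt_trans h); rewrite ltry.
Qed.


(* Truncating by [M] times the Hardy weight lets L^2 convergence control the
   L^p integrand of the limit [t] by that of the test function [f]; [M] is then
   sent to infinity by monotone convergence. *)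
Lemma min_pointwise a (p M f t : R) (x : 'rV[R]_d) : 2 <= p -> 0 <= M ->
  Num.min (2 `^ (- p) * (`|t| `^ p * wgt (- wexp d a p) x)) (M * (t ^+ 2 * wgt (- (2 * (a + 1))) x))
  <= `|f| `^ p * wgt (- wexp d a p) x + 4 * M * ((f - t) ^+ 2 * wgt (- (2 * (a + 1))) x).
Proof.
move=> p2 M0; have W1 := wgt_ge0 (- wexp d a p) x; have W2 := wgt_ge0 (- (2 * (a + 1))) x.
have p0 : 0 <= p by lra.
have [ft|ft] := leP (`|t| / 2) `|f|.
  rewrite ge_min; apply/orP; left.
  apply: (@le_trans _ _ (`|f| `^ p * wgt (- wexp d a p) x)); last first.
    by rewrite lerDl; apply: mulr_ge0; [rewrite mulr_ge0|rewrite mulr_ge0 ?sqr_ge0].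
  rewrite mulrA; apply: ler_wpM2r => //.
  have -> : 2 `^ (- p) * `|t| `^ p = (`|t| / 2) `^ p.
    by rewrite powRM// -powR_inv1// -powRrM mulN1r mulrC.
  by apply: ge0_ler_powR; rewrite ?nnegrE ?divr_ge0.
rewrite ge_min; apply/orP; right.
apply: (@le_trans _ _ (4 * M * ((f - t) ^+ 2 * wgt (- (2 * (a + 1))) x))); last first.
  by rewrite lerDr mulr_ge0 ?powR_ge0.
rewrite -(mulrC M) -[leRHS]mulrA; apply: ler_wpM2l => //.
rewrite mulrA; apply: ler_wpM2r => //.
have h : `|t| / 2 <= `|f - t|.
  have : `|t| <= `|f| + `|f - t|.
    rewrite [X in `|X| <= _](_ : t = f - (f - t)); last by ring.
    exact: ler_normB.
  lra.
have : (`|t| / 2) ^+ 2 <= `|f - t| ^+ 2 by rewrite lerXn2r ?nnegrE ?divr_ge0.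
rewrite exprMn !real_normK ?num_real// exprVn; lra.
Qed.

Lemma ckn_approx a (p : R) : (1 <= d)%N -> 2 <= p -> ckn_at d a p ->
  exists K : R, 0 < K /\ forall u G, mfun_BV u -> mvec G -> approx a u G ->
    (Xp a p u <= ((K * fine (DG a G)) `^ (p / 2))%:E)%E.
Proof.
(* One factor 4 comes from the energy bound [2 * D + e] with [e = 2 * D]; the other from undoing
   [2^{-p}], since [2^p = 4^{p/2}]. *)
move=> d1 p2 [K [K0 HK]]; exists (16 * K); split; first by rewrite mulr_gt0.
move=> u G mu_ mG apx.
have DGf := approx_fin mG apx.
set D := fine (DG a G); have D0 : 0 <= D by apply: fine_ge0; exact: DG_ge0.
pose A x := 2 `^ (- p) * mp a p u x.
pose B x := u x ^+ 2 * wgt (- (2 * (a + 1))) x.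
have A0 x : 0 <= A x by rewrite mulr_ge0 ?powR_ge0 ?mp_ge0.
have B0 x : 0 <= B x by rewrite mulr_ge0 ?sqr_ge0 ?wgt_ge0.
have mA : mfun_BV A by apply: measurable_funM => //; exact: mfun_mp.
have mB : mfun_BV B by apply: measurable_funM; [exact: measurable_funX|exact: mfun_wgt].
have step1 (M e : R) : 0 <= M -> 0 < e ->
   (\int[mu]_x (Num.min (A x) (M * B x))%:E <= ((K * (2 * D + e)) `^ (p / 2))%:E)%E.
  move=> M0 e0; apply/lee_addgt0Pr => k k0.
  (* The first entry keeps the energy of [phi] below [2 * D + e]; the second makes the error term
     [4 * M * eps] at most [k]. *)
  pose eps := Num.min (e / 2) (k / (4 * M + 1)).
  have M1 : 0 < 4 * M + 1 by lra.
  have eps0 : 0 < eps by rewrite lt_min !divr_gt0.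
  have [phi [ctphi [h1 h2]]] := apx _ eps0.
  have T0 : 0 < 2 * D + e by lra.
  have DT : (Dp a phi <= (2 * D + e)%:E)%E.
    apply: (le_trans (DG_triangle a (c1test_mvec ctphi) mG)).
    have -> : DG a G = D%:E by rewrite /D fineK.
    have h3 : (DG a (fun x => G x - grad phi x)%R <= (e / 2)%:E)%E.
      apply: (@le_trans _ _ eps%:E); last by rewrite lee_fin ge_min lexx.
      apply: le_trans h1; rewrite le_eqVlt; apply/orP; left; apply/eqP.
      by apply: eq_integral => x _; rewrite sqnormB.
    rewrite (EFinD (2 * D) e) (EFinM 2 D) (_ : e%:E = 2%:E * (e / 2)%:E)%E; last first.
      by rewrite -EFinM; congr EFin; field.
    by apply: leeD => //; apply: lee_wpmul2l.
  have Xphi := HK _ _ ctphi T0 DT.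
  have mphi := c1test_mfun ctphi.
  have mf2 : mfun_BV (fun x => phi x - u x) by exact: measurable_funB.
  apply: (@le_trans _ _ (Xp a p phi + (4 * M)%:E * L2 a (fun x => phi x - u x)%R)%E).
    have nn2 x : (0 <= ((phi x - u x) ^+ 2 * wgt (- (2 * (a + 1))) x)%:E)%E.
      by rewrite lee_fin mulr_ge0 ?sqr_ge0 ?wgt_ge0.
    rewrite /Xp /L2 -ge0_integralZl ?lee_fin//; last 2 first.
    - exact: (mfun_L2 a mf2).
    - by rewrite mulr_ge0.
    rewrite -ge0_integralD//; last 4 first.
    - by move=> x _; rewrite lee_fin mp_ge0.
    - by apply: measurable_EFin_fun; exact: mfun_mp.
    - by move=> x _; rewrite mule_ge0// lee_fin mulr_ge0.
    - by apply: measurable_funeM; exact: (mfun_L2 a mf2).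
    apply: ge0_le_integral => //.
    - by move=> x _; rewrite lee_fin le_min A0 mulr_ge0.
    - apply: measurable_EFin_fun; apply: measurable_minr => //.
      exact: measurable_funM.
    - apply: emeasurable_funD; first by apply: measurable_EFin_fun; exact: mfun_mp.
      by apply: measurable_funeM; exact: (mfun_L2 a mf2).
    by move=> x _; rewrite -EFinM -EFinD lee_fin; exact: min_pointwise.
  apply: leeD => //; apply: (@le_trans _ _ ((4 * M)%:E * eps%:E)%E).
    by apply: lee_wpmul2l => //; rewrite lee_fin mulr_ge0.
  rewrite -EFinM lee_fin; apply: (@le_trans _ _ (4 * M * (k / (4 * M + 1)))).
    by apply: ler_wpM2l; [rewrite mulr_ge0|rewrite ge_min lexx orbT].
  rewrite mulrA ler_pdivrMr//; nra.
have step2 (e : R) : 0 < e ->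
   (\int[mu]_x (A x)%:E <= ((K * (2 * D + e)) `^ (p / 2))%:E)%E.
  move=> e0.
  pose hn (n : nat) (x : BV R d) := (Num.min (A x) (n%:R * B x))%:E.
  have mhn n : measurable_fun setT (hn n).
    apply: measurable_EFin_fun; apply: measurable_minr => //; exact: measurable_funM.
  have hn0 n x : (0 <= hn n x)%E by rewrite lee_fin le_min A0 mulr_ge0.
  have ndh x : {homo hn ^~ x : n m / (n <= m)%N >-> (n <= m)%E}.
    move=> n m nm; rewrite lee_fin le_min ge_min lexx /= ge_min; apply/orP; right.
    by apply: ler_wpM2r => //; rewrite ler_nat.
  have cvh x : cvgn (hn ^~ x) by apply: ereal_nondecreasing_is_cvgn; exact: ndh.
  have cv x : x != 0 -> hn ^~ x @ \oo --> (A x)%:E.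
    move=> x0; apply: cvg_near_cst; have [Bx|Bx] := eqVneq (B x) 0.
      have ux : u x = 0.
        move/eqP : Bx; rewrite mulf_eq0 (gt_eqF (wgt_gt0 _ x0)) orbF sqrf_eq0.
        by move/eqP.
      have Ax : A x = 0 by rewrite /A mp_zero ?mulr0// gt_eqF//; lra.
      by near=> n; rewrite /hn Ax Bx mulr0 minxx.
    near=> n; rewrite /hn min_l// -ler_pdivrMr; last by rewrite lt0r Bx B0.
    by near: n; exact: nbhs_infty_ger.
  apply: (@le_trans _ _ (limn (fun n => \int[mu]_x hn n x)%E)).
    rewrite -monotone_convergence//.
    apply: ae_ge0_le_integral => //.
    - by move=> x _; rewrite lee_fin.
    - exact: measurable_EFin_fun.
    - by move=> x _; apply: lime_ge => //; apply: nearW => n; exact: hn0.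
    - by apply: (emeasurable_fun_cvg hn) => // x _; exact: cvh.
    have [N [mN N0 sub]] := ae_neq0 (R := R) d1.
    exists N; split => // x /= nQ; apply: sub => /= x0; apply: nQ => _.
    by rewrite (cvg_lim _ (cv _ x0)).
  apply: lime_le; last by apply: nearW => n; exact: step1.
  apply: ereal_nondecreasing_is_cvgn => n m nm; apply: ge0_le_integral => //.
  by move=> x _; exact: ndh.
have p20 : 0 < p / 2 by lra.
have step3 : (\int[mu]_x (A x)%:E <= ((K * (4 * D)) `^ (p / 2))%:E)%E.
  (* For positive energy take [e = 2 * D]. For zero energy, [e] is chosen so that the bound of
     [step2] is exactly [k], an arbitrary positive number. *)
  have [D00|Dn0] := eqVneq D 0; last first.
    have D20 : 0 < 2 * D by rewrite mulr_gt0// lt0r Dn0.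
    by have := step2 _ D20; rewrite (_ : 2 * D + 2 * D = 4 * D)//; ring.
  apply/lee_addgt0Pr => k k0; apply: (@le_trans _ _ k%:E); last first.
    by rewrite -EFinD lee_fin lerDr powR_ge0.
  have e0 : 0 < k `^ (p / 2)^-1 / K by rewrite divr_gt0// powR_gt0.
  have := step2 _ e0; rewrite D00 mulr0 add0r mulrC divfK ?gt_eqF//.
  by rewrite -powRrM mulVf ?gt_eqF// powRr1 ?(ltW k0).
have AE : (\int[mu]_x (A x)%:E = (2 `^ (- p))%:E * Xp a p u)%E.
  rewrite /Xp -ge0_integralZl//; first by apply: measurable_EFin_fun; exact: mfun_mp.
  - by move=> x _; rewrite lee_fin mp_ge0.
have -> : Xp a p u = ((2 `^ p)%:E * \int[mu]_x (A x)%:E)%E.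
  rewrite AE muleA -EFinM powRN mulfV ?mul1e// gt_eqF// powR_gt0//.
rewrite (_ : 16 * K * D = 2 ^+ 2 * (K * (4 * D))); last by ring.
have KD0 : 0 <= K * (4 * D) by rewrite mulr_ge0 ?mulr_ge0 ?(ltW K0).
rewrite powRM// EFinM -powR_mulrn// -powRrM (_ : 2%:R * (p / 2) = p); last by field.
by apply: lee_wpmul2l; rewrite ?lee_fin ?powR_ge0.
Unshelve. all: by end_near. Qed.

End Approx.

(** * From the integrals and function space of the statement to [rV_measure] *)

Section Bridge.
Context {R : realType} (d : nat).
Local Notation mu := (rV_measure d).
Implicit Types (u phi : 'rV[R]_d -> R) (G : 'rV[R]_d -> 'rV[R]_d).

Lemma nnintE u : mfun_BV u -> (forall x, 0 <= u x) ->
  nnint u = (\int[mu]_x (u x)%:E)%E.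
Proof.
move=> mu_ u0; rewrite /nnint iintE//; first exact: measurable_EFin_fun.
Qed.

Lemma sintE u : mfun_BV u -> sint u = (\int[mu]_x (u x)%:E)%E.
Proof.
move=> mu_; rewrite /sint integralE; congr (_ - _)%E.
  rewrite nnintE; first by apply: eq_integral => x _; rewrite funeposE EFin_max.
  - by apply: measurable_maxr.
  - by move=> x; rewrite le_max lexx orbT.
rewrite nnintE; first by apply: eq_integral => x _; rewrite funenegE EFin_max.
- by apply: measurable_maxr => //; exact: measurable_funN.
- by move=> x; rewrite le_max lexx orbT.
Qed.

Lemma mfun_eq_off0 (f g : 'rV[R]_d -> R) : mfun_BV g ->
  (forall x, x != 0 -> f x = g x) -> mfun_BV f.
Proof.
move=> mg fg; rewrite /mfun_BV (_ : f = (fun x => if x == 0 then f 0 else g x)); last first.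
  by apply/funext => x; case: eqP => [->//|/eqP]; exact: fg.
apply: measurable_fun_ifT => //; apply: (measurable_fun_bool true).
rewrite setTI (_ : _ @^-1` _ = [set (0 : 'rV[R]_d)]); first exact: measurable_rV_set1.
by apply/seteqP; split => x /= /eqP.
Qed.

Lemma integral_eq_off0 (f g : 'rV[R]_d -> R) : (1 <= d)%N -> mfun_BV g ->
  (forall x, x != 0 -> f x = g x) ->
  (\int[mu]_x (f x)%:E = \int[mu]_x (g x)%:E)%E.
Proof.
move=> d1 mg fg; have mf := mfun_eq_off0 mg fg.
apply: ae_eq_integral => //; try exact: measurable_EFin_fun.
have [N [mN N0 sub]] := ae_neq0 (R := R) d1.
by exists N; split => // x /= nQ; apply: sub => /= x0; apply: nQ => _; rewrite fg.
Qed.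

Lemma cvge0_le (X : nat -> \bar R) (eps : R) : X @ \oo --> 0%E -> 0 < eps ->
  \forall n \near \oo, (X n <= eps%:E)%E.
Proof.
move=> /fine_cvgP[fX cX] e0.
have h : \forall n \near \oo, `|fine (X n)| < eps.
  by move/cvgr0Pnorm_lt : cX => /(_ _ e0).
near=> n; have fXn : X n \is a fin_num by near: n.
rewrite -(fineK fXn) lee_fin (le_trans (ler_norm _))// ltW//.
by near: n.
Unshelve. all: by end_near. Qed.

(** Approximation by smooth test functions is kept beside [approx], because the weak equation is
    given only against [testfun]. *)
Definition tapprox a u G := forall eps : R, 0 < eps -> exists phi, testfun phi /\
  (DG a (fun x => grad phi x - G x)%R <= eps%:E)%E /\ (L2 a (fun x => phi x - u x)%R <= eps%:E)%E.

Lemma inDP a u G : inD a u G -> [/\ mfun_BV u, mvec G & tapprox a u G].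
Proof.
move=> [/borel_funE mu_ [mG [phi [tphi [c1 c2]]]]].
have {}mG : mvec G by move=> j; apply/borel_funE; exact: mG.
split => // eps e0.
have h1 := cvge0_le c1 e0; have h2 := cvge0_le c2 e0.
have [n [k1 k2]] : exists n, _ /\ _ := filter_ex (filterI h1 h2).
exists (phi n); split => //.
have ct := testfun_c1test (tphi n).
split.
  rewrite /DG -nnintE//.
    apply: measurable_funM; last exact: mfun_wgt.
    by apply: mfun_sqnorm; apply: mvecB => //; exact: c1test_mvec.
  by move=> x; rewrite mulr_ge0 ?sqnorm_ge0 ?wgt_ge0.
rewrite /L2 -nnintE//.
  apply: measurable_funM; last exact: mfun_wgt.
  by apply: measurable_funX; apply: measurable_funB => //; exact: c1test_mfun.
by move=> x; rewrite mulr_ge0 ?sqr_ge0 ?wgt_ge0.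
Qed.

Lemma tapprox_approx a u G : tapprox a u G -> approx a u G.
Proof.
move=> h eps /h [phi [tphi hphi]]; exists phi; split => //; exact: testfun_c1test.
Qed.

Lemma c1testB phi psi : c1test phi -> c1test psi -> c1test (fun x => phi x - psi x) /\
  forall x, grad (fun x => phi x - psi x) x = grad phi x - grad psi x.
Proof.
move=> [d1 c1 [r1 [M1 [r10 a1]]]] [d2 c2 [r2 [M2 [r20 a2]]]].
have pB j x : pderiv j (fun x => phi x - psi x) x = pderiv j phi x - pderiv j psi x.
  by rewrite /pderiv deriveB//; exact: diff_derivable.
split; last by move=> x; apply/rowP => j; rewrite !mxE pB.
split.
- by move=> x; apply: differentiableB.
- move=> j x; rewrite (_ : pderiv j _ = (fun x => pderiv j phi x - pderiv j psi x)); last exact/funext.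
  by apply: continuousB; [exact: c1|exact: c2].
- exists (Num.min r1 r2), (Num.max M1 M2); split; first by rewrite lt_min r10.
  move=> x [|]; rewrite ?lt_min ?gt_max => /andP[h1 h2].
    by rewrite a1 ?a2 ?subrr//; left.
  by rewrite a1 ?a2 ?subrr//; right.
Qed.

(** Lets the inequality for limits be applied to [phi - u], which turns energy convergence into
    weighted L^p convergence. *)
Lemma approxB a u G phi : c1test phi -> approx a u G ->
  approx a (fun x => phi x - u x) (fun x => grad phi x - G x).
Proof.
move=> ct h eps /h [psi [cpsi [h1 h2]]].
have [cB gB] := c1testB ct cpsi.
exists (fun x => phi x - psi x); split => //; split.
  apply: le_trans h1; rewrite le_eqVlt; apply/orP; left; apply/eqP.
  apply: eq_integral => x _; rewrite gB sqnormB; congr (sqnorm _ * _)%:E.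
  by rewrite opprB addrC addrA subrK.
apply: le_trans h2; rewrite le_eqVlt; apply/orP; left; apply/eqP.
apply: eq_integral => x _; congr (_ * _)%:E.
rewrite -sqrrN; congr (_ ^+ 2); ring.
Qed.

End Bridge.

Lemma fine_fin_gt0 (R : realType) (X : \bar R) :
  X \is a fin_num -> (0 < X)%E -> 0 < fine X.
Proof. by case: X. Qed.

(** * The optimal constant and the extended weak equation *)

Section Final.
Context {R : realType} (d : nat).
Local Notation mu := (rV_measure d).
Implicit Types (u phi : 'rV[R]_d -> R) (G : 'rV[R]_d -> 'rV[R]_d).

Lemma admissible_wexp (a b p : R) : admissible d a b p -> b * p = wexp d a p.
Proof.
move=> [_ [p2 [_ [-> _]]]]; rewrite /wexp mulrDl divfK//.
by rewrite gt_eqF//; lra.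
Qed.

Lemma nnint_Xp (a b p : R) u : b * p = wexp d a p -> mfun_BV u ->
  nnint (fun x => `|u x| `^ p * wgt (- (b * p)) x) = Xp a p u.
Proof.
move=> -> mu_; rewrite nnintE//; first exact: mfun_mp.
by move=> x; exact: mp_ge0.
Qed.

Lemma nnint_DG (a : R) G : mvec G ->
  nnint (fun x => sqnorm (G x) * wgt (- (2 * a)) x) = DG a G.
Proof.
move=> mG; rewrite nnintE//.
  by apply: measurable_funM; [exact: mfun_sqnorm|exact: mfun_wgt].
by move=> x; rewrite mulr_ge0 ?sqnorm_ge0 ?wgt_ge0.
Qed.

Lemma Xp_fin (a p K : R) u G : (Xp a p u <= ((K * fine (DG a G)) `^ (p / 2))%:E)%E ->
  Xp a p u \is a fin_num.
Proof. by move=> h; rewrite ge0_fin_numE ?Xp_ge0// (le_lt_trans h)// ltry. Qed.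

(** The infimum is finite because [K] is an admissible constant, and positive because a nonzero [u0]
    forces every admissible constant above a positive quotient. It is itself admissible since each
    such quotient is a lower bound. *)
Lemma Cab_spec (a b p : R) u0 G0 : admissible d a b p -> inD a u0 G0 ->
  (0 < Xp a p u0)%E ->
  0 < Cab d a b p /\ forall u G, inD a u G ->
    fine (Xp a p u) `^ (2 / p) <= Cab d a b p * fine (DG a G).
Proof.
move=> adm inD0 X0.
have bp := admissible_wexp adm; have [d1 [p2 _]] := adm.
have p0 : 0 < p by lra.
have p2i : p / 2 * (2 / p) = 1 by field; rewrite gt_eqF.
have [K [K0 HK]] := ckn_approx d1 p2 (ckn_test adm).
rewrite /Cab; set S := [set C : R | _].
have SP C : S C <-> forall u G, inD a u G ->
    fine (Xp a p u) `^ (2 / p) <= C * fine (DG a G).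
  split=> h u G iD; have := h u G iD; have [mu_ mG /tapprox_approx ap] := inDP iD;
  have Xf := Xp_fin (HK _ _ mu_ mG ap); have Df := approx_fin mG ap;
  rewrite (nnint_Xp bp mu_) (nnint_DG a mG).
    by rewrite -{1}(fineK Xf) -{1}(fineK Df) poweR_EFin -EFinM lee_fin.
  by rewrite -{2}(fineK Xf) -{2}(fineK Df) poweR_EFin -EFinM lee_fin.
have SK : S K.
  apply/SP => u G iD; have [mu_ mG /tapprox_approx ap] := inDP iD.
  have HX := HK _ _ mu_ mG ap; have Xf := Xp_fin HX.
  have KD : 0 <= K * fine (DG a G) by rewrite mulr_ge0 ?(ltW K0)// fine_ge0 ?DG_ge0.
  have e : K * fine (DG a G) = ((K * fine (DG a G)) `^ (p / 2)) `^ (2 / p).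
    by rewrite -powRrM p2i powRr1.
  rewrite [leRHS]e; apply: ge0_ler_powR.
  - by rewrite divr_ge0// ltW.
  - by rewrite nnegrE fine_ge0 ?Xp_ge0.
  - by rewrite nnegrE powR_ge0.
  - by rewrite -lee_fin fineK.
have [mu0 mG0 /tapprox_approx ap0] := inDP inD0.
have Xf0 := Xp_fin (HK _ _ mu0 mG0 ap0).
pose x := fine (Xp a p u0); pose D := fine (DG a G0).
have x0 : 0 < x := fine_fin_gt0 Xf0 X0.
have xp0 : 0 < x `^ (2 / p) by exact: powR_gt0.
(* The energy of [u0] cannot vanish, as [K] times it dominates a positive number. *)
have D0 : 0 < D.
  have := SK; move/SP => /(_ _ _ inD0) h.
  have : 0 < K * D by exact: lt_le_trans xp0 h.
  by rewrite pmulr_rgt0.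
set I := ereal_inf _.
have lb (m : R) : (forall C, S C -> m <= C) -> (m%:E <= I)%E.
  by move=> h; apply: le_ereal_inf_tmp => _ [C SC <-]; rewrite lee_fin; exact: h.
have Ilb C : S C -> (I <= C%:E)%E.
  by move=> SC; apply: ereal_inf_lbound; exists C.
have mI : ((x `^ (2 / p) / D)%:E <= I)%E.
  by apply: lb => C /SP /(_ _ _ inD0) h; rewrite ler_pdivrMr.
have If : I \is a fin_num.
  rewrite fin_numE; apply/andP; split; apply/eqP => e.
    by move: mI; rewrite e.
  by have := Ilb _ SK; rewrite e.
have C0 : 0 < fine I.
  rewrite -lte_fin fineK//; apply: lt_le_trans mI; rewrite lte_fin divr_gt0//.
split => // u G iD.
have [mu_ mG /tapprox_approx ap] := inDP iD.
(* Zero energy admits no quotient; there the inequality for [K] already has right-hand side 0. *)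
have [DG0|DGn0] := eqVneq (fine (DG a G)) 0.
  by move/SP : SK => /(_ _ _ iD); rewrite DG0 !mulr0.
have Dp : 0 < fine (DG a G) by rewrite lt0r DGn0 fine_ge0 ?DG_ge0.
rewrite -ler_pdivrMr// -lee_fin fineK//; apply: lb => C /SP /(_ _ _ iD).
by rewrite ler_pdivrMr.
Qed.

(** Hoelder with exponents p/(p-1) and p, after splitting the weight between the two factors in the
    same proportion. *)
Lemma pairing_bound (a p : R) u z : 2 <= p -> mfun_BV u -> mfun_BV z ->
  (forall x, 0 <= u x) ->
  (\int[mu]_x (wgt (- wexp d a p) x * u x `^ (p - 1) * `|z x|)%:E
   <= Xp a p u `^ ((p - 1) / p) * Xp a p z `^ p^-1)%E.
Proof.
move=> p2 mu_ mz u0.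
have p0 : 0 < p by lra.
have p1 : 0 < p - 1 by lra.
have mU : mfun_BV (fun x => mp a p u x `^ ((p - 1) / p)).
  by apply: (measurableT_comp (measurable_powR _)); exact: mfun_mp.
have mZ : mfun_BV (fun x => mp a p z x `^ p^-1).
  by apply: (measurableT_comp (measurable_powR _)); exact: mfun_mp.
have conj : (p / (p - 1))^-1 + p^-1 = 1 by field; rewrite !gt_eqF.
have H := ge0_hoelder mu mU mZ (fun x => powR_ge0 _ _) (fun x => powR_ge0 _ _)
  (divr_gt0 p0 p1) p0 conj.
have E1 : (\int[mu]_x ((mp a p u x `^ ((p - 1) / p)) `^ (p / (p - 1)))%:E = Xp a p u)%E.
  have e1 : (p - 1) / p * (p / (p - 1)) = 1 by field; rewrite !gt_eqF.
  by apply: eq_integral => x _; rewrite -powRrM e1 powRr1 ?mp_ge0.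
have E2 : (\int[mu]_x ((mp a p z x `^ p^-1) `^ p)%:E = Xp a p z)%E.
  by apply: eq_integral => x _; rewrite -powRrM mulVf ?gt_eqF// powRr1 ?mp_ge0.
apply: (@le_trans _ _ (\int[mu]_x (mp a p u x `^ ((p - 1) / p) * mp a p z x `^ p^-1)%:E)%E); last first.
  apply: (le_trans H); rewrite invf_div le_eqVlt; apply/orP; left; apply/eqP.
  by congr (_ `^ _ * _ `^ _)%E; [exact: E1|exact: E2].
rewrite le_eqVlt; apply/orP; left; apply/eqP.
apply: eq_integral => x _; congr EFin; apply/esym.
rewrite /mp !powRM ?powR_ge0 ?wgt_ge0// !wgt_powR -!powRrM mulfV ?gt_eqF// powRr1//.
rewrite (ger0_norm (u0 x)) (_ : p * ((p - 1) / p) = p - 1); last by field; rewrite gt_eqF.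
rewrite (_ : wgt (- wexp d a p) x = wgt (- wexp d a p * ((p - 1) / p)) x * wgt (- wexp d a p / p) x).
  by ring.
have e : - wexp d a p = - wexp d a p * ((p - 1) / p) + - wexp d a p / p.
  by field; rewrite gt_eqF.
(* At the origin a power splits over a sum of exponents only when the sum is nonzero; when it is
   zero all three weights are 1. *)
have [w0|w0] := eqVneq (wexp d a p) 0.
  by rewrite w0 oppr0 !mul0r !wgt0 mulr1.
by rewrite {1}e /wgt powRD// -e oppr_eq0 (negbTE w0).
Qed.

Lemma dotp_integrable (a : R) G H : mvec G -> mvec H ->
  DG a G \is a fin_num -> DG a H \is a fin_num ->
  mu.-integrable setT (EFin \o (fun x : BV R d => dotp (G x) (H x) * wgt (- (2 * a)) x)) /\
  (`|\int[mu]_x (dotp (G x) (H x) * wgt (- (2 * a)) x)%:E|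
    <= (Num.sqrt (fine (DG a G) * fine (DG a H)))%:E)%E.
Proof.
move=> mG mH fG fH.
have mw := @mfun_wgt R d (- (2 * a)).
have mf : mfun_BV (fun x => dotp (G x) (H x) * wgt (- (2 * a)) x).
  by apply: measurable_funM => //; exact: mfun_dotp.
have mQ G' : mvec G' -> mfun_BV (fun x => sqnorm (G' x) * wgt (- (2 * a)) x).
  by move=> mG'; apply: measurable_funM => //; exact: mfun_sqnorm.
have nn G' x : 0 <= sqnorm (G' x) * wgt (- (2 * a)) x by rewrite mulr_ge0 ?sqnorm_ge0 ?wgt_ge0.
have pw x : (dotp (G x) (H x) * wgt (- (2 * a)) x) ^+ 2 <=
    (sqnorm (G x) * wgt (- (2 * a)) x) * (sqnorm (H x) * wgt (- (2 * a)) x).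
  rewrite mulrACA exprMn -(expr2 (wgt _ _)).
  by apply: ler_wpM2r; [exact: sqr_ge0|exact: dotp_sqr_le].
have le1 : (\int[mu]_x `|dotp (G x) (H x) * wgt (- (2 * a)) x|%:E
    <= (Num.sqrt (fine (DG a G) * fine (DG a H)))%:E)%E.
  apply: (integral_sqrt_le mf (mQ _ mG) (mQ _ mH) (nn G) (nn H) pw).
  - by rewrite -/(DG a G) fineK.
  - by rewrite -/(DG a H) fineK.
split; last exact: le_trans (le_abse_integral _ measurableT (measurable_EFin_fun mf)) le1.
apply/integrableP; split; first exact: measurable_EFin_fun.
by apply: (le_lt_trans le1); rewrite ltry.
Qed.

(** Here [r] is the common value of both pairings at a test function, [r1] and [r2] are their values
    at the limit, and [s] is the energy of the difference. Both errors are of order [t]. *)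
Lemma limit_step (p K t c y s H r r1 r2 : R) :
  0 < p -> 0 < K -> 0 < t -> 0 <= c -> 0 <= y -> 0 <= s -> s <= t ^+ 2 -> 0 <= H ->
  y <= (K * s) `^ (p / 2) ->
  `|r - r1| <= c * y `^ p^-1 -> `|r - r2| <= Num.sqrt (H * s) ->
  `|r1 - r2| <= (c * Num.sqrt K + Num.sqrt H) * t.
Proof.
move=> p0 K0 t0 c0 y0 s0 st H0 yK e1 e2.
have e1' : `|r - r1| <= c * (Num.sqrt K * t).
  apply: (le_trans e1); apply: ler_wpM2l => //.
  apply: (@le_trans _ _ (((K * t ^+ 2) `^ (p / 2)) `^ p^-1)).
    apply: ge0_ler_powR; rewrite ?nnegrE ?powR_ge0 ?invr_ge0 ?(ltW p0)//.
    apply: (le_trans yK); apply: ge0_ler_powR.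
    - by rewrite divr_ge0// ltW.
    - by rewrite nnegrE mulr_ge0// ltW.
    - by rewrite nnegrE mulr_ge0 ?sqr_ge0// ltW.
    - by apply: ler_wpM2l => //; exact: ltW.
  rewrite -powRrM (_ : p / 2 * p^-1 = 2^-1); last by field; rewrite gt_eqF.
  rewrite powR12_sqrt; last by rewrite mulr_ge0 ?sqr_ge0// ltW.
  by rewrite sqrtrM ?(ltW K0)// sqrtr_sqr ger0_norm// ltW.
have e2' : `|r - r2| <= Num.sqrt H * t.
  apply: (le_trans e2); rewrite sqrtrM//.
  apply: ler_wpM2l; first exact: sqrtr_ge0.
  rewrite -[leRHS]ger0_norm ?(ltW t0)// -sqrtr_sqr; exact: ler_wsqrtr.
rewrite (_ : r1 - r2 = (r - r2) - (r - r1)); last by ring.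
apply: (le_trans (ler_normB _ _)); rewrite mulrDl -mulrA addrC; exact: lerD.
Qed.

Section Pairing.
Variables (a p k : R) (u : 'rV[R]_d -> R).
Hypotheses (p2 : 2 <= p) (mu_ : mfun_BV u) (u0 : forall x, 0 <= u x) (k0 : 0 <= k).
Hypothesis Xu : Xp a p u \is a fin_num.
Let h x := k * wgt (- wexp d a p) x * u x `^ (p - 1).
Let c := k * fine (Xp a p u) `^ ((p - 1) / p).

Lemma pairing_mfun : mfun_BV h.
Proof.
apply: measurable_funM; last exact: (measurableT_comp (measurable_powR _) mu_).
by apply: measurable_funM => //; exact: mfun_wgt.
Qed.

Lemma pairing_integrable z : mfun_BV z -> Xp a p z \is a fin_num ->
  mu.-integrable setT (EFin \o (fun x : BV R d => h x * z x)) /\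
  (`|\int[mu]_x (h x * z x)%:E| <= (c * fine (Xp a p z) `^ p^-1)%:E)%E.
Proof.
move=> mz Xz; have mh := pairing_mfun.
have mhz : mfun_BV (fun x => h x * z x) by exact: measurable_funM.
have le1 : (\int[mu]_x `|h x * z x|%:E <= (c * fine (Xp a p z) `^ p^-1)%:E)%E.
  have -> : (\int[mu]_x `|h x * z x|%:E =
      k%:E * \int[mu]_x (wgt (- wexp d a p) x * u x `^ (p - 1) * `|z x|)%:E)%E.
    rewrite -ge0_integralZl//.
    - apply: eq_integral => x _; rewrite -EFinM normrM ger0_norm ?mulr_ge0 ?wgt_ge0 ?powR_ge0//.
      by rewrite /h !mulrA.
    - apply: measurable_EFin_fun; apply: measurable_funM; last exact: measurableT_comp.
      apply: measurable_funM; first exact: mfun_wgt.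
      exact: (measurableT_comp (measurable_powR _) mu_).
    - by move=> x _; rewrite lee_fin !mulr_ge0 ?wgt_ge0 ?powR_ge0.
  apply: (@le_trans _ _ (k%:E * (Xp a p u `^ ((p - 1) / p) * Xp a p z `^ p^-1))%E).
    by apply: lee_wpmul2l; [rewrite lee_fin|exact: pairing_bound].
  by rewrite -{1}(fineK Xu) -{1}(fineK Xz) !poweR_EFin -!EFinM mulrA.
split; last exact: le_trans (le_abse_integral _ measurableT (measurable_EFin_fun mhz)) le1.
apply/integrableP; split; first exact: measurable_EFin_fun.
by apply: (le_lt_trans le1); rewrite ltry.
Qed.

(** Both sides are linear in [z] and continuous for the energy, the left by Hoelder and the
    inequality with constant [K], the right by Cauchy-Schwarz. They agree on test functions. *)
Lemma pairing_eq (K : R) z G H : 0 < K ->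
  (forall u G, mfun_BV u -> mvec G -> approx a u G ->
    (Xp a p u <= ((K * fine (DG a G)) `^ (p / 2))%:E)%E) ->
  mfun_BV z -> mvec G -> tapprox a z G ->
  mvec H -> DG a H \is a fin_num ->
  (forall phi, testfun phi ->
     (\int[mu]_x (h x * phi x)%:E =
      \int[mu]_x (dotp (H x) (grad phi x) * wgt (- (2 * a)) x)%:E)%E) ->
  (\int[mu]_x (h x * z x)%:E = \int[mu]_x (dotp (H x) (G x) * wgt (- (2 * a)) x)%:E)%E.
Proof.
move=> K0 HK mz mG tap mH fH Ht.
have ap := tapprox_approx tap.
have p0 : 0 < p by move: p2; lra.
have Xz := Xp_fin (HK _ _ mz mG ap); have fG := approx_fin mG ap.
have [I1 _] := pairing_integrable mz Xz.
have [I2 _] := dotp_integrable mH mG fH fG.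
have f1 := integrable_fin_num measurableT I1.
have f2 := integrable_fin_num measurableT I2.
set J1 := (\int[mu]_x (h x * z x)%:E)%E in f1 *.
set J2 := (\int[mu]_x (dotp (H x) (G x) * wgt (- (2 * a)) x)%:E)%E in f2 *.
have c0 : 0 <= c by apply: mulr_ge0; [exact: k0|exact: powR_ge0].
pose C := c * Num.sqrt K + Num.sqrt (fine (DG a H)).
have C0 : 0 <= C by apply: addr_ge0; [apply: mulr_ge0|]; rewrite ?sqrtr_ge0.
have key t : 0 < t -> `|fine J1 - fine J2| <= C * t.
  move=> t0; have t20 : 0 < t ^+ 2 by rewrite exprn_gt0.
  have [phi [tphi [D1 _]]] := tap _ t20.
  have ct := testfun_c1test tphi.
  have mphi := c1test_mfun ct.
  have apB := approxB ct ap.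
  have mzB : mfun_BV (fun x => phi x - z x) by exact: measurable_funB.
  have mGB : mvec (fun x => grad phi x - G x) by apply: mvecB => //; exact: c1test_mvec.
  have XB := HK _ _ mzB mGB apB.
  have fB := approx_fin mGB apB.
  have [_ e1] := pairing_integrable mzB (Xp_fin XB).
  have [_ e2] := dotp_integrable mH mGB fH fB.
  have Xphi : Xp a p phi \is a fin_num by exact: (integrable_fin_num measurableT (mp_int a ct p2)).
  have [Iphi _] := pairing_integrable mphi Xphi.
  have fgphi : DG a (grad phi) \is a fin_num.
    by rewrite ge0_fin_numE ?DG_ge0// c1test_DG.
  have [Igphi _] := dotp_integrable mH (c1test_mvec ct) fH fgphi.
  have fP := integrable_fin_num measurableT Iphi.
  have fgP := integrable_fin_num measurableT Igphi.
  have d1 : (\int[mu]_x (h x * (phi x - z x))%:E = \int[mu]_x (h x * phi x)%:E - J1)%E.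
    rewrite -integralB_EFin//; apply: eq_integral => x _.
    by rewrite -EFinB mulrBr.
  have d2 : (\int[mu]_x (dotp (H x) (grad phi x - G x) * wgt (- (2 * a)) x)%:E =
     \int[mu]_x (dotp (H x) (grad phi x) * wgt (- (2 * a)) x)%:E - J2)%E.
    rewrite -integralB_EFin//; apply: eq_integral => x _.
    rewrite -EFinB -mulrBl; congr (_ * _)%:E.
    by rewrite /dotp -sumrB; apply: eq_bigr => i _; rewrite !mxE mulrBr.
  have DGB : fine (DG a (fun x => grad phi x - G x)) <= t ^+ 2 by rewrite -lee_fin fineK.
  have DGB0 : 0 <= fine (DG a (fun x => grad phi x - G x)) by rewrite fine_ge0 ?DG_ge0.
  have XB' : fine (Xp a p (fun x => phi x - z x)) <=
      (K * fine (DG a (fun x => grad phi x - G x))) `^ (p / 2).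
    by rewrite -lee_fin (fineK (Xp_fin XB)).
  move: e1 e2; rewrite d1 d2 -(Ht _ tphi).
  rewrite -(fineK fP) -(fineK f1) -(fineK f2) -!EFinB !abse_EFin !lee_fin => e1 e2.
  exact: (limit_step p0 K0 t0 c0 (fine_ge0 (Xp_ge0 _ _ _)) DGB0 DGB (fine_ge0 (DG_ge0 _ _)) XB' e1 e2).
have e0 : fine J1 - fine J2 = 0.
  apply/eqP; rewrite -normr_le0; apply/ler_addgt0Pr => e e0.
  (* The denominator [C + 1] stays positive even when [C] is 0. *)
  have t0 : 0 < e / (C + 1) by rewrite divr_gt0//; lra.
  apply: (le_trans (key _ t0)); rewrite add0r mulrA ler_pdivrMr; last lra.
  nra.
by rewrite -(fineK f1) -(fineK f2); congr EFin; apply/eqP; rewrite -subr_eq0 e0.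
Qed.

End Pairing.

(** The weight is positive off the origin, so a vanishing integral would force [u = 0] almost
    everywhere. *)
Lemma not_ae_zero_Xp (a p : R) u : (1 <= d)%N -> 0 < p -> mfun_BV u -> not_ae_zero u ->
  (0 < Xp a p u)%E.
Proof.
move=> d1 p0 mu_ nz; rewrite lt0e Xp_ge0 andbT; apply: contra nz => /eqP X0.
have m1 : mfun_BV (fun x => if u x == 0 then 0 else 1 : R).
  apply: measurable_fun_ifT => //; first exact: measurable_fun_eqr.
rewrite nnintE//; last by move=> x; case: ifP.
apply/eqP; rewrite -(integral0 mu setT); apply: ae_eq_integral => //.
  exact: measurable_EFin_fun.
have mX : measurable_fun setT (fun x : BV R d => (mp a p u x)%:E).
  by apply: measurable_EFin_fun; exact: mfun_mp.
have : (\int[mu]_x `|(mp a p u x)%:E| = 0)%E.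
  by rewrite -[RHS]X0; apply: eq_integral => x _; rewrite abse_EFin ger0_norm ?mp_ge0.
move=> /(ae_eq_integral_abs mu measurableT mX) [N [mN N0 sub]].
have [N' [mN' N'0 sub']] := ae_neq0 (R := R) d1.
exists (N `|` N'); split; first exact: measurableU.
  have h := measureU2 (rV_measure d) mN mN'.
  apply/eqP; rewrite -measure_le0; apply: (le_trans h).
  by rewrite [X in (X + _)%E](_ : _ = 0%E)// [X in (_ + X)%E](_ : _ = 0%E)// adde0.
move=> x /= nQ; have [x0|x0] := eqVneq x 0.
  by right; apply: sub'; rewrite /= x0 eqxx.
left; apply: sub => /= hx; apply: nQ => _; case: eqP => // ux.
have := hx I; case => /eqP; rewrite mulf_eq0 (gt_eqF (wgt_gt0 _ x0)) orbF.
by rewrite powR_eq0 normr_eq0 => /andP[/eqP].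
Qed.

End Final.

(** * Closing arithmetic and the duality estimate *)

Lemma integral_scale_mp (R : realType) d (a p k : R) (u : 'rV[R]_d -> R) :
  0 <= k -> mfun_BV u ->
  (\int[rV_measure d]_x (k * mp a p u x)%:E = k%:E * Xp a p u)%E.
Proof.
move=> k0 mu_; under eq_integral do rewrite EFinM.
rewrite ge0_integralZl//.
  by apply: measurable_EFin_fun; exact: mfun_mp.
by move=> x _; rewrite lee_fin mp_ge0.
Qed.

Lemma dotpxx (R : realType) d (x : 'rV[R]_d) : dotp x x = sqnorm x.
Proof. by apply: eq_bigr => i _; rewrite expr2. Qed.

(** The square of [sqrt (C y) - sqrt (x / C)] is nonnegative, and its cross term is free of [C]. *)
Lemma sub_le_sub_of_le_sqrt (R : realType) (C x y z : R) : 0 < C -> 0 <= x -> 0 <= y ->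
  z <= Num.sqrt (x * y) -> z - C^-1 * x <= C * y - z.
Proof.
move=> C0 x0 y0 hz; suff : 2 * Num.sqrt (x * y) <= C * y + C^-1 * x by move: hz; lra.
have e : C * y + C^-1 * x - 2 * Num.sqrt (x * y) =
    (Num.sqrt (C * y) - Num.sqrt (C^-1 * x)) ^+ 2.
  have Cy : 0 <= C * y by rewrite mulr_ge0// ltW.
  have Cx : 0 <= C^-1 * x by rewrite mulr_ge0// invr_ge0 ltW.
  rewrite sqrrB !sqr_sqrtr// -sqrtrM// (_ : C * y * (C^-1 * x) = x * y).
    by rewrite -mulr_natl; ring.
  by field; rewrite gt_eqF.
by rewrite -subr_ge0 e sqr_ge0.
Qed.

(** Squaring the first bound gives [W^2 <= k^2 x^{2/p} <= k^2 C W]; then divide by [W]. *)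
Lemma le_of_le_mul_root (R : realType) (p k C W x : R) : 0 < p -> 0 <= k -> 0 <= C ->
  0 <= W -> W <= k * x `^ p^-1 -> x `^ (2 / p) <= C * W -> W <= k ^+ 2 * C.
Proof.
move=> p0 k0 C0 W0 Wk xC.
have [->|Wn0] := eqVneq W 0; first by rewrite mulr_ge0 ?sqr_ge0.
have Wp : 0 < W by rewrite lt0r Wn0.
rewrite -(ler_pM2r Wp) -expr2 -mulrA.
apply: le_trans (ler_wpM2l (sqr_ge0 k) xC).
have -> : x `^ (2 / p) = (x `^ p^-1) ^+ 2.
  by rewrite -powR_mulrn ?powR_ge0// -powRrM mulrC.
by rewrite -exprMn; apply: lerXn2r => //; rewrite ?nnegrE ?mulr_ge0 ?powR_ge0.
Qed.

Theorem mainTheorem9 (R : realType) (d : nat) (a b p : R)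
  (u : 'rV[R]_d -> R) (Gu : 'rV[R]_d -> 'rV[R]_d)
  (v : 'rV[R]_d -> R) (w : 'rV[R]_d -> R) (Gw : 'rV[R]_d -> 'rV[R]_d) :
  admissible d a b p ->
  let q := p / (p - 1) in
  inD a u Gu ->
  (forall x, 0 <= u x) ->
  not_ae_zero u ->
  let kappa := powR (fine (nnint (fun x => powR `|u x| p * wgt (- (b * p)) x))) p^-1 in
  (forall x, wgt (- (2 * a)) x * v x
             = powR kappa (2 - p) * wgt (- (b * p)) x * powR (u x) (p - 1)) ->
  (* v in L^q(R^d, |x|^{-(2a-b)q} dx) *)
  (nnint (fun x => powR `|v x| q * wgt (- ((2 * a - b) * q)) x)%R < +oo)%E ->
  (* v in L_a(D^{1,2}_a) and w = L_a^{-1} v, i.e. w in D^{1,2}_a with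
     L_a w = v weakly: <v, phi> = int grad w . grad phi |x|^{-2a} *)
  inD a w Gw ->
  (forall phi, testfun phi ->
     sint (fun x => v x * phi x * wgt (- (2 * a)) x)
     = sint (fun x => dotp (Gw x) (grad phi x) * wgt (- (2 * a)) x)) ->
  let C := Cab d a b p in
  let Iv := powR (fine (nnint (fun x => powR `|v x| q * wgt (- ((2 * a - b) * q)) x))) (2 / q) in
  let vLv := fine (sint (fun x => v x * w x * wgt (- (2 * a)) x)) in
  let Du := fine (nnint (fun x => sqnorm (Gu x) * wgt (- (2 * a)) x)) in
  let Iu := powR (fine (nnint (fun x => powR `|u x| p * wgt (- (b * p)) x))) (2 / p) in
  0 <= Iv - C^-1 * vLv /\ Iv - C^-1 * vLv <= C * Du - Iu.
Proof.
move=> adm q iDu u0 nz kappa hv _ iDw hw C Iv vLv Du Iu.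
have bp := admissible_wexp adm; have [d1 [p2 _]] := adm.
have p0 : 0 < p by lra.
have p1 : 0 < p - 1 by lra.
have [mu_ mGu tapu] := inDP iDu; have [mw mGw tapw] := inDP iDw.
have [K [K0 HK]] := ckn_approx d1 p2 (ckn_test adm).
have XuF := Xp_fin (HK _ _ mu_ mGu (tapprox_approx tapu)).
have XwF := Xp_fin (HK _ _ mw mGw (tapprox_approx tapw)).
have DuF := approx_fin mGu (tapprox_approx tapu).
have DwF := approx_fin mGw (tapprox_approx tapw).
have Xu0 := not_ae_zero_Xp a d1 p0 mu_ nz.
have [C0 HC] := Cab_spec adm iDu Xu0; rewrite -/C in C0 HC.
set x := fine (Xp a p u).
have x0 : 0 < x by exact: fine_fin_gt0 XuF Xu0.
have kE : kappa = x `^ p^-1 by rewrite /kappa (nnint_Xp bp mu_).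
have k0 : 0 < kappa by rewrite kE powR_gt0.
have kD (s t : R) : kappa `^ (s + t) = kappa `^ s * kappa `^ t.
  by rewrite powRD// (gt_eqF k0) implybT.
have xE : x = kappa `^ p by rewrite kE -powRrM mulVf ?gt_eqF// powRr1// ltW.
have IuE : Iu = kappa ^+ 2.
  rewrite /Iu (nnint_Xp bp mu_) -/x xE -powRrM -powR_mulrn ?(ltW k0)//; congr (_ `^ _).
  by field; rewrite gt_eqF.
(* [h] is [|x|^{-2a} v] written through [u]; integrals against [v] become integrals against [h]. *)
pose k := kappa `^ (2 - p).
have kge0 : 0 <= k by exact: powR_ge0.
pose h y := k * wgt (- wexp d a p) y * u y `^ (p - 1).
have mh : mfun_BV h := pairing_mfun a p k mu_.
have vh z y : v y * z y * wgt (- (2 * a)) y = h y * z y.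
  by rewrite mulrAC (mulrC (v y)) hv bp.
have sE z : mfun_BV z ->
    sint (fun y => v y * z y * wgt (- (2 * a)) y) = (\int[rV_measure d]_y (h y * z y)%:E)%E.
  move=> mz; rewrite (_ : (fun y => _) = (fun y => h y * z y)); last exact/funext.
  by rewrite sintE//; exact: measurable_funM.
have Ht phi : testfun phi -> (\int[rV_measure d]_y (h y * phi y)%:E =
    \int[rV_measure d]_y (dotp (Gw y) (grad phi y) * wgt (- (2 * a)) y)%:E)%E.
  move=> tphi; have ct := testfun_c1test tphi.
  rewrite -sE ?hw//; last exact: c1test_mfun.
  rewrite sintE//; apply: measurable_funM; last exact: mfun_wgt.
  by apply: mfun_dotp => //; exact: c1test_mvec.
have Pu := pairing_eq p2 mu_ u0 kge0 XuF K0 HK mu_ mGu tapu mGw DwF Ht.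
have Pw := pairing_eq p2 mu_ u0 kge0 XuF K0 HK mw mGw tapw mGw DwF Ht.
set W := fine (DG a Gw).
have W0 : 0 <= W by rewrite fine_ge0 ?DG_ge0.
have PwE : (\int[rV_measure d]_y (h y * w y)%:E = W%:E)%E.
  by rewrite Pw /W fineK//; apply: eq_integral => y _; rewrite dotpxx.
have vLvE : vLv = W by rewrite /vLv sE// PwE.
have DuE : Du = fine (DG a Gu) by rewrite /Du nnint_DG.
have PuE : (\int[rV_measure d]_y (h y * u y)%:E = (kappa ^+ 2)%:E)%E.
  transitivity (k%:E * Xp a p u)%E.
    rewrite -integral_scale_mp//; apply: eq_integral => y _; congr EFin.
    rewrite /h /mp ger0_norm// -(mulr_powRB1 (u0 y) p0); ring.
  rewrite -(fineK XuF) -/x -EFinM xE /k -kD subrK; congr EFin.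
  by rewrite -powR_mulrn// ltW.
have IvE : Iv = kappa ^+ 2.
  have qE : q = p / (p - 1) by [].
  pose g y := kappa `^ ((2 - p) * q) * mp a p u y.
  have mg : mfun_BV g by apply: measurable_funM => //; exact: mfun_mp.
  (* The relation defining [v] is divided by [|x|^{-2a}], which may be 0 at the origin under the
     convention for powers, so the formula for [v] is obtained off the origin only. *)
  have vg y : y != 0 -> `|v y| `^ q * wgt (- ((2 * a - b) * q)) y = g y.
    move=> y0.
    have wD s t : wgt (s + t) y = wgt s y * wgt t y by exact: wgtD.
    have -> : v y = k * wgt (2 * a - b * p) y * u y `^ (p - 1).
      have e : wgt (2 * a) y * wgt (- (2 * a)) y = 1 by rewrite -wD subrr wgt0.
      have -> : wgt (2 * a - b * p) y = wgt (2 * a) y * wgt (- (b * p)) y by exact: wD.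
      by rewrite -(mul1r (v y)) -[X in X * _ = _]e -mulrA hv -/k !mulrA [_ * k]mulrC.
    rewrite ger0_norm ?mulr_ge0 ?wgt_ge0 ?powR_ge0//.
    rewrite !powRM ?mulr_ge0 ?wgt_ge0 ?powR_ge0// wgt_powR.
    rewrite -[(k `^ _)]powRrM -[((u y) `^ _) `^ _]powRrM.
    rewrite (_ : (p - 1) * q = p); last by rewrite qE; field; rewrite gt_eqF.
    rewrite /g /mp ger0_norm// -!mulrA; congr (_ * _); rewrite mulrCA; congr (_ * _).
    rewrite -wD -bp; congr (wgt _ _); rewrite qE; field; rewrite gt_eqF//.
  rewrite /Iv nnintE; last 2 first.
  - exact: mfun_eq_off0 mg vg.
  - by move=> y; rewrite mulr_ge0 ?powR_ge0 ?wgt_ge0.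
  rewrite (integral_eq_off0 d1 mg vg).
  have -> : (\int[rV_measure d]_y (g y)%:E = (kappa `^ ((2 - p) * q))%:E * Xp a p u)%E.
    by rewrite -integral_scale_mp ?powR_ge0.
  rewrite -(fineK XuF) -/x -EFinM /= xE -kD -powRrM -powR_mulrn ?(ltW k0)//.
  (* The exponent of [kappa] is [((2 - p) q + p) (2 / q) = 2 (2 - p) + 2 (p - 1) = 2]. *)
  by congr (_ `^ _); rewrite qE; field; rewrite !gt_eqF.
have [_ bw] := pairing_integrable p2 mu_ u0 kge0 XuF mw XwF.
(* The normalisation by [kappa^{2-p}] makes the dual norm of [h] equal to [kappa]: the exponents add
   up as [(2 - p) + (p - 1) = 1]. *)
have cE : k * x `^ ((p - 1) / p) = kappa.
  rewrite {1}xE -powRrM /k -kD -[RHS]powRr1 ?(ltW k0)//; congr (_ `^ _).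
  by field; rewrite gt_eqF.
have {}bw : W <= kappa * fine (Xp a p w) `^ p^-1.
  by move: bw; rewrite PwE -/x cE abse_EFin lee_fin ger0_norm.
have WC : W <= kappa ^+ 2 * C.
  exact: (le_of_le_mul_root p0 (ltW k0) (ltW C0) W0 bw (HC _ _ iDw)).
rewrite IvE vLvE IuE DuE; split.
  by rewrite subr_ge0 mulrC ler_pdivrMr.
have [_] := dotp_integrable mGw mGu DwF DuF.
rewrite -Pu PuE abse_EFin lee_fin ger0_norm ?sqr_ge0// => hk.
exact: (sub_le_sub_of_le_sqrt C0 W0 (fine_ge0 (DG_ge0 _ _)) hk).
Qed.
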